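(* Let $(\mathcal N,g)$ be a smooth, compact, orientable Riemannian manifold without boundary, isometrically embedded in $\mathbb R^N$, and let $\omega\subset\mathbb T^1$ be a non-empty open set. Let $T_2=6\pi$. Then for any homotopic closed geodesics $\gamma_0,\gamma_1:\mathbb T^1\to\mathcal N$, there is a control $f\in C([0,T_2];L^2(\mathbb T^1))$ such that the flow of the controlled wave maps equation $$\Box\phi-\Pi(\phi)(\partial_\nu\phi,\partial^\nu\phi)=\chi_\omega\,\Pi_T(\phi)f$$ carries the data $(\gamma_0,0)$ at time $t=0$ into $(\gamma_1,0)$ at time $t=T_2$.
   Context: $\mathbb T^1=\mathbb R/2\pi\mathbb Z$. $\Box=-\partial_t^2+\partial_x^2$. $\Pi$ is the second fundamental form of $\mathcal N\subset\mathbb R^N$; $\Pi(\phi)(\partial_\nu\phi,\partial^\nu\phi)=-\Pi(\phi)(\phi_t,\phi_t)+\Pi(\phi)(\phi_x,\phi_x)$. $\Pi_T(\phi)$ is the orthogonal projection of $\mathbb R^N$ onto $T_\phi\mathcal N$; controls $f$ are $\mathbb R^N$-valued. $\chi_\omega$ is the cutoff (indicator function) localizing to $\omega$. Solutions are in $C([0,T_2];\mathcal H(\mathbb T^1;\mathcal N))$, where $\mathcal H(\mathbb T^1;\mathcal N)=\{(\phi,\phi_t):\phi\in H^1(\mathbb T^1;\mathcal N),\ \phi_t\in L^2(\mathbb T^1;\phi^*T\mathcal N)\}$. A closed geodesic means a harmonic map $\gamma:\mathbb T^1\to\mathcal N$, i.e. $\gamma_{xx}-\Pi(\gamma)(\gamma_x,\gamma_x)=0$.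 Two closed geodesics are homotopic if they are homotopic as continuous maps $\mathbb T^1\to\mathcal N$. *)

(* Defs.v *)
From HB Require Import structures.
From mathcomp Require Import all_boot all_order all_algebra.
From mathcomp Require Import all_classical all_reals all_analysis.

Set Implicit Arguments.
Unset Strict Implicit.
Unset Printing Implicit Defensive.

Import Order.TTheory GRing.Theory Num.Theory.
Import numFieldNormedType.Exports.

Local Open Scope classical_set_scope.
Local Open Scope ring_scope.

(** * Smooth functions and the Euclidean structure of R^N *)

Section Smoothness.
Context {R : realType} {V W : normedModType R}.

(* Used only for finite-dimensional [V] and open [A]; there, continuity of all
   iterated directional derivatives of order at most [k] is the usual C^k. *)
Fixpoint Ck (k : nat) (A : set V) (f : V -> W) : Prop :=
  (forall x, A x -> {for x, continuous f}) /\
  (if k is k'.+1 then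
     forall v : V, (forall x, A x -> derivable f x v) /\ Ck k' A ('D_v f)
   else True).

Definition smooth_on (A : set V) (f : V -> W) : Prop := forall k, Ck k A f.

End Smoothness.

(* The library norm on ['rV[R]_N] is the sup norm: it gives the right topology
   but not the right geometry. *)
Definition dotr {R : realType} {N : nat} (u v : 'rV[R]_N) : R :=
  \sum_(i < N) u 0 i * v 0 i.

Definition enorm {R : realType} {N : nat} (u : 'rV[R]_N) : R :=
  Num.sqrt (dotr u u).

(** * Embedded submanifolds of R^N *)

Section Submanifolds.
Context {R : realType} {N : nat}.
Implicit Types (M : set 'rV[R]_N) (p X Y v : 'rV[R]_N).

(* Local parametrization of [M] by an open subset [V] of R^n: an injective
   immersion that is a homeomorphism onto a relatively open subset of [M]
   (last clause: it is open as a map into [M]). Vectors are rows, so the rows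
   of ['J psi y] are the partial derivatives of [psi] at [y]. *)
Definition local_param n M (V : set 'rV[R]_n) (psi : 'rV[R]_n -> 'rV[R]_N) :=
  [/\ open V,
      smooth_on V psi,
      (forall y, V y -> row_free ('J psi y)),
      (forall y z, V y -> V z -> psi y = psi z -> y = z) &
      (forall A, open A -> A `<=` V ->
         exists2 U : set 'rV[R]_N, open U & psi @` A = M `&` U)].

(* Boundaryless, of dimension n; it carries the metric induced by R^N. *)
Definition embedded_submanifold n M :=
  forall p, M p -> exists (V : set 'rV[R]_n) psi y,
    [/\ local_param M V psi, V y & psi y = p].

(* Existence of an oriented atlas. The matrix [A] below is the Jacobian matrix
   at [y] of the change of coordinates from [c] to [c']. *)
Definition orientable n M :=
  exists atlas : set (set 'rV[R]_n * ('rV[R]_n -> 'rV[R]_N)),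
  [/\ (forall c, atlas c -> local_param M c.1 c.2),
      (forall p, M p -> exists c y, [/\ atlas c, c.1 y & c.2 y = p]) &
      (forall c c' y y', atlas c -> atlas c' -> c.1 y -> c'.1 y' ->
         c.2 y = c'.2 y' ->
         exists2 A : 'M[R]_n, 0 < \det A & 'J c.2 y = A *m 'J c'.2 y')].

Definition tangent M p : set 'rV[R]_N :=
  [set v | exists (e : R) (c : R -> 'rV[R]_N),
     [/\ 0 < e,
         smooth_on `]- e, e[%classic c,
         (forall s : R, - e < s < e -> M (c s)),
         c 0 = p &
         derive1 c 0 = v]].

Definition tanproj M p v : 'rV[R]_N :=
  xget 0 [set w | tangent M p w /\
                  forall z, tangent M p z -> dotr (v - w) z = 0].

(* Normal part of the flat derivative [D_X Yt], where [Yt] is any local smooth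
   extension of [Y] that is tangent along [M]; the value does not depend on the
   extension. It is 0 by default when [X] or [Y] is not tangent at [p]. *)
Definition second_ff M p X Y : 'rV[R]_N :=
  xget 0 [set w | tangent M p X /\
    exists (A : set 'rV[R]_N) (Yt : 'rV[R]_N -> 'rV[R]_N),
    [/\ open A /\ A p,
        smooth_on A Yt,
        (forall q, M q -> A q -> tangent M q (Yt q)),
        Yt p = Y &
        w = 'D_X Yt p - tanproj M p ('D_X Yt p)]].

End Submanifolds.

(** * The circle R / 2 pi Z: functions on it are 2pi-periodic functions on R *)

Section Circle.
Context {R : realType}.

Definition period : R := 2 * pi.

Definition circle_set (A : set R) := forall x : R, A (x + period) <-> A x.

Definition circle_measure :=
  mrestr (@lebesgue_measure R) (measurable_itv `[0, period]).

HB.instance Definition _ := Measure.on circle_measure.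

Context {N : nat}.
Implicit Types (M : set 'rV[R]_N) (g u ux : R -> 'rV[R]_N) (f : R -> R -> 'rV[R]_N).

Definition closed_geodesic M g :=
  [/\ periodic g period,
      Ck 2 setT g,
      (forall x, M (g x)) &
      (forall x, derive1 (derive1 g) x
                 - second_ff M (g x) (derive1 g x) (derive1 g x) = 0)].

Definition homotopic M g0 g1 :=
  exists H : R * R -> 'rV[R]_N,
  [/\ {within `[0, 1] `*` setT, continuous H},
      (forall s : R, 0 <= s <= 1 -> periodic (fun x => H (s, x)) period),
      (forall (s x : R), 0 <= s <= 1 -> M (H (s, x))),
      (forall x, H (0, x) = g0 x) &
      (forall x, H (1, x) = g1 x)].

Definition L2_circle u :=
  periodic u period /\
  forall i, (fun x => u x 0 i) \in Lfun circle_measure 2%:E.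

Definition L2norm u : \bar R :=
  'N[circle_measure]_(2%:E)[EFin \o (enorm \o u)]%E.

(* [f t] is the function of [x] at time [t]. *)
Definition C0L2 (T : R) f :=
  (forall t : R, 0 <= t <= T -> L2_circle (f t)) /\
  (forall t0 : R, 0 <= t0 <= T ->
     L2norm (fun x => f t x - f t0 x)
       @[t --> within `[0, T] (nbhs t0)] --> 0%E).

Definition weak_derivative u ux :=
  forall eta : R -> R, smooth_on setT eta -> periodic eta period ->
  forall i, \int[circle_measure]_x (u x 0 i * derive1 eta x) =
            - \int[circle_measure]_x (ux x 0 i * eta x).

(* [u], identified with its continuous representative, is in H^1 with values
   in [M], and its derivative is [ux]. *)
Definition H1_map M u ux :=
  [/\ continuous u,
      (forall x, M (u x)),
      L2_circle u,
      L2_circle ux &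
      weak_derivative u ux].

End Circle.

(** * The controlled wave maps equation *)

Section WaveMaps.
Context {R : realType} {N : nat}.
Implicit Types (M : set 'rV[R]_N) (omega : set R) (T : R).
Implicit Types f phi phix phit : R -> R -> 'rV[R]_N.

(* Compactly supported in (0, T) x (R / 2 pi Z). *)
Definition test_function T (psi : R * R -> R) :=
  [/\ smooth_on setT psi,
      (forall t, periodic (fun x => psi (t, x)) period) &
      exists a b : R, [/\ 0 < a, b < T &
        forall t x, psi (t, x) != 0 -> a <= t <= b]].

(* All the inner integrals below are continuous functions of time for
   functions in the class [energy_class], so iterated integrals suffice. *)
Definition st_integral T (F : R -> R -> R) : R :=
  \int[lebesgue_measure]_(t in `[0, T]) \int[circle_measure]_x F t x.

Definition dt (psi : R * R -> R) (t x : R) : R := 'D_(1, 0) psi (t, x).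
Definition dx (psi : R * R -> R) (t x : R) : R := 'D_(0, 1) psi (t, x).

(* [(phi, phit)] is in C([0,T]; H), with [phix] the x-derivative of [phi] and
   [phit] its (distributional) t-derivative. *)
Definition energy_class M T phi phix phit :=
  [/\ [/\ C0L2 T phi, C0L2 T phix & C0L2 T phit],
      (forall t : R, 0 <= t <= T -> H1_map M (phi t) (phix t)),
      (forall t : R, 0 <= t <= T ->
         {ae circle_measure, forall x, tangent M (phi t x) (phit t x)}) &
      (forall psi, test_function T psi -> forall i,
         st_integral T (fun t x => phi t x 0 i * dt psi t x) =
         - st_integral T (fun t x => phit t x 0 i * psi (t, x)))].

(* Pi(phi)(d_nu phi, d^nu phi), for the Minkowski metric of signature (-, +). *)
Definition null_form M (p pt px : 'rV[R]_N) : 'rV[R]_N :=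
  - second_ff M p pt pt + second_ff M p px px.

(* Distributional form, on (0, T) x (R / 2 pi Z), of
     - phi_tt + phi_xx - Pi(phi)(d_nu phi, d^nu phi) = chi_omega Pi_T(phi) f. *)
Definition wave_map_solution M omega T f phi phix phit :=
  energy_class M T phi phix phit /\
  forall psi, test_function T psi -> forall i,
    st_integral T (fun t x =>
      phit t x 0 i * dt psi t x - phix t x 0 i * dx psi t x
      - null_form M (phi t x) (phit t x) (phix t x) 0 i * psi (t, x)) =
    st_integral T (fun t x =>
      \1_omega x * tanproj M (phi t x) (f t x) 0 i * psi (t, x)).

(* The flow on [0, T] sends the data [(u0, u1)] to [(v0, v1)]. *)
Definition flow_carries M omega T f (u0 u1 v0 v1 : R -> 'rV[R]_N) :=
  exists phi phix phit,
  [/\ wave_map_solution M omega T f phi phix phit,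
      (forall x, phi 0 x = u0 x),
      {ae circle_measure, forall x, phit 0 x = u1 x},
      (forall x, phi T x = v0 x) &
      {ae circle_measure, forall x, phit T x = v1 x}].

End WaveMaps.

(* Main.v *)
(* Let rho be the nearest-point projection onto M, smooth near M, and approximate
   the homotopy by a path K_s of loops near M with K_0 = gamma0 and K_1 = gamma1.
   The solution is phi(t, x) = rho (K_{s(t, x)} (h(t, x))) for scalar functions h and
   s with h(0, x) = h(T, x) = x, s(0, .) = 0 and s(T, .) = 1. Off omega, h first
   solves the linear wave equation while s = 0, so phi = gamma0 o h is a wave map;
   by finite speed of propagation h can become constant there within one period.
   Then s goes from 0 to 1 as a function of x + t alone: a map depending only on
   x + t has zero d'Alembertian. Finally h is run backwards in time with s = 1.
   Inside omega nothing is required: the control is box phi, because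
   box phi - Pi(phi)(d phi, d phi) is the tangential part of box phi, which vanishes
   off omega. *)

(* The position h is a lift to the line: h(t, x + P) = h(t, x) + P for the period P, so a collapsed
   loop cannot be constant everywhere. Off omega it rests at c = m + k P, a lift of the centre m of
   an interval in omega, and all the winding happens inside that interval. This is why the
   intermediate loops K_s need not be geodesics: off omega only the single curve s -> rho (K_s c) is
   seen. The linear waves are explicit. With y = x - c, the deviation of h from x is F(y + t) + B(y
   - t), where each profile passes from 0 to - z / 2 as a function of its argument z, so that the
   sum passes from 0 to - y. The free arc is shorter than P, so each of the three phases fits in one
   period; hence T = 3 P = 6 pi. [tanproj] and [second_ff] are given by a choice operator. Both are
   computed from one object: at p in M, the map v -> 'D_v rho p is the orthogonal projection onto
   the tangent space. Smoothness of rho near M, obtained from an implicit equation, is therefore the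
   geometric basis of everything else. *)
Require Import Defs.
From mathcomp Require Import all_boot all_order all_algebra.
From mathcomp Require Import all_classical all_reals all_analysis.
From mathcomp Require Import measurable_realfun ring lra.

Set Implicit Arguments.
Unset Strict Implicit.
Unset Printing Implicit Defensive.

Import Order.TTheory GRing.Theory Num.Theory.
Import numFieldNormedType.Exports.

Local Open Scope classical_set_scope.
Local Open Scope ring_scope.

(** * Calculus of C^k maps *)

Section CkGeneral.
Context {R : realType} {V W : normedModType R}.
Implicit Types (A B : set V) (f g : V -> W).

Lemma Ck_continuous k A f x : Ck k A f -> A x -> {for x, continuous f}.
Proof. by case: k => [|k] [+ _] Ax; apply. Qed.

Lemma CkW k A f : Ck k.+1 A f -> Ck k A f.
Proof.
elim: k f => [|k IH] f; first by case=> h _; split.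
case=> h1 h2; split=> // v; have [h3 h4] := h2 v; split=> //; exact: IH.
Qed.

Lemma Ck_leq j k A f : (j <= k)%N -> Ck k A f -> Ck j A f.
Proof.
elim: k => [|k IH]; first by rewrite leqn0 => /eqP ->.
by rewrite leq_eqVlt => /predU1P[->//|/IH h] /CkW.
Qed.

Lemma Ck_sub k A B f : A `<=` B -> Ck k B f -> Ck k A f.
Proof.
move=> AB; elim: k f => [|k IH] f [h1 h2]; (split; first by move=> x /AB; exact: h1).
  by [].
by move=> v; have [h3 h4] := h2 v; split; [move=> x /AB; exact: h3|exact: IH].
Qed.

Lemma Ck_derivable k A f x v : Ck k.+1 A f -> A x -> derivable f x v.
Proof. by case=> _ /(_ v)[+ _] Ax; apply. Qed.

Lemma Ck_derive k A f v : Ck k.+1 A f -> Ck k A ('D_v f).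
Proof. by case=> _ /(_ v)[]. Qed.

Lemma open_near A x (P : V -> Prop) : open A -> A x -> (forall y, A y -> P y) ->
  \forall y \near x, P y.
Proof. by move=> oA Ax AP; apply: filterS AP _; exact: open_nbhs_nbhs. Qed.

(** Openness of [A] matters: a derivative at a point of [A] depends on the values in a whole
    neighbourhood. *)
Lemma Ck_eq k A f g : open A -> (forall x, A x -> f x = g x) -> Ck k A f ->
  Ck k A g.
Proof.
move=> oA; elim: k f g => [|k IH] f g fg [h1 h2];
  (have fgn x : A x -> \forall y \near x, f y = g y
    by move=> Ax; exact: (open_near oA Ax fg));
  (have cvg_fg x : A x -> {for x, continuous g}
    by move=> Ax; (have fx : f @ x --> g x by rewrite -fg//; exact: h1);
      apply: cvg_trans fx; apply: near_eq_cvg; exact: fgn).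
- split=> // x Ax; exact: cvg_fg.
- split=> [x Ax|v]; first exact: cvg_fg.
  have [h3 h4] := h2 v; split=> [x Ax|].
    by apply: near_eq_derivable (h3 x Ax); exact: fgn.
  apply: IH h4 => x Ax; apply: near_eq_derive; exact: fgn.
Qed.

Lemma Ck_local k A f :
  (forall x, A x -> exists B, [/\ open B, B x & Ck k B f]) -> Ck k A f.
Proof.
elim: k f => [|k IH] f h; (split; first by move=> x /h[B [_ Bx]] /Ck_continuous; apply)=> // v.
split=> [x /h[B [_ Bx]] /Ck_derivable|]; first exact.
by apply: IH => x /h[B [oB Bx /Ck_derive cB]]; exists B; split.
Qed.

Lemma Ck_cst k A (c : W) : Ck k A (fun=> c).
Proof.
elim: k c => [|k IH] c; (split; first by move=> x _; exact: cst_continuous)=> // v.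
split=> [x _|]; first exact: derivable_cst.
suff -> : 'D_v (fun _ : V => c) = (fun=> 0) by exact: IH.
by apply/funext => x; rewrite derive_cst.
Qed.

Lemma Ck_add k A f g : open A -> Ck k A f -> Ck k A g ->
  Ck k A (fun x => f x + g x).
Proof.
move=> oA; elim: k f g => [|k IH] f g cf cg; (split; first by move=> x Ax; apply: cvgD; [move: cf|move: cg] => /Ck_continuous; exact)=> // v.
have df x : A x -> derivable f x v := @Ck_derivable _ _ _ _ _ cf.
have dg x : A x -> derivable g x v := @Ck_derivable _ _ _ _ _ cg.
split=> [x Ax|]; first exact: derivableD (df x Ax) (dg x Ax).
apply: (Ck_eq oA _ (IH _ _ (Ck_derive v cf) (Ck_derive v cg))) => x Ax.
by rewrite -deriveD; [|exact: df|exact: dg].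
Qed.

Lemma Ck_opp k A f : open A -> Ck k A f -> Ck k A (fun x => - f x).
Proof.
move=> oA; elim: k f => [|k IH] f cf; (split; first by move=> x Ax; apply: cvgN; move: cf => /Ck_continuous; exact)=> // v.
have df x : A x -> derivable f x v := @Ck_derivable _ _ _ _ _ cf.
split=> [x Ax|]; first exact: derivableN (df x Ax).
apply: (Ck_eq oA _ (IH _ (Ck_derive v cf))) => x Ax.
by rewrite -deriveN; [|exact: df].
Qed.

Lemma Ck_sub_fun k A f g : open A -> Ck k A f -> Ck k A g ->
  Ck k A (fun x => f x - g x).
Proof. by move=> oA cf cg; apply: Ck_add => //; exact: Ck_opp. Qed.

Lemma Ck_sum (I : Type) (r : seq I) (P : pred I) k A (F : I -> V -> W) : open A ->
  (forall i, P i -> Ck k A (F i)) -> Ck k A (fun x => \sum_(i <- r | P i) F i x).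
Proof.
move=> oA cF; elim: r => [|i r IH].
  by apply: (Ck_eq oA _ (@Ck_cst k A 0)) => x _; rewrite big_nil.
have [Pi|nPi] := boolP (P i).
  apply: (Ck_eq oA _ (Ck_add oA (cF i Pi) IH)) => x _.
  by rewrite big_cons Pi.
by apply: (Ck_eq oA _ IH) => x _; rewrite big_cons (negbTE nPi).
Qed.

Lemma Ck_linear k A f : (forall x v, is_derive x v f (f v)) -> continuous f ->
  Ck k A f.
Proof.
case: k => [|k] fv fc; (split; first by move=> x _; exact: fc)=> // v.
split=> [x _|]; first by have [] := fv x v.
have -> : 'D_v f = (fun=> f v) by apply/funext => x; have [_ ->] := fv x v.
exact: Ck_cst.
Qed.

End CkGeneral.

Section CkScalar.
Context {R : realType} {V : normedModType R}.
Implicit Types (A B : set V) (f g : V -> R).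

Lemma Ck_mul k A f g : open A -> Ck k A f -> Ck k A g ->
  Ck k A (fun x => f x * g x).
Proof.
move=> oA; elim: k f g => [|k IH] f g cf cg; (split; first by move=> x Ax; apply: cvgM; [move: cf|move: cg] => /Ck_continuous; exact)=> // v.
have df x : A x -> derivable f x v := @Ck_derivable _ _ _ _ _ _ _ _ cf.
have dg x : A x -> derivable g x v := @Ck_derivable _ _ _ _ _ _ _ _ cg.
split=> [x Ax|]; first exact: derivableM (df x Ax) (dg x Ax).
have c1 := IH _ _ (CkW cf) (Ck_derive v cg).
have c2 := IH _ _ (CkW cg) (Ck_derive v cf).
apply: (Ck_eq oA _ (Ck_add oA c1 c2)) => x Ax.
by rewrite -[LHS](@deriveM _ _ f g); [|exact: df|exact: dg].
Qed.

Lemma Ck_prod (I : Type) (r : seq I) k A (F : I -> V -> R) : open A ->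
  (forall i, Ck k A (F i)) -> Ck k A (fun x => \prod_(i <- r) F i x : R).
Proof.
move=> oA cF; elim: r => [|i r IH].
  have c1 : Ck k A (fun=> (1 : R)) by exact: Ck_cst.
  by apply: (Ck_eq oA _ c1) => x _; rewrite big_nil.
by apply: (Ck_eq oA _ (Ck_mul oA (cF i) IH)) => x _; rewrite big_cons.
Qed.

Lemma Ck_inv k A f : open A -> (forall x, A x -> f x != 0) -> Ck k A f ->
  Ck k A (fun x => (f x)^-1).
Proof.
move=> oA f0; elim: k => [|k IH] cf; (split; first by move=> x Ax; apply: cvgV; [exact: f0|move: cf => /Ck_continuous; exact])=> // v.
have df x : A x -> derivable f x v := @Ck_derivable _ _ _ _ _ _ _ _ cf.
split=> [x Ax|]; first exact: derivableV (f0 x Ax) (df x Ax).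
have ci := IH (CkW cf).
have c1 := Ck_opp oA (Ck_mul oA (Ck_mul oA ci ci) (Ck_derive v cf)).
apply: (Ck_eq oA _ c1) => x Ax; rewrite deriveV; [|exact: f0|exact: df].
by rewrite -exprVn expr2 scaleNr.
Qed.

End CkScalar.

Section CkMatrix.
Context {R : realType} {V : normedModType R} {m n : nat}.
Implicit Types (A B : set V) (f : V -> 'M[R]_(m, n)).

Lemma cvg_mx_coord {T : Type} (F : set_system T) (FF : Filter F) (f : T -> 'M[R]_(m, n)) (l : 'M[R]_(m, n)) :
  (f @ F --> l) <-> (forall i j, (fun x => f x i j) @ F --> l i j).
Proof.
split=> [fl i j|h].
  exact: (cvg_comp _ _ fl (@coord_continuous _ _ _ i j l)).
apply/cvgrPdist_le => /= e e0; near=> x.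
rewrite /Num.Def.normr/= mx_normrE (bigmax_le _ (ltW e0))//= => i _.
rewrite !mxE/=.
move: i; near: x; apply: filter_forall => /= i.
exact: ((cvgrPdist_le _ _).1 (h i.1 i.2)).
Unshelve. all: by end_near. Qed.

Lemma derive_coord f x v i j : derivable f x v ->
  'D_v f x i j = 'D_v (fun y => f y i j) x.
Proof. by move=> df; rewrite derive_mx// mxE. Qed.

Lemma Ck_coord k A f i j : open A -> Ck k A f -> Ck k A (fun x => f x i j).
Proof.
move=> oA; elim: k f => [|k IH] f cf; (split; first by move=> x Ax; apply: (cvg_mx_coord _ _ _).1; exact: Ck_continuous cf Ax)=> // v.
have df x : A x -> derivable f x v := @Ck_derivable _ _ _ _ _ _ _ _ cf.
split=> [x Ax|]; first exact: (derivable_mxP _ _ _).1 (df x Ax) _ _.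
apply: (Ck_eq oA _ (IH _ (Ck_derive v cf))) => x Ax.
by rewrite derive_coord//; exact: df.
Qed.

Lemma Ck_mx k A f : open A -> (forall i j, Ck k A (fun x => f x i j)) -> Ck k A f.
Proof.
move=> oA; elim: k f => [|k IH] f cf; (split; first by move=> x Ax; apply: (cvg_mx_coord _ _ _).2 => i j; exact: Ck_continuous (cf i j) Ax)=> // v.
have df x : A x -> derivable f x v.
  by move=> Ax; apply/derivable_mxP => i j; exact: Ck_derivable (cf i j) Ax.
split=> //; apply: IH => i j.
apply: (Ck_eq oA _ (Ck_derive v (cf i j))) => x Ax.
by rewrite derive_coord//; exact: df.
Qed.

End CkMatrix.

Section CkDet.
Context {R : realType} {V : normedModType R}.
Implicit Types A : set V.

Lemma Ck_det n k A (f : V -> 'M[R]_n) : open A ->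
  (forall i j, Ck k A (fun x => f x i j)) -> Ck k A (fun x => \det (f x)).
Proof.
move=> oA cf; rewrite /determinant; apply: Ck_sum => // s _.
by apply: Ck_mul => //; [exact: Ck_cst|exact: Ck_prod].
Qed.

(** Cramer's rule: the entries of the inverse are cofactors divided by the determinant. *)
Lemma Ck_invmx n k A (f : V -> 'M[R]_n) : open A ->
  (forall x, A x -> f x \in unitmx) ->
  (forall i j, Ck k A (fun x => f x i j)) ->
  forall i j, Ck k A (fun x => invmx (f x) i j).
Proof.
move=> oA fu cf i j.
have cadj : Ck k A (fun x => (\adj (f x)) i j).
  apply: (Ck_eq oA (f := fun x => cofactor (f x) j i)) => [x _|]; first by rewrite mxE.
  apply: Ck_mul => //; first exact: Ck_cst.
  apply: Ck_det => // a b.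
  by apply: (Ck_eq oA _ (cf (lift j a) (lift i b))) => x _; rewrite !mxE.
have cdet : Ck k A (fun x => (\det (f x))^-1).
  apply: Ck_inv => //; last exact: Ck_det.
  by move=> x /fu; rewrite unitmxE unitfE.
apply: (Ck_eq oA _ (Ck_mul oA cdet cadj)) => x Ax.
by rewrite /invmx (fu x Ax) [RHS]mxE.
Qed.

Lemma Ck_mulmx k A n1 n2 n3 (f : V -> 'M[R]_(n1, n2)) (g : V -> 'M[R]_(n2, n3)) :
  open A -> (forall i j, Ck k A (fun x => f x i j)) ->
  (forall i j, Ck k A (fun x => g x i j)) ->
  forall i j, Ck k A (fun x => (f x *m g x) i j).
Proof.
move=> oA cf cg i j.
have cs : Ck k A (fun x => \sum_l f x i l * g x l j : R).
  by apply: Ck_sum => // l _; exact: (Ck_mul oA (cf i l) (cg l j)).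
by apply: (Ck_eq oA _ cs) => x _; rewrite mxE.
Qed.

End CkDet.

(** * Strict differentiability and the chain rule *)

Section RowNorm.
Context {R : realType} {n : nat}.
Implicit Types (u v : 'rV[R]_n).

Lemma coord_le_norm m (M : 'M[R]_(m, n)) i j : `|M i j| <= `|M|.
Proof. by rewrite [leRHS]/Num.Def.normr/= mx_normrE; exact: (le_bigmax _ _ (i, j)). Qed.

Lemma row_norm_le v c : 0 <= c -> (forall i, `|v 0 i| <= c) -> `|v| <= c.
Proof.
move=> c0 h; rewrite [leLHS]/Num.Def.normr/= mx_normrE (bigmax_le _ c0)//= => -[i j] _.
by rewrite ord1 h.
Qed.

Lemma row_norm_lt v c : 0 < c -> (forall i, `|v 0 i| < c) -> `|v| < c.
Proof.
move=> c0 h; rewrite [ltLHS]/Num.Def.normr/= mx_normrE.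
by apply: bigmax_lt => //= -[i j] _; rewrite ord1 h.
Qed.

End RowNorm.

Lemma mulmx_norm_le (R : realType) n m (M : 'M[R]_(n, m)) : exists2 C, 0 < C &
  forall v : 'rV[R]_n, `|v *m M| <= C * `|v|.
Proof.
exists (n%:R * `|M| + 1) => [|v]; first by rewrite ltr_wpDl// mulr_ge0.
apply: row_norm_le => [|j]; first by rewrite mulr_ge0// addr_ge0// mulr_ge0.
rewrite mxE mulrDl mul1r ler_wpDr// (le_trans (ler_norm_sum _ _ _))//.
rewrite (le_trans (y := \sum_(k < n) `|v| * `|M|))//.
  by apply: ler_sum => k _; rewrite normrM ler_pM// coord_le_norm.
by rewrite sumr_const card_ord -[leLHS]mulr_natl [`|v| * _]mulrC mulrA.
Qed.

Section StrictDifferentiability.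
Context {R : realType}.

Lemma mean_value_bound (g : R -> R) (a b c e : R) :
  (forall s, Num.min a b <= s <= Num.max a b ->
    derivable g s 1 /\ `|'D_1 g s - c| <= e) ->
  `|g b - g a - c * (b - a)| <= e * `|b - a|.
Proof.
wlog ab : a b / a <= b => [wh|] h.
  have [ab|/ltW ba] := leP a b; first exact: wh.
  rewrite -[leLHS]normrN -[`|b - a|]normrN.
  rewrite (_ : - (g b - g a - c * (b - a)) = g a - g b - c * (a - b)); last by ring.
  rewrite opprB; apply: wh => // s; rewrite minC maxC; exact: h.
have dg x : x \in `[a, b]%R -> derivable g x 1 /\ `|'D_1 g x - c| <= e.
  by rewrite in_itv/= => xab; apply: h; rewrite min_l// max_r.
have [x||s sab gab] := @MVT_segment _ g ('D_1 g) a b ab.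
- by move=> /subset_itv_oo_cc/dg[/derivableP].
- by apply: derivable_within_continuous => x /dg[].
- rewrite gab -mulrBl normrM ler_wpM2r//; by have [] := dg s sab.
Qed.

Definition delta_row n (i : 'I_n) : 'rV[R]_n := delta_mx 0 i.

Lemma derive_line (V W : normedModType R) (f : V -> W) (w e : V) s :
  derivable f (w + s *: e) e ->
  is_derive s 1 (fun t : R => f (w + t *: e)) ('D_e f (w + s *: e)).
Proof.
have E : (fun h : R => h^-1 *: (((fun t : R => f (w + t *: e)) \o shift s) (h *: 1) -
            f (w + s *: e))) =
        (fun h : R => h^-1 *: ((f \o shift (w + s *: e)) (h *: e) - f (w + s *: e))).
  apply/funext => h /=; congr (_ *: (f _ - _)).
  by rewrite [h%:A]mulr1 scalerDl addrCA.
by move=> df; split; rewrite /derivable /derive E.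
Qed.

(** Both [z] and [z'] move, which is stronger than differentiability at [x0] and later makes
    implicit solutions Lipschitz. The passage from [z'] to [z] changes one coordinate at a time;
    each change is a one-variable mean value estimate with an almost constant partial derivative. *)
Lemma strict_differentiable n (A : set 'rV[R]_n) (f : 'rV[R]_n -> R) x0 :
  open A -> Ck 1 A f -> A x0 -> forall e, 0 < e -> exists2 r, 0 < r &
  forall z z', `|z - x0| < r -> `|z' - x0| < r ->
    `|f z - f z' - \sum_i (z - z') 0 i * 'D_(delta_row i) f x0| <= e * `|z - z'|.
Proof.
move=> oA cf Ax0 e e0.
(* The [n] one-coordinate errors add up to at most [e]; the successor keeps the divisor positive
   when n = 0. *)
pose e' := e / n.+1%:R; have e'0 : 0 < e' by rewrite divr_gt0.
have : \forall z \near x0, A z /\ forall i : 'I_n,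
    `|'D_(delta_row i) f z - 'D_(delta_row i) f x0| <= e'.
  near=> z; split; first by near: z; exact: (open_near oA Ax0 (fun y Ay => Ay)).
  near: z; apply: filter_forall => /= i.
  have /cvgrPdist_le/(_ _ e'0) := Ck_continuous (Ck_derive (delta_row i) cf) Ax0.
  by apply: filterS => z; rewrite distrC.
move=> /nbhs_normP[r /= r0 hr]; exists r => // z z' zr z'r.
(* The hybrid [w k] agrees with [z] in the first [k] coordinates; in the sup norm it stays in the
   ball around [x0]. *)
pose w k : 'rV[R]_n := \row_j (if (j < k)%N then z 0 j else z' 0 j).
have w0 : w 0%N = z' by apply/rowP => j; rewrite mxE ltn0.
have wn : w n = z by apply/rowP => j; rewrite mxE ltn_ord.
have wS (k : 'I_n) t : `|t - x0 0 k| < r -> `|w k + (t - z' 0 k) *: delta_row k - x0| < r.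
  move=> tr; apply: row_norm_lt => // j; rewrite !mxE eqxx/=.
  case: (ltngtP j k) => [jk|kj|/val_inj ->].
  - rewrite (_ : j == k = false) ?mulr0 ?addr0; last by apply/eqP => jk'; rewrite jk' ltnn in jk.
    by apply: le_lt_trans zr; have := coord_le_norm (z - x0) 0 j; rewrite !mxE.
  - rewrite (_ : j == k = false) ?mulr0 ?addr0; last by apply/eqP => jk'; rewrite jk' ltnn in kj.
    by apply: le_lt_trans z'r; have := coord_le_norm (z' - x0) 0 j; rewrite !mxE.
  - by rewrite eqxx mulr1 addrCA subrr addr0.
have step (k : 'I_n) : `|f (w k.+1) - f (w k) - (z - z') 0 k * 'D_(delta_row k) f x0| <=
    e' * `|z - z'|.
  pose g (t : R) := f ((w k - z' 0 k *: delta_row k) + t *: delta_row k).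
  have ew t : w k - z' 0 k *: delta_row k + t *: delta_row k =
     w k + (t - z' 0 k) *: delta_row k by rewrite scalerBl addrAC addrA.
  have -> : f (w k) = g (z' 0 k) by rewrite /g ew subrr scale0r addr0.
  have -> : f (w k.+1) = g (z 0 k).
    rewrite /g ew; congr f; apply/rowP => j; rewrite !mxE eqxx/= ltnS.
    case: (ltngtP j k) => [jk|kj|/val_inj ->].
    - rewrite (_ : j == k = false) ?mulr0 ?addr0//.
      by apply/eqP => jk'; rewrite jk' ltnn in jk.
    - rewrite (_ : j == k = false) ?mulr0 ?addr0//.
      by apply/eqP => jk'; rewrite jk' ltnn in kj.
    - by rewrite eqxx mulr1 addrC subrK.
  have -> : (z - z') 0 k = z 0 k - z' 0 k by rewrite !mxE.
  apply: (@le_trans _ _ (e' * `|z 0 k - z' 0 k|)); last first.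
    by rewrite ler_pM2l//; have := coord_le_norm (z - z') 0 k; rewrite !mxE.
  rewrite [_ * 'D_ _ f x0]mulrC.
  apply: mean_value_bound => s sz.
  have sr : `|s - x0 0 k| < r.
    have := coord_le_norm (z - x0) 0 k; have := coord_le_norm (z' - x0) 0 k.
    rewrite !mxE => h1 h2; have {}h1 := le_lt_trans h1 z'r; have {}h2 := le_lt_trans h2 zr.
    move: h1 h2; rewrite !ltr_distl.
    case: (leP (z' 0 k) (z 0 k)) sz => _ /andP[s1 s2] /andP[? ?] /andP[? ?].
      apply/andP; split; lra.
    apply/andP; split; lra.
  have [Aw hw] := hr (w k + (s - z' 0 k) *: delta_row k)
    (eq_ind _ is_true (wS k s sr) _ (congr1 (fun t => t < r) (distrC _ _))).
  have dw : derivable f (w k - z' 0 k *: delta_row k + s *: delta_row k) (delta_row k).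
    by rewrite ew; exact: Ck_derivable cf _.
  have [dg ->] := derive_line dw; split=> //.
  by rewrite ew; exact: hw.
have -> : f z - f z' - \sum_i (z - z') 0 i * 'D_(delta_row i) f x0 =
  \sum_(k < n) (f (w k.+1) - f (w k) - (z - z') 0 k * 'D_(delta_row k) f x0).
  rewrite sumrB; congr (_ - _).
  by rewrite -(big_mkord xpredT (fun k => f (w k.+1) - f (w k))) telescope_sumr// w0 wn.
rewrite (le_trans (ler_norm_sum _ _ _))// (le_trans (ler_sum _ (fun k _ => step k)))//.
rewrite sumr_const card_ord -mulr_natl mulrA ler_wpM2r// /e' mulrCA ler_piMr//; first exact: ltW.
by rewrite ler_pdivrMr// mul1r ler_nat.
Unshelve. all: by end_near. Qed.

Section ChainRule.
Context {V : normedModType R}.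

(** [g] is only derivable in the direction [v]. Its difference quotients [u] converge, hence stay
    bounded, and the strict estimate for [f] on the values of [g] along that line controls the
    error. *)
Lemma chain_rule n (A : set 'rV[R]_n) (f : 'rV[R]_n -> R) (g : V -> 'rV[R]_n) x v :
  open A -> Ck 1 A f -> A (g x) -> derivable g x v ->
  is_derive x v (f \o g) (\sum_i 'D_v g x 0 i * 'D_(delta_row i) f (g x)).
Proof.
move=> oA cf Ag dg.
set L := \sum_i _.
pose u h := h^-1 *: ((g \o shift x) (h *: v) - g x).
have uG : u @ 0^' --> 'D_v g x by exact: dg.
pose S h := \sum_i u h 0 i * 'D_(delta_row i) f (g x).
have SL : S @ 0^' --> L.
  apply: cvg_big => [|i _]; first exact: add_continuous.
  apply: cvgM; last exact: cvg_cst.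
  exact: (cvg_mx_coord _ _ _).1 uG 0 i.
pose q h := h^-1 *: (((f \o g) \o shift x) (h *: v) - (f \o g) x).
have gc : g (h *: v + x) @[h --> 0^'] --> g x.
  have : {for (0 : R), continuous (fun h : R => g (h *: v + x))}.
    exact/differentiable_continuous/derivable1_diffP/(derivable1P _ _ _).1.
  by move=> /continuous_withinNx; rewrite scale0r add0r.
have r0 : (fun h => q h - S h) @ 0^' --> 0.
  apply/cvgr0Pnorm_le => /= e e0.
  (* Near 0 the quotient [u h] has norm at most this divisor. *)
  pose e' := e / (`|'D_v g x| + 1).
  have e'0 : 0 < e' by rewrite divr_gt0// ltr_wpDl.
  have [r rp hr] := strict_differentiable oA cf Ag e'0.
  near=> h.
  have h0 : h != 0 by near: h; exact: nbhs_dnbhs_neq.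
  have -> : q h - S h = h^-1 * (f (g (h *: v + x)) - f (g x) -
     \sum_i (g (h *: v + x) - g x) 0 i * 'D_(delta_row i) f (g x)).
    rewrite mulrBr /q; congr (_ - _); rewrite /S mulr_sumr; apply: eq_bigr => i _.
    by rewrite /u mxE mulrA.
  rewrite normrM.
  apply: (@le_trans _ _ (`|h^-1| * (e' * `|g (h *: v + x) - g x|))).
    rewrite ler_wpM2l//; apply: hr; last by rewrite subrr normr0.
    by rewrite distrC; near: h; move/cvgrPdist_lt : gc; exact.
  rewrite mulrCA -normrZ -/(u h).
  have uh : `|u h| <= `|'D_v g x| + 1.
    rewrite -[u h](subrK ('D_v g x)) addrC (le_trans (ler_normD _ _))// lerD2l distrC.
    by near: h; move/cvgrPdist_le : uG; apply.
  by rewrite /e' -mulrA ler_piMr// ?(ltW e0)// ler_pdivrMl ?mulr1// ltr_wpDl.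
have qL : q @ 0^' --> L.
  have -> : q = (fun h => (q h - S h) + S h) by apply/funext => h; rewrite subrK.
  by rewrite -[L]add0r; exact: cvgD.
by split; [apply/cvg_ex; exists L|exact: cvg_lim qL].
Unshelve. all: by end_near. Qed.

Lemma Ck_comp n k (A : set 'rV[R]_n) (B : set V) (f : 'rV[R]_n -> R) (g : V -> 'rV[R]_n) :
  open A -> open B -> Ck k A f -> Ck k B g -> (forall x, B x -> A (g x)) ->
  Ck k B (fun x => f (g x)).
Proof.
move=> oA oB; elim: k f => [|k IH] f cf cg AB;
  (split; first by move=> x Bx; apply: continuous_comp;
     [exact: Ck_continuous cg Bx | apply: Ck_continuous cf _; exact: AB])=> // v.
have cr x : B x -> is_derive x v (f \o g) (\sum_i 'D_v g x 0 i * 'D_(delta_row i) f (g x)).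
  have c1 : Ck 1 A f by apply: Ck_leq cf.
  by move=> Bx; exact: (chain_rule oA c1 (AB _ Bx) (Ck_derivable cg Bx)).
split=> [x /cr[]//|].
have cs : Ck k B (fun x => \sum_i 'D_v g x 0 i * 'D_(delta_row i) f (g x) : R).
  apply: Ck_sum => // i _; apply: Ck_mul => //.
    exact: Ck_coord (Ck_derive v cg).
  by apply: (IH _ (Ck_derive _ cf) (CkW cg) AB).
by apply: (Ck_eq oB _ cs) => x /cr[_ ->].
Qed.

Lemma Ck_id k (A : set V) : Ck k A id.
Proof. by apply: Ck_linear => // x. Qed.

Lemma Ck_comp1 k (A : set R) (B : set V) (f : R -> R) (g : V -> R) :
  open A -> open B -> Ck k A f -> Ck k B g -> (forall x, B x -> A (g x)) ->
  Ck k B (fun x => f (g x)).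
Proof.
move=> oA oB; elim: k f => [|k IH] f cf cg AB;
  (split; first by move=> x Bx; apply: continuous_comp;
     [exact: Ck_continuous cg Bx | apply: Ck_continuous cf _; exact: AB])=> // v.
have cr x : B x -> is_derive x v (f \o g) ('D_v g x * 'D_1 f (g x)).
  move=> Bx; have dg : derivable g x v := Ck_derivable cg Bx.
  have df : derivable f (g x) 1 := Ck_derivable cf (AB _ Bx).
  have /derivable1P dg1 := dg.
  have dfg : derivable (f \o (fun h : R => g (h *: v + x))) 0 1.
    apply/derivable1_diffP/differentiable_comp; first exact/derivable1_diffP.
    by rewrite scale0r add0r; exact/derivable1_diffP.
  have eD (F : V -> R) : 'D_v F x = derive1 (fun h : R => F (h *: v + x)) 0.
    rewrite derive1E /derive; set g1 := fun h => h^-1 *: _; set g2 := fun h => h^-1 *: _.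
    suff -> : g1 = g2 by [].
    by apply/funext => h; rewrite /g1 /g2 /= addr0 scale0r add0r [_%:A]mulr1.
  split; first exact: (derivable1P (f \o g) x v).2 dfg.
  have df0 : derivable f (g (0 *: v + x)) 1 by rewrite scale0r add0r.
  apply: etrans (eD (f \o g)) (etrans (derive1_comp dg1 df0) _).
  by rewrite -(eD g) scale0r add0r derive1E mulrC.
split=> [x /cr[]//|].
have cs : Ck k B (fun x => 'D_v g x * 'D_1 f (g x) : R).
  apply: Ck_mul => //; first exact: (Ck_derive v cg).
  by apply: (IH _ (Ck_derive _ cf) (CkW cg) AB).
by apply: (Ck_eq oB _ cs) => x /cr[_ ->].
Qed.

End ChainRule.

Lemma derive_delta n (A : set 'rV[R]_n) (f : 'rV[R]_n -> R) x v : open A -> Ck 1 A f -> A x ->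
  'D_v f x = \sum_i v 0 i * 'D_(delta_row i) f x.
Proof.
move=> oA cf Ax.
have dI : derivable (id : 'rV[R]_n -> 'rV[R]_n) x v by exact: derivable_id.
have [_] := chain_rule oA cf (Ax : A (id x)) dI.
by rewrite derive_id.
Qed.

End StrictDifferentiability.

(** * Implicit functions *)

Section ImplicitFunction.
Context {R : realType} {n N : nat}.
Variables (A : set 'rV[R]_(n + N)) (E : 'I_n -> 'rV[R]_(n + N) -> R).
Hypothesis oA : open A.

(** A point is [row_mx y q], with unknown [y] and parameter [q]. Rows are indexed by variables and
    columns by equations, so a row of increments multiplies from the left. *)
Definition partial_l z : 'M[R]_n :=
  \matrix_(j, i) 'D_(delta_row (lshift N j)) (E i) z.
Definition partial_r z : 'M[R]_(N, n) :=
  \matrix_(j, i) 'D_(delta_row (rshift n j)) (E i) z.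

Lemma row_mx_norm_le (u : 'rV[R]_n) (v : 'rV[R]_N) : `|row_mx u v| <= `|u| + `|v|.
Proof.
apply: row_norm_le => [|k]; first exact: addr_ge0.
rewrite mxE; case: (fintype.split k) => j.
  by rewrite ler_wpDr// coord_le_norm.
by rewrite ler_wpDl// coord_le_norm.
Qed.

Lemma sum_partial (d : 'rV[R]_(n + N)) z i :
  \sum_k d 0 k * 'D_(delta_row k) (E i) z =
  (lsubmx d *m partial_l z + rsubmx d *m partial_r z) 0 i.
Proof.
rewrite !mxE big_split_ord/=; congr (_ + _).
  by apply: eq_bigr => j _; rewrite !mxE.
by apply: eq_bigr => j _; rewrite !mxE.
Qed.

Hypothesis cE : forall i, Ck 1 A (E i).

(* Two zeros of [E] near a point where the left partial derivative is invertible: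
   strict differentiability bounds the first components by the second ones. *)
Lemma implicit_strict y0 q0 : A (row_mx y0 q0) -> partial_l (row_mx y0 q0) \in unitmx ->
  forall e, 0 < e -> exists2 r, 0 < r & forall y y' q q',
    `|y - y0| < r -> `|y' - y0| < r -> `|q - q0| < r -> `|q' - q0| < r ->
    (forall i, E i (row_mx y q) = 0) -> (forall i, E i (row_mx y' q') = 0) ->
    `|y - y' + (q - q') *m partial_r (row_mx y0 q0) *m invmx (partial_l (row_mx y0 q0))|
      <= e * (`|y - y'| + `|q - q'|).
Proof.
set z0 := row_mx y0 q0 => Az0 u0 e e0.
have [c c0 hc] := mulmx_norm_le (invmx (partial_l z0)).
(* [c] bounds the inverse of the left partial derivative, which is applied to the error [w] at the
   end. *)
have e'0 : 0 < e / c by rewrite divr_gt0.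
have : forall i, exists r, 0 < r /\ forall z z', `|z - z0| < r -> `|z' - z0| < r ->
    `|E i z - E i z' - \sum_k (z - z') 0 k * 'D_(delta_row k) (E i) z0|
      <= e / c * `|z - z'|.
  by move=> i; have [r r0 h] := strict_differentiable oA (cE i) Az0 e'0; exists r.
move=> /choice[r hr].
pose s := \big[Num.min/1]_i r i.
have s0 : 0 < s.
  by rewrite /s; elim/big_ind : _ => // [a b a0 b0|i _]; [rewrite lt_min a0|have [] := hr i].
have sr i : s <= r i by rewrite /s (bigD1 i)//= ge_min lexx.
exists (s / 2) => [|y y' q q' hy hy' hq hq' Ez Ez']; first by rewrite divr_gt0.
have near_z a b : `|a - y0| < s / 2 -> `|b - q0| < s / 2 -> `|row_mx a b - z0| < s.
  move=> ha hb; rewrite /z0 opp_row_mx add_row_mx.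
  by apply: le_lt_trans (row_mx_norm_le _ _) _; rewrite [s]splitr ltrD.
have zz' : row_mx y q - row_mx y' q' = row_mx (y - y') (q - q').
  by rewrite opp_row_mx add_row_mx.
(* [E] vanishes at both points, so [w], the linear part of its increment, is itself only an error
   term. *)
pose w := (y - y') *m partial_l z0 + (q - q') *m partial_r z0.
have wle : `|w| <= e / c * (`|y - y'| + `|q - q'|).
  apply: row_norm_le => [|i]; first by rewrite mulr_ge0// ?(ltW e'0)// addr_ge0.
  have [_ /(_ (row_mx y q) (row_mx y' q'))] := hr i.
  rewrite !(lt_le_trans (near_z _ _ _ _) (sr i))// => /(_ isT isT).
  rewrite Ez Ez' subrr sub0r normrN sum_partial zz' row_mxKl row_mxKr => h.
  by apply: le_trans h _; rewrite ler_pM2l// row_mx_norm_le.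
have -> : y - y' + (q - q') *m partial_r z0 *m invmx (partial_l z0) =
    w *m invmx (partial_l z0) by rewrite /w mulmxDl mulmxK.
rewrite (le_trans (hc _))// (le_trans (ler_wpM2l (ltW c0) wle))//.
by rewrite mulrA [c * _]mulrC divfK ?gt_eqF.
Qed.

Lemma implicit_lipschitz y0 q0 : A (row_mx y0 q0) -> partial_l (row_mx y0 q0) \in unitmx ->
  exists r C, [/\ 0 < r, 0 < C & forall y y' q q',
    `|y - y0| < r -> `|y' - y0| < r -> `|q - q0| < r -> `|q' - q0| < r ->
    (forall i, E i (row_mx y q) = 0) -> (forall i, E i (row_mx y' q') = 0) ->
    `|y - y'| <= C * `|q - q'|].
Proof.
set z0 := row_mx y0 q0 => Az0 u0.
have [c c0 hc] := mulmx_norm_le (partial_r z0 *m invmx (partial_l z0)).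
(* With e = 1/2 the part of the error in [|y - y'|] is absorbed by the left-hand side; this yields
   the constant [1 + 2 * c]. *)
have h0 : 0 < 2^-1 :> R by rewrite invr_gt0.
have [r r0 hr] := implicit_strict Az0 u0 h0.
exists r, (1 + 2 * c); split=> // [|y y' q q' hy hy' hq hq' Ez Ez'].
  by rewrite addr_gt0// mulr_gt0.
have := hr y y' q q' hy hy' hq hq' Ez Ez'; rewrite -/z0 -mulmxA.
set v := (q - q') *m _ => h1.
have h2 : `|v| <= c * `|q - q'| by exact: hc.
have h3 : `|y - y'| <= `|y - y' + v| + `|v|.
  by rewrite -{1}[y - y'](addrK v); exact: ler_normB.
lra.
Qed.

(** The strict estimate compares the increment of [Y] with its linearization up to a small multiple
    of both increments, and the Lipschitz bound reduces both to [|h *: v|]. *)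
Lemma implicit_derive (Y : 'rV[R]_N -> 'rV[R]_n) q v :
  A (row_mx (Y q) q) -> partial_l (row_mx (Y q) q) \in unitmx ->
  {for q, continuous Y} -> (\forall q' \near q, forall i, E i (row_mx (Y q') q') = 0) ->
  is_derive q v Y (- (v *m partial_r (row_mx (Y q) q) *m invmx (partial_l (row_mx (Y q) q)))).
Proof.
set z0 := row_mx (Y q) q => Az0 u0 cY EY.
set L := - _.
have [r1 [C [r10 C0 hC]]] := implicit_lipschitz Az0 u0.
have qL : (fun h => h^-1 *: ((Y \o shift q) (h *: v) - Y q)) @ 0^' --> L.
  apply/cvgrPdist_le => /= e e0.
  pose e' := e / ((C + 1) * (`|v| + 1)).
  have D0 : 0 < (C + 1) * (`|v| + 1) by rewrite mulr_gt0// addr_gt0// ltr_wpDl.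
  have e'0 : 0 < e' by rewrite divr_gt0.
  have [r2 r20 hr] := implicit_strict Az0 u0 e'0.
  have sc : (fun h : R => h *: v + q) @ 0^' --> q.
    have : {for (0 : R), continuous (fun h : R => h *: v + q)}.
      by apply: cvgD; [exact: scalel_continuous|exact: cvg_cst].
    by move=> /continuous_withinNx; rewrite scale0r add0r.
  have Yc : (fun h : R => Y (h *: v + q)) @ 0^' --> Y q by exact: cvg_comp sc cY.
  have hq r : 0 < r -> \forall h \near 0^', `|(h *: v + q) - q| < r.
    move=> r0; move/cvgrPdist_lt : sc => /(_ r r0).
    by apply: filterS => h; rewrite distrC.
  have hY r : 0 < r -> \forall h \near 0^', `|Y (h *: v + q) - Y q| < r.
    move=> r0; move/cvgrPdist_lt : Yc => /(_ r r0).
    by apply: filterS => h; rewrite distrC.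
  have hE : \forall h \near 0^', forall i, E i (row_mx (Y (h *: v + q)) (h *: v + q)) = 0.
    exact: (sc _ EY).
  near=> h.
  have h0 : h != 0 by near: h; exact: nbhs_dnbhs_neq.
  have E1 i : E i (row_mx (Y (h *: v + q)) (h *: v + q)) = 0.
    by move: i; near: h; exact: hE.
  have E0 i : E i (row_mx (Y q) q) = 0 by have := nbhs_singleton EY; exact.
  have l1 : `|Y (h *: v + q) - Y q| <= C * `|h *: v|.
    rewrite -[X in C * `|X|](addrK q); apply: hC; rewrite ?subrr ?normr0//.
      by near: h; exact: hY.
    by near: h; exact: hq.
  have l2 : `|Y (h *: v + q) - Y q + (h *: v) *m partial_r z0 *m invmx (partial_l z0)| <=
      e' * (`|Y (h *: v + q) - Y q| + `|h *: v|).
    rewrite -[X in X *m partial_r _](addrK q) -[X in _ + `|X|](addrK q).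
    apply: hr; rewrite ?subrr ?normr0//.
      by near: h; exact: hY.
    by near: h; exact: hq.
  have -> : L - h^-1 *: ((Y \o shift q) (h *: v) - Y q) =
      - (h^-1 *: (Y (h *: v + q) - Y q + (h *: v) *m partial_r z0 *m invmx (partial_l z0))).
    have -> : h *: v *m partial_r z0 *m invmx (partial_l z0) =
        h *: (v *m partial_r z0 *m invmx (partial_l z0)) by rewrite !scalemxAl.
    by rewrite [in RHS]scalerDr scalerA mulVf// scale1r opprD [RHS]addrC.
  rewrite normrN normrZ normfV ler_pdivrMl ?normr_gt0//.
  apply: le_trans l2 _.
  apply: (@le_trans _ _ (e' * ((C + 1) * `|h *: v|))).
    by rewrite ler_pM2l// mulrDl mul1r lerD2r.
  rewrite normrZ [`|h| * e]mulrC -[e](divfK (lt0r_neq0 D0)) -/e' -!mulrA ler_pM2l//.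
  by rewrite ler_pM2l ?invr_gt0// ler_pM2l ?addr_gt0// [leRHS]mulrC ler_wpM2l// lerDl.
by split; [apply/cvg_ex; exists L|exact: cvg_lim qL].
Unshelve. all: by end_near. Qed.

End ImplicitFunction.

Section ImplicitSmooth.
Context {R : realType} {n N : nat}.
Variables (A : set 'rV[R]_(n + N)) (E : 'I_n -> 'rV[R]_(n + N) -> R).
Hypotheses (oA : open A) (sE : forall i, smooth_on A (E i)).

(** Existence of a solution is not at stake: [Y] is given and continuous. Its derivative is a smooth
    expression in [Y] itself, so each order of regularity yields the next. *)
Lemma implicit_smooth (O : set 'rV[R]_N) (Y : 'rV[R]_N -> 'rV[R]_n) : open O ->
  (forall q, O q -> A (row_mx (Y q) q)) ->
  (forall q, O q -> partial_l E (row_mx (Y q) q) \in unitmx) ->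
  (forall q, O q -> {for q, continuous Y}) ->
  (forall q, O q -> forall i, E i (row_mx (Y q) q) = 0) ->
  smooth_on O Y.
Proof.
move=> oO AO uO cO EO.
have dY q v : O q -> is_derive q v Y
    (- (v *m partial_r E (row_mx (Y q) q) *m invmx (partial_l E (row_mx (Y q) q)))).
  move=> Oq; have cE i : Ck 1 A (E i) := sE i 1%N.
  apply: (implicit_derive oA cE v (AO q Oq) (uO q Oq) (cO q Oq)).
  exact: (open_near oO Oq EO).
elim=> [|k IH]; first by split.
split=> // v; split=> [q Oq|]; first by have [] := dY q v Oq.
pose G q := row_mx (Y q) q.
have cG : Ck k O G.
  apply: Ck_mx => // i j; rewrite ord1; case: (splitP j) => [j' jE|j' jE].
    have -> : j = lshift N j' by exact: val_inj.
    apply: (Ck_eq oO _ (Ck_coord 0 j' oO IH)) => q _; rewrite /G.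
    by rewrite row_mxEl.
  have -> : j = rshift n j' by exact: val_inj.
  apply: (Ck_eq oO _ (Ck_coord 0 j' oO (Ck_id k O))) => q _; rewrite /G.
  by rewrite row_mxEr.
have cl i j : Ck k O (fun q => partial_l E (G q) i j).
  apply: (Ck_eq oO _ (Ck_comp oA oO (Ck_derive (delta_row (lshift N i)) (sE j k.+1)) cG AO)).
  by move=> q _; rewrite mxE.
have cr i j : Ck k O (fun q => partial_r E (G q) i j).
  apply: (Ck_eq oO _ (Ck_comp oA oO (Ck_derive (delta_row (rshift n i)) (sE j k.+1)) cG AO)).
  by move=> q _; rewrite mxE.
apply: Ck_mx => // i j.
have c1 := Ck_mulmx oO (Ck_mulmx (f := fun=> v) oO (fun i j => Ck_cst k O (v i j)) cr)
  (Ck_invmx oO uO cl) i j.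
apply: (Ck_eq oO _ (Ck_opp oO c1)) => q Oq.
by have [_ ->] := dY q v Oq; rewrite [RHS]mxE.
Qed.

End ImplicitSmooth.

(** * Full differentials, the Euclidean product and Gram matrices *)

Section Jacobian.
Context {R : realType}.

Lemma finite_lower_bound (I : finType) (r : I -> R) : (forall i, 0 < r i) ->
  exists2 s, 0 < s & forall i, s <= r i.
Proof.
move=> r0; exists (\big[Num.min/1]_i r i) => [|i].
  by elim/big_ind : _ => // a b a0 b0; rewrite lt_min a0.
by rewrite (bigD1 i)//= ge_min lexx.
Qed.

Lemma differentiable_estimate (V W : normedModType R) (f : V -> W)
    (df : {linear V -> W}) x : continuous df ->
  (forall e, 0 < e -> \forall h \near (0 : V), `|f (h + x) - f x - df h| <= e * `|h|) ->
  differentiable f x.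
Proof.
move=> cdf hf.
have dxf : f \o shift x = cst (f x) + df +o_ (0 : V) id.
  apply/eqaddoP => e e0; apply: filterS (hf e e0) => h.
  by rewrite !fctE opprD addrA.
apply/diffP; apply: (@getPex _ (fun (df : {linear V -> W}) => continuous df /\
  forall y, f y = f (lim (nbhs x)) + df (y - lim (nbhs x))
                  +o_(y \near x) (y - lim (nbhs x)))).
exists df; split=> //; apply: eqaddoEx => z.
have hdf : (df : V -> W) = f \o shift x - cst (f x) +o_ 0 id.
  apply: eqaddoE; rewrite dxf addrAC -!addrA addrC !addrA subrK.
  rewrite -[LHS]addr0 -addrA; congr (_ + _).
  by apply/eqP; rewrite eq_sym addrC addr_eq0 oppo.
rewrite hdf !addrA lim_id // /(_ \o _) /= subrK [f _ + _]addrC addrK.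
rewrite -addrA -[LHS]addr0; congr (_ + _).
apply/eqP; rewrite eq_sym addrC addr_eq0 oppox; apply/eqP.
rewrite [in LHS]littleo_center0 (comp_centerK x id).
by rewrite -[- _ in RHS](comp_centerK x).
Qed.

(** ['J] rests on the full differential, whereas [Ck] speaks of directional derivatives. Strict
    differentiability of each coordinate supplies the uniform estimate that links the two. *)
Lemma Ck_differentiable n m (A : set 'rV[R]_n) (f : 'rV[R]_n -> 'rV[R]_m) x :
  open A -> Ck 1 A f -> A x -> differentiable f x.
Proof.
move=> oA cf Ax.
pose J : 'M[R]_(n, m) := \matrix_(i, j) 'D_(delta_row i) f x 0 j.
pose df : {linear 'rV[R]_n -> 'rV[R]_m} := mulmxr J.
have cdf : continuous df.
  have c0 : Ck 0 setT (fun u : 'rV[R]_n => u *m J).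
    apply: Ck_mx; first exact: openT.
    apply: (Ck_mulmx (f := fun u : 'rV[R]_n => u) (g := fun=> J) openT) => i j.
      exact: (Ck_coord i j openT (Ck_id 0 setT)).
    exact: Ck_cst.
  by move=> v; exact: (Ck_continuous c0 I).
apply: (differentiable_estimate cdf) => e e0.
have : forall j, exists r, 0 < r /\ forall z z', `|z - x| < r -> `|z' - x| < r ->
    `|f z 0 j - f z' 0 j - \sum_i (z - z') 0 i * 'D_(delta_row i) (fun y => f y 0 j) x|
      <= e * `|z - z'|.
  move=> j; have [r r0 h] := strict_differentiable oA (Ck_coord 0 j oA cf) Ax e0.
  by exists r.
move=> /choice[r hr].
have [s s0 sr] := finite_lower_bound (fun j => (hr j).1).
apply/nbhs_normP; exists s => // h /=; rewrite sub0r normrN => hs.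
apply: row_norm_le => [|j]; first by rewrite mulr_ge0// ltW.
have [_ /(_ (h + x) x)] := hr j.
rewrite addrK subrr normr0 (hr j).1 (lt_le_trans hs (sr j)) => /(_ isT isT); apply: le_trans.
rewrite le_eqVlt; apply/orP; left; apply/eqP; congr `|_|.
rewrite !mxE; congr (_ - _).
by apply: eq_bigr => i _; rewrite mxE (derive_coord 0 j (Ck_derivable cf Ax)).
Qed.

Lemma row_jacobian n m (A : set 'rV[R]_n) (f : 'rV[R]_n -> 'rV[R]_m) x i :
  open A -> Ck 1 A f -> A x -> row i ('J f x) = 'D_(delta_row i) f x.
Proof.
by move=> oA cf Ax; rewrite rowE deriveEjacobian//; exact: Ck_differentiable cf Ax.
Qed.

Lemma dotr_ge0 N (u : 'rV[R]_N) : 0 <= dotr u u.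
Proof. by apply: sumr_ge0 => i _; rewrite -expr2 sqr_ge0. Qed.

Lemma dotrE N (u v : 'rV[R]_N) : dotr u v = (u *m v^T) 0 0.
Proof. by rewrite mxE; apply: eq_bigr => i _; rewrite !mxE. Qed.

Lemma dotrC N (u v : 'rV[R]_N) : dotr u v = dotr v u.
Proof. by apply: eq_bigr => i _; rewrite mulrC. Qed.

Lemma dotrDl N (u v w : 'rV[R]_N) : dotr (u + v) w = dotr u w + dotr v w.
Proof. by rewrite -big_split; apply: eq_bigr => i _; rewrite mxE mulrDl. Qed.

Lemma dotrNl N (u w : 'rV[R]_N) : dotr (- u) w = - dotr u w.
Proof. by rewrite -sumrN; apply: eq_bigr => i _; rewrite mxE mulNr. Qed.

Lemma dotr0l N (w : 'rV[R]_N) : dotr 0 w = 0.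
Proof. by apply: big1 => i _; rewrite mxE mul0r. Qed.

(** With [dotr_le_norm], this compares the sup norm, which carries the topology, with the Euclidean
    norm, which defines nearest points. *)
Lemma norm_le_dotr N (u : 'rV[R]_N) : `|u| ^+ 2 <= dotr u u.
Proof.
rewrite -[leRHS]sqr_sqrtr ?dotr_ge0// ler_sqr ?nnegrE ?sqrtr_ge0//.
apply: row_norm_le => [|i]; first exact: sqrtr_ge0.
rewrite -sqrtr_sqr ler_sqrt ?dotr_ge0// /dotr (bigD1 i)//= -expr2 lerDl.
by apply: sumr_ge0 => j _; rewrite -expr2 sqr_ge0.
Qed.

Lemma dotr_le_norm N (u : 'rV[R]_N) : dotr u u <= N%:R * `|u| ^+ 2.
Proof.
rewrite (le_trans (y := \sum_(i < N) `|u| ^+ 2))//; last first.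
  by rewrite sumr_const card_ord mulr_natl.
by apply: ler_sum => i _; rewrite -expr2 -real_normK ?num_real// ler_sqr ?nnegrE// coord_le_norm.
Qed.

Lemma dotr_eq0 N (u : 'rV[R]_N) : dotr u u <= 0 -> u = 0.
Proof.
move=> u0; have := le_trans (norm_le_dotr u) u0.
rewrite exprn_even_le0//= => /eqP; exact: normr0_eq0.
Qed.

Lemma is_derive_dotr (V : normedModType R) N (u w : V -> 'rV[R]_N) x v du dw :
  is_derive x v u du -> is_derive x v w dw ->
  is_derive x v (fun y => dotr (u y) (w y)) (dotr du (w x) + dotr (u x) dw).
Proof.
move=> [du1 <-] [dw1 <-].
have -> : (fun y => dotr (u y) (w y)) = \sum_(i < N) ((fun y => u y 0 i) * (fun y => w y 0 i)).
  by apply/funext => y; rewrite fct_sumE.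
have -> : dotr ('D_v u x) (w x) + dotr (u x) ('D_v w x) =
    \sum_(i < N) (u x 0 i *: 'D_v (fun y => w y 0 i) x + w x 0 i *: 'D_v (fun y => u y 0 i) x).
  rewrite big_split/= addrC; congr (_ + _); apply: eq_bigr => i _.
    by rewrite derive_coord// mulrC.
  by rewrite derive_coord.
apply: is_derive_sum => i; apply: is_deriveM; apply: derivableP.
  exact: (derivable_mxP _ _ _).1 du1 _ _.
exact: (derivable_mxP _ _ _).1 dw1 _ _.
Qed.

Lemma Ck_dotr (V : normedModType R) N k (A : set V) (u w : V -> 'rV[R]_N) : open A ->
  Ck k A u -> Ck k A w -> Ck k A (fun y => dotr (u y) (w y)).
Proof.
move=> oA cu cw; apply: Ck_sum => // i _.
exact: (Ck_mul oA (Ck_coord 0 i oA cu) (Ck_coord 0 i oA cw)).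
Qed.

(** If [v] is killed by the Gram matrix, then [v *m J] has Euclidean norm 0, and [J] is injective on
    rows. *)
Lemma gram_unit n N (J : 'M[R]_(n, N)) : row_free J -> J *m J^T \in unitmx.
Proof.
move=> fJ; rewrite -row_free_unit; apply: inj_row_free => v vJ0.
have : dotr (v *m J) (v *m J) <= 0.
  by rewrite dotrE trmx_mul mulmxA -(mulmxA v) vJ0 !mul0mx mxE.
by move=> /dotr_eq0/eqP; rewrite mulmx_free_eq0// => /eqP.
Qed.

End Jacobian.

(** * The nearest-point projection *)

Lemma open_norm_ball (R : realType) (V : normedModType R) (x : V) (r : R) :
  open [set y | `|y - x| < r].
Proof.
rewrite openE => y /= hy; apply/nbhs_normP.
exists (r - `|y - x|) => [|t /=]; first by rewrite /= subr_gt0.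
rewrite ltrBrDr => h; apply: le_lt_trans h.
by rewrite -[t - x](subrKA y) (le_trans (ler_normD _ _))// lerD2r distrC.
Qed.

Lemma lipschitz_continuous_at (R : realType) (V W : normedModType R) (f : V -> W)
    (A : set V) (x : V) (C : R) : 0 < C -> open A -> A x ->
  (forall y, A y -> `|f x - f y| <= C * `|x - y|) -> {for x, continuous f}.
Proof.
move=> C0 oA Ax hf; apply/cvgrPdist_le => /= e e0.
near=> y; rewrite (le_trans (hf y _))//.
  by near: y; exact: (open_near oA Ax (fun _ h => h)).
rewrite mulrC -ler_pdivlMr//; near: y; apply/nbhs_normP.
by exists (e / C) => [|y /= /ltW//]; rewrite /= divr_gt0.
Unshelve. all: by end_near. Qed.

Section NearestPoint.
Context {R : realType} {N : nat}.
Implicit Types (M : set 'rV[R]_N) (p q : 'rV[R]_N).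

(** Far from [M] there may be several minimizers; the choice is harmless, since the estimates below
    hold for whichever one is selected. *)
Definition nearest M q : 'rV[R]_N :=
  xget 0 [set x | M x /\ forall z, M z -> dotr (q - x) (q - x) <= dotr (q - z) (q - z)].

Variables (M : set 'rV[R]_N) (n : nat).
Hypotheses (cM : compact M) (M0 : M !=set0) (sM : embedded_submanifold n M).

Lemma nearestP q : M (nearest M q) /\
  forall z, M z -> dotr (q - nearest M q) (q - nearest M q) <= dotr (q - z) (q - z).
Proof.
have cd : Ck 0 setT (fun z => dotr (q - z) (q - z)).
  have c1 : Ck 0 setT (fun z => q - z).
    by apply: Ck_sub_fun openT _ _; [exact: Ck_cst|exact: Ck_id].
  exact: (Ck_dotr openT c1 c1).
have [|c] := EVT_min_rV M0 cM (f := fun z => dotr (q - z) (q - z)).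
  by apply: continuous_subspaceT => z; exact: Ck_continuous cd I.
rewrite inE => Mc hc; rewrite /nearest; case: xgetP => [x _ //|/(_ c)[]].
by split=> // z Mz; apply: hc; rewrite inE.
Qed.

Lemma nearest_in q : M (nearest M q). Proof. by have [] := nearestP q. Qed.

Lemma nearest_id q : M q -> nearest M q = q.
Proof.
move=> Mq; have [_ /(_ q Mq)] := nearestP q.
rewrite subrr dotr0l => /dotr_eq0/eqP; rewrite subr_eq0 => /eqP/esym//.
Qed.

(** The Euclidean distance from [q] to its nearest point is at most that from [q] to [p]. Passing to
    the sup norm costs a factor sqrt N, bounded by [N.+1], and the triangle inequality adds one
    more. *)
Lemma nearest_close p q : M p -> `|nearest M q - p| <= N.+2%:R * `|q - p|.
Proof.
move=> Mp; have [_ /(_ p Mp) h] := nearestP q.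
have h1 : `|q - nearest M q| <= N.+1%:R * `|q - p|.
  rewrite -ler_sqr ?nnegrE ?mulr_ge0// exprMn.
  apply: le_trans (norm_le_dotr _) _; apply: le_trans h _.
  apply: le_trans (dotr_le_norm _) _; rewrite ler_wpM2r ?sqr_ge0//.
  by rewrite -natrX ler_nat (leq_trans (leqnSn N))// -{1}(expn1 N.+1) leq_pexp2l.
rewrite -[nearest M q - p](subrKA q) (le_trans (ler_normD _ _))//.
by rewrite -natr1 mulrDl mul1r lerD// distrC.
Qed.

(** First-order condition: along a curve in [M] through the nearest point, the squared distance to
    [q] has an interior minimum at time 0. *)
Lemma nearest_normal q (c : R -> 'rV[R]_N) e : 0 < e ->
  (forall s, - e < s < e -> derivable c s 1) -> (forall s, - e < s < e -> M (c s)) ->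
  c 0 = nearest M q -> dotr (q - nearest M q) ('D_1 c 0) = 0.
Proof.
move=> e0 dc Mc c0.
pose g s := dotr (q - c s) (q - c s).
have dg s : - e < s < e -> is_derive s 1 g (dotr (- 'D_1 c s) (q - c s) + dotr (q - c s) (- 'D_1 c s)).
  move=> /dc/derivableP dcs.
  have d1 : is_derive s 1 (fun s => q - c s) (- 'D_1 c s).
    by rewrite -[- _]add0r; apply: is_deriveD; exact: is_deriveN.
  exact: is_derive_dotr.
have [_ g0] : is_derive (0 : R) 1 g 0.
  apply: (@derive1_at_min _ g (- e) e 0) => [|t|//|t].
  - by lra.
  - by rewrite in_itv/= => /dg[].
  - by rewrite in_itv/= oppr_lt0 e0.
  - by rewrite in_itv/= => /Mc Mct; rewrite /g c0; have [_] := nearestP q; apply.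
have e00 : - e < 0 < e by rewrite oppr_lt0 e0.
have [_] := dg 0 e00.
rewrite g0 c0 [X in _ = X + _]dotrC -mulr2n => /esym/eqP.
rewrite mulrn_eq0/= => /eqP; rewrite dotrC dotrNl dotrC => /eqP.
by rewrite oppr_eq0 => /eqP.
Qed.

Lemma local_param_in (V : set 'rV[R]_n) psi y : local_param M V psi -> V y -> M (psi y).
Proof.
case=> oV _ _ _ /(_ V oV (fun _ h => h))[U _ e] Vy.
have : (psi @` V) (psi y) by exists y.
by rewrite e => -[].
Qed.

Lemma lsubmx_line (h : R) (d z : 'rV[R]_(n + N)) :
  lsubmx (h *: d + z) = h *: lsubmx d + lsubmx z.
Proof. by apply/rowP => a; rewrite !mxE. Qed.

Lemma rsubmx_line (h : R) (d z : 'rV[R]_(n + N)) :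
  rsubmx (h *: d + z) = h *: rsubmx d + rsubmx z.
Proof. by apply/rowP => a; rewrite !mxE. Qed.

Lemma derive_lsubmx (W : normedModType R) (f : 'rV[R]_n -> W) (z d : 'rV[R]_(n + N)) :
  derivable f (lsubmx z) (lsubmx d) ->
  is_derive z d (fun z => f (lsubmx z)) ('D_(lsubmx d) f (lsubmx z)).
Proof.
have E : (fun h : R => h^-1 *: (((fun z => f (lsubmx z)) \o shift z) (h *: d) - f (lsubmx z))) =
    (fun h : R => h^-1 *: ((f \o shift (lsubmx z)) (h *: lsubmx d) - f (lsubmx z))).
  by apply/funext => h /=; rewrite lsubmx_line.
by move=> df; split; rewrite /derivable /derive E.
Qed.

Lemma Ck_lsubmx k A : open A -> Ck k A (fun z : 'rV[R]_(n + N) => lsubmx z).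
Proof.
move=> oA; apply: Ck_mx => // i j; rewrite ord1.
apply: (Ck_eq oA _ (Ck_coord 0 (lshift N j) oA (Ck_id k A))) => z _.
by rewrite mxE.
Qed.

Lemma Ck_rsubmx k A : open A -> Ck k A (fun z : 'rV[R]_(n + N) => rsubmx z).
Proof.
move=> oA; apply: Ck_mx => // i j; rewrite ord1.
apply: (Ck_eq oA _ (Ck_coord 0 (rshift n j) oA (Ck_id k A))) => z _.
by rewrite mxE.
Qed.

Lemma Ck_comp_row (V : normedModType R) a b k (A : set 'rV[R]_a) (B : set V)
    (f : 'rV[R]_a -> 'rV[R]_b) (g : V -> 'rV[R]_a) :
  open A -> open B -> Ck k A f -> Ck k B g -> (forall x, B x -> A (g x)) ->
  Ck k B (fun x => f (g x)).
Proof.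
move=> oA oB cf cg AB; apply: Ck_mx => // i j.
exact: (Ck_comp oA oB (Ck_coord i j oA cf) cg AB).
Qed.

(* [E i (y, q) = 0] for all i says that q - psi y is orthogonal to the tangent
   space at psi y. *)
Definition normal_eq (psi : 'rV[R]_n -> 'rV[R]_N) (i : 'I_n) (z : 'rV[R]_(n + N)) : R :=
  dotr (rsubmx z - psi (lsubmx z)) ('D_(delta_row i) psi (lsubmx z)).

Lemma normal_eq_smooth (V : set 'rV[R]_n) psi i : open V -> smooth_on V psi ->
  smooth_on (lsubmx @^-1` V : set 'rV[R]_(n + N)) (normal_eq psi i).
Proof.
move=> oV sV k.
have oA : open (lsubmx @^-1` V : set 'rV[R]_(n + N)).
  by apply: open_comp => // z _; exact: (Ck_continuous (Ck_lsubmx 0 openT) I).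
apply: Ck_dotr => //.
  apply: Ck_sub_fun => //; first exact: Ck_rsubmx.
  by apply: (Ck_comp_row oV oA (sV k)) => //; exact: Ck_lsubmx.
by apply: (Ck_comp_row oV oA (Ck_derive _ (sV k.+1))) => //; exact: Ck_lsubmx.
Qed.

(** In the left partial derivative of [normal_eq] the second derivatives of [psi] are multiplied by
    q - psi y, which vanishes here. What remains is minus the Gram matrix of the Jacobian. *)
Lemma normal_eq_unit (V : set 'rV[R]_n) psi y : open V -> smooth_on V psi -> V y ->
  row_free ('J psi y) -> partial_l (normal_eq psi) (row_mx y (psi y)) \in unitmx.
Proof.
move=> oV sV Vy fJ; set z := row_mx y (psi y).
have lz : lsubmx z = y by rewrite row_mxKl.
have -> : partial_l (normal_eq psi) z = - ('J psi y *m ('J psi y)^T).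
  apply/matrixP => j i; rewrite !mxE.
  set d := delta_row (lshift N j).
  have ld : lsubmx d = delta_row j.
    by apply/rowP => a; rewrite !mxE eqxx/=; congr (_%:R); rewrite (inj_eq (@lshift_inj _ _)).
  have rd : rsubmx d = 0.
    by apply/rowP => a; rewrite !mxE eqxx/=; rewrite eq_rlshift.
  have d1 : is_derive z d (fun z => rsubmx z - psi (lsubmx z)) (0 - 'D_(delta_row j) psi y).
    apply: is_deriveB; last first.
      rewrite -ld -lz; apply: derive_lsubmx; rewrite lz; exact: Ck_derivable (sV 1%N) Vy.
    split.
      have := @Ck_derivable _ _ _ _ _ _ z d (@Ck_rsubmx 1 setT openT) I; exact.
    have E : (fun h : R => h^-1 *: ((rsubmx \o shift z) (h *: d) - rsubmx z)) = (fun=> 0).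
      by apply/funext => h /=; rewrite rsubmx_line rd scaler0 add0r subrr scaler0.
    by rewrite /derive E lim_cst.
  have d2 : is_derive z d (fun z => 'D_(delta_row i) psi (lsubmx z)) ('D_(delta_row j) ('D_(delta_row i) psi) y).
    rewrite -ld -lz; apply: derive_lsubmx; rewrite lz.
    exact: Ck_derivable (Ck_derive _ (sV 2%N)) Vy.
  have [_ ->] := is_derive_dotr d1 d2.
  rewrite lz row_mxKr subrr dotr0l addr0 sub0r dotrNl; congr (- _).
  apply: eq_bigr => a _; rewrite -!(row_jacobian _ oV (sV 1%N) Vy) !mxE.
  by [].
by rewrite -scaleN1r unitmxZ ?gram_unit// unitrN1.
Qed.

(** In a chart, the coordinates [Y] of the nearest point solve [normal_eq], whose left partial
    derivative is invertible near [p]. The Lipschitz estimate gives continuity of [Y], and the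
    implicit equation then gives smoothness. *)
Lemma nearest_smooth_near p : M p -> exists O, [/\ open O, O p & smooth_on O (nearest M)].
Proof.
move=> Mp; have [V [psi [y0 [lp Vy0 psiy0]]]] := sM Mp.
have [oV sV fV iV hV] := lp.
pose A : set 'rV[R]_(n + N) := lsubmx @^-1` V.
pose E := normal_eq psi.
have oA : open A.
  by apply: open_comp => // z _; exact: (Ck_continuous (Ck_lsubmx 0 openT) I).
have sE i : smooth_on A (E i) by exact: normal_eq_smooth.
pose z0 := row_mx y0 p.
have Az0 : A z0 by rewrite /A/= row_mxKl.
have u0 : partial_l E z0 \in unitmx by rewrite /z0 -psiy0; exact: (normal_eq_unit oV sV Vy0 (fV _ Vy0)).
have [r [C [r0 C0 hC]]] := implicit_lipschitz oA (fun i => sE i 1%N) Az0 u0.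
have cdet : Ck 0 A (fun z => \det (partial_l E z)).
  apply: Ck_det => // i j.
  by apply: (Ck_eq oA _ (Ck_derive (delta_row (lshift N i)) (sE j 1%N))) => z _; rewrite mxE.
have : \forall z \near z0, A z /\ \det (partial_l E z) != 0.
  have det0 : \det (partial_l E z0) != 0 by rewrite -unitfE -unitmxE.
  near=> z; split; near: z; first exact: (open_near oA Az0 (fun _ h => h)).
  have := Ck_continuous cdet Az0; rewrite /prop_for /continuous_at => h.
  apply: (h [set t | t != 0]).
  exact: (open_nbhs_nbhs (conj (@open_neq _ 0) det0)).
move=> /nbhs_normP[r' /= r'0 hr'].
(* Halving leaves room for the two components of [row_mx (Y q) q], each within [r1] of its
   centre. *)
pose r1 := Num.min r r' / 2.
have r10 : 0 < r1 by rewrite divr_gt0// lt_min r0.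
have r1r : r1 < r.
  have : Num.min r r' <= r by rewrite ge_min lexx.
  by rewrite /r1 ltr_pdivrMr//; lra.
have r1r' : r1 + r1 <= r' by rewrite /r1 -splitr ge_min lexx orbT.
pose B := V `&` [set y | `|y - y0| < r1].
have oB : open B.
  by apply: openI => //; exact: open_norm_ball.
have [U oU psiB] := hV B oB (@subIsetl _ _ _).
have Up : U p.
  have : (psi @` B) p by exists y0 => //; split=> //=; rewrite subrr normr0.
  by rewrite psiB => -[].
have := open_nbhs_nbhs (conj oU Up); move=> /nbhs_normP[r2 /= r20 hr2].
(* The divisor undoes the factor of [nearest_close]: the nearest point of any [q] in [O] falls
   within [r2] of [p], hence in the image of [B]. *)
pose r3 := Num.min r1 (r2 / N.+2%:R).
have r30 : 0 < r3 by rewrite lt_min r10 divr_gt0.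
pose O := [set q : 'rV[R]_N | `|q - p| < r3].
have hY q : exists y, O q -> B y /\ psi y = nearest M q.
  have [Oq|] := pselect (O q); last by exists 0.
  have : (M `&` U) (nearest M q).
    split; first exact: nearest_in.
    apply: hr2 => /=; rewrite distrC (le_lt_trans (nearest_close q Mp))//.
    by rewrite mulrC -ltr_pdivlMr//; move: Oq; rewrite /O/= /r3 lt_min => /andP[].
  by rewrite -psiB => -[y By e]; exists y.
move: hY => /choice[Y hY].
have oO : open O by exact: open_norm_ball.
have Yy0 q : O q -> `|Y q - y0| < r1 by move=> /hY[[]].
have Oq1 q : O q -> `|q - p| < r1 by rewrite /O/= /r3 lt_min => /andP[].
have nz q : O q -> A (row_mx (Y q) q) /\ \det (partial_l E (row_mx (Y q) q)) != 0.
  move=> Oq; apply: hr' => /=; rewrite distrC; apply: lt_le_trans r1r'.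
  rewrite /z0 opp_row_mx add_row_mx; apply: le_lt_trans (row_mx_norm_le _ _) _.
  by rewrite ltrD ?Yy0 ?Oq1.
have E0 q : O q -> forall i, E i (row_mx (Y q) q) = 0.
  move=> Oq i; have [[VY _] psiY] := hY q Oq.
  rewrite /E /normal_eq row_mxKl row_mxKr psiY.
  have [e /= e0 he] : exists2 e : R, 0 < e & forall s, - e < s < e -> V (Y q + s *: delta_row i).
    have /nbhs_normP[e /= e0 he] := open_nbhs_nbhs (conj oV VY).
    exists e => // s se; apply: he => /=.
    rewrite opprD addrA subrr sub0r normrN normrZ (le_lt_trans (y := `|s|))//; last by rewrite ltr_norml.
    rewrite ler_piMr//; apply: row_norm_le => // j; rewrite mxE.
    by case: (_ && _); rewrite ?normr1 ?normr0.
  have dl s : - e < s < e -> is_derive s 1 (fun s : R => psi (Y q + s *: delta_row i))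
      ('D_(delta_row i) psi (Y q + s *: delta_row i)).
    by move=> /he Vs; apply: derive_line; exact: Ck_derivable (sV 1%N) Vs.
  have e00 : - e < 0 < e by rewrite oppr_lt0 e0.
  have <- : 'D_1 (fun s : R => psi (Y q + s *: delta_row i)) 0 = 'D_(delta_row i) psi (Y q).
    by have [_ ->] := dl 0 e00; rewrite scale0r addr0.
  apply: (nearest_normal (e := e)) => // [s /dl[]//|s /he Vs|].
    exact: (local_param_in lp).
  by rewrite scale0r addr0.
have cY q : O q -> {for q, continuous Y}.
  move=> Oq; apply: (lipschitz_continuous_at C0 oO Oq) => t Ot.
  apply: hC; rewrite ?(lt_trans (Yy0 _ _) r1r) ?(lt_trans (Oq1 _ _) r1r)//; exact: E0.
have sY : smooth_on O Y.
  have uO q : O q -> partial_l E (row_mx (Y q) q) \in unitmx.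
    by move=> /nz[_]; rewrite unitmxE unitfE.
  exact: (implicit_smooth oA sE oO (fun q Oq => (nz q Oq).1) uO cY E0).
exists O; split=> //; first by rewrite /O/= subrr normr0.
move=> k.
apply: (Ck_eq oO _ (Ck_comp_row oV oO (sV k) (sY k) _)) => q Oq.
  by have [_] := hY q Oq.
by have [[]] := hY q Oq.
Unshelve. all: by end_near. Qed.

End NearestPoint.

(** * Tangent spaces and the second fundamental form *)

Section ChainRuleRow.
Context {R : realType} {V : normedModType R}.

Lemma is_derive_coord m n (f : V -> 'M[R]_(m, n)) x v (df : 'M[R]_(m, n)) : is_derive x v f df ->
  forall i j, is_derive x v (fun y => f y i j) (df i j).
Proof.
move=> [d <-] i j; rewrite derive_coord//; apply: derivableP.
exact: (derivable_mxP _ _ _).1 d _ _.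
Qed.

Lemma is_derive_mx m n (f : V -> 'M[R]_(m, n)) x v (df : 'M[R]_(m, n)) :
  (forall i j, is_derive x v (fun y => f y i j) (df i j)) -> is_derive x v f df.
Proof.
move=> h; have d : derivable f x v by apply/derivable_mxP => i j; have [] := h i j.
split=> //; apply/matrixP => i j; rewrite derive_coord//.
by have [_] := h i j.
Qed.

Lemma chain_rule_row a b (A : set 'rV[R]_a) (f : 'rV[R]_a -> 'rV[R]_b)
    (g : V -> 'rV[R]_a) x v dg :
  open A -> Ck 1 A f -> A (g x) -> is_derive x v g dg ->
  is_derive x v (fun y => f (g y)) ('D_dg f (g x)).
Proof.
move=> oA cf Agx [d <-]; apply: is_derive_mx => i j; rewrite ord1.
rewrite derive_coord; last exact: Ck_derivable cf Agx.
rewrite (derive_delta _ oA (Ck_coord 0 j oA cf) Agx).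
exact: (chain_rule oA (Ck_coord 0 j oA cf) Agx d).
Qed.

Lemma derive_row_delta a b (A : set 'rV[R]_a) (f : 'rV[R]_a -> 'rV[R]_b) x v :
  open A -> Ck 1 A f -> A x -> 'D_v f x = \sum_i v 0 i *: 'D_(delta_row i) f x.
Proof.
move=> oA cf Ax; apply/rowP => j; rewrite summxE derive_coord; last exact: Ck_derivable cf Ax.
rewrite (derive_delta _ oA (Ck_coord 0 j oA cf) Ax); apply: eq_bigr => i _.
by rewrite mxE derive_coord//; exact: Ck_derivable cf Ax.
Qed.

Lemma derive_rowD a b (A : set 'rV[R]_a) (f : 'rV[R]_a -> 'rV[R]_b) x u v :
  open A -> Ck 1 A f -> A x -> 'D_(u + v) f x = 'D_u f x + 'D_v f x.
Proof.
move=> oA cf Ax; rewrite !(derive_row_delta _ oA cf Ax) -big_split/=.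
by apply: eq_bigr => i _; rewrite mxE scalerDl.
Qed.

Lemma derive_rowN a b (A : set 'rV[R]_a) (f : 'rV[R]_a -> 'rV[R]_b) x u :
  open A -> Ck 1 A f -> A x -> 'D_(- u) f x = - 'D_u f x.
Proof.
move=> oA cf Ax; rewrite !(derive_row_delta _ oA cf Ax) -sumrN.
by apply: eq_bigr => i _; rewrite mxE scaleNr.
Qed.

Lemma derive_rowZ a b (A : set 'rV[R]_a) (f : 'rV[R]_a -> 'rV[R]_b) x c u :
  open A -> Ck 1 A f -> A x -> 'D_(c *: u) f x = c *: 'D_u f x.
Proof.
move=> oA cf Ax; rewrite !(derive_row_delta _ oA cf Ax) scaler_sumr.
by apply: eq_bigr => i _; rewrite mxE scalerA.
Qed.

Lemma near_is_derive_eq (W : normedModType R) (f g : V -> W) x v df dg :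
  (\forall y \near x, f y = g y) -> is_derive x v f df -> is_derive x v g dg -> df = dg.
Proof. by move=> fg [_ <-] [_ <-]; exact: near_eq_derive. Qed.

End ChainRuleRow.

Section TangentSpace.
Context {R : realType} {N : nat}.
Variables (M : set 'rV[R]_N) (n : nat).
Hypotheses (cM : compact M) (M0 : M !=set0) (sM : embedded_submanifold n M).
Implicit Types (p q v : 'rV[R]_N).
Local Notation rho := (nearest M).

(** One open domain for all derivatives of the nearest-point map; [nearest_smooth_near] puts [M]
    inside it. *)
Definition tube : set 'rV[R]_N := [set q | exists O, [/\ open O, O q & smooth_on O (nearest M)]].

Lemma tube_open : open tube.
Proof.
rewrite openE => q [B [oB Bq sB]].
by apply: filterS (open_nbhs_nbhs (conj oB Bq)) => t Bt; exists B.
Qed.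

Lemma tube_smooth : smooth_on tube rho.
Proof. by move=> k; apply: Ck_local => q [B [oB Bq sB]]; exists B. Qed.

Lemma sub_tube : M `<=` tube.
Proof. by move=> p Mp; exact: (nearest_smooth_near cM M0 sM Mp). Qed.

Lemma line_Ck p v k (A : set R) : open A -> Ck k A (fun s : R => p + s *: v).
Proof.
move=> oA; apply: Ck_mx => // i j.
have c1 : Ck k A (fun s : R => p i j + s * v i j).
  by apply: Ck_add => //; [exact: Ck_cst|apply: Ck_mul => //; [exact: Ck_id|exact: Ck_cst]].
by apply: (Ck_eq oA _ c1) => s _; rewrite !mxE.
Qed.

Lemma is_derive_line p v (s : R) : is_derive s 1 (fun s : R => p + s *: v) v.
Proof.
apply: is_derive_mx => i j.
have -> : (fun y : R => (p + y *: v) i j) = (fun y : R => p i j + v i j * y).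
  by apply/funext => y; rewrite !mxE mulrC.
rewrite -[X in is_derive _ _ _ X]add0r; apply: is_deriveD.
rewrite -[X in is_derive _ _ _ X]mulr1; exact: is_deriveZ.
Qed.

Lemma tube_line p v : tube p -> exists2 e : R, 0 < e & forall s, - e < s < e -> tube (p + s *: v).
Proof.
move=> Tp; have lc : {for (0 : R), continuous (fun s : R => p + s *: v)}.
  exact: Ck_continuous (line_Ck p v 0 openT) I.
have : \forall s \near (0 : R), tube (p + s *: v).
  by apply: lc; rewrite scale0r addr0; exact: (open_nbhs_nbhs (conj tube_open Tp)).
move=> /nbhs_normP[e /= e0 he]; exists e => // s se; apply: he => /=.
by rewrite sub0r normrN ltr_norml.
Qed.

Lemma nearest_derive k v : Ck k tube ('D_v rho).
Proof. by apply: Ck_derive; exact: tube_smooth. Qed.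

Lemma tangent_derive_nearest p v : M p -> tangent M p ('D_v rho p).
Proof.
move=> Mp; have Tp := sub_tube Mp.
have [e e0 he] := tube_line v Tp.
have dc : is_derive (0 : R) 1 (fun s : R => rho (p + s *: v)) ('D_v rho p).
  rewrite -[X in 'D_v rho X](_ : p + 0 *: v = p); last by rewrite scale0r addr0.
  apply: chain_rule_row tube_open (tube_smooth 1) _ (is_derive_line p v 0).
  by rewrite scale0r addr0.
exists e, (fun s => rho (p + s *: v)); split.
- exact: e0.
- move=> k; apply: (Ck_comp_row tube_open _ (tube_smooth k)).
  + exact: interval_open.
  + by apply: line_Ck; exact: interval_open.
  + by move=> s /=; rewrite in_itv/= => /he.
- by move=> s _; exact: nearest_in.
- by rewrite scale0r addr0 nearest_id.
- by rewrite derive1E; have [_ ->] := dc.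
Qed.

(** The nearest-point map fixes the curve pointwise near [s0], and this identity is
    differentiated. *)
Lemma derive_nearest_velocity (c : R -> 'rV[R]_N) e s0 : 0 < e ->
  (forall s, s0 - e < s < s0 + e -> M (c s)) -> derivable c s0 1 ->
  'D_('D_1 c s0) rho (c s0) = 'D_1 c s0.
Proof.
move=> e0 Mc dc; have Mc0 : M (c s0) by apply: Mc; lra.
apply: (@near_is_derive_eq _ _ _ (fun s => rho (c s)) c s0 1).
- apply/nbhs_normP; exists e => // s /=; rewrite distrC ltr_distl => se.
  by rewrite nearest_id//; apply: Mc.
- exact: (chain_rule_row tube_open (tube_smooth 1) (sub_tube Mc0) (derivableP dc)).
- exact: derivableP.
Qed.

Lemma tangent_fixed p v : M p -> tangent M p v -> 'D_v rho p = v.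
Proof.
move=> Mp [e [c [e0 sc Mc cp <-]]]; rewrite derive1E -{1}cp.
apply: (derive_nearest_velocity (e := e)) => //.
  by move=> s; rewrite sub0r add0r; exact: Mc.
by apply: Ck_derivable (sc 1%N) _; rewrite /= in_itv/= oppr_lt0 e0.
Qed.

(** Velocities of curves are not visibly closed under linear operations; as fixed vectors of a
    linear map they are. *)
Lemma tangentP p v : M p -> tangent M p v <-> 'D_v rho p = v.
Proof.
move=> Mp; split; first exact: tangent_fixed.
by move=> <-; exact: tangent_derive_nearest.
Qed.

Lemma nearest_tangent_normal q v : tangent M (rho q) v -> dotr (q - rho q) v = 0.
Proof.
move=> [e [c [e0 sc Mc cp <-]]]; rewrite derive1E.
apply: (nearest_normal cM M0 (e := e)) => // s se.
by apply: Ck_derivable (sc 1%N) _; rewrite /= in_itv.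
Qed.

(** The field ['D_z rho], taken at nearest points, extends [z] and is tangent, so q - rho q is
    orthogonal to it. This identity is differentiated along p + s v; the term in which the field is
    differentiated has the factor p - rho p = 0. *)
Lemma derive_nearest_normal p v z : M p -> tangent M p z -> dotr (v - 'D_v rho p) z = 0.
Proof.
move=> Mp Tz; have Tp := sub_tube Mp.
have p0 : p + (0 : R) *: v = p by rewrite scale0r addr0.
have d1 : is_derive (0 : R) 1 (fun s : R => rho (p + s *: v)) ('D_v rho p).
  rewrite -[X in 'D_v rho X]p0.
  by apply: chain_rule_row tube_open (tube_smooth 1) _ (is_derive_line p v 0); rewrite p0.
have d2 : is_derive (0 : R) 1 (fun s : R => 'D_z rho (rho (p + s *: v))) ('D_('D_v rho p) ('D_z rho) p).
  have e1 : rho (p + (0 : R) *: v) = p by rewrite p0 nearest_id.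
  rewrite -[X in 'D_('D_v rho p) _ X]e1.
  apply: chain_rule_row tube_open (nearest_derive 1 z) _ d1.
  by rewrite e1.
have d3 : is_derive (0 : R) 1 (fun s : R => p + s *: v - rho (p + s *: v)) (v - 'D_v rho p).
  exact: (is_deriveB (is_derive_line p v 0) d1).
have d4 := is_derive_dotr d3 d2.
have d5 : is_derive (0 : R) 1 (fun=> 0 : R) (0 : R) by exact: is_derive_cst.
have near0 : \forall s \near (0 : R),
    dotr (p + s *: v - rho (p + s *: v)) ('D_z rho (rho (p + s *: v))) = 0.
  near=> s; apply: nearest_tangent_normal.
  by apply: tangent_derive_nearest; exact: nearest_in.
have := near_is_derive_eq near0 d4 d5.
by rewrite p0 (nearest_id cM M0 Mp) subrr dotr0l addr0 (tangent_fixed Mp Tz).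
Unshelve. all: by end_near. Qed.

(** Two orthogonal projections of [v] differ by a tangent vector that is orthogonal to all tangent
    vectors, itself included. *)
Lemma tanprojE p v : M p -> tanproj M p v = 'D_v rho p.
Proof.
move=> Mp; have Tp := sub_tube Mp.
rewrite /tanproj; case: xgetP => [w _ [Tw hw]|/(_ ('D_v rho p))[]]; last first.
  split; first exact: tangent_derive_nearest.
  by move=> z Tz; exact: derive_nearest_normal.
have Td : tangent M p (w - 'D_v rho p).
  apply/tangentP => //; rewrite (derive_rowD _ _ tube_open (tube_smooth 1) Tp).
  rewrite (derive_rowN _ tube_open (tube_smooth 1) Tp) (tangent_fixed Mp Tw).
  by rewrite (tangent_fixed Mp (tangent_derive_nearest v Mp)).
apply/eqP; rewrite -subr_eq0; apply/eqP/dotr_eq0.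
have -> : dotr (w - 'D_v rho p) (w - 'D_v rho p) =
    dotr (v - 'D_v rho p) (w - 'D_v rho p) - dotr (v - w) (w - 'D_v rho p).
  by rewrite -dotrNl -dotrDl opprB [v - _ + _]addrC subrKA.
by rewrite hw// derive_nearest_normal// subrr.
Qed.

(* A second derivative along the curve sees a tangent field [Z] vanishing at the
   base point only through its tangential part. *)
Lemma tangent_field_derive (c Z : R -> 'rV[R]_N) s0 dZ : M (c s0) -> derivable c s0 1 ->
  (\forall s \near s0, 'D_(Z s) rho (c s) = Z s) -> (\forall s \near s0, M (c s)) ->
  Z s0 = 0 -> is_derive s0 1 Z dZ -> 'D_dZ rho (c s0) = dZ.
Proof.
move=> Mc dc hZ hM Z0 dZs; have Tc := sub_tube Mc.
apply/rowP => k; rewrite (derive_row_delta _ tube_open (tube_smooth 1) Tc) summxE.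
(* [G s] holds the coefficients of the [k]-th coordinate of the linear map v -> 'D_v rho (c s). In
   the derivative of the identity dotr Z G = Z_k, the term with the derivative of [G] has the factor
   [Z s0], which is 0. *)
pose G s : 'rV[R]_N := \row_i 'D_(delta_row i) rho (c s) 0 k.
have dG : derivable G s0 1.
  apply/derivable_mxP => i j; rewrite ord1.
  have [d _] := is_derive_coord (chain_rule_row tube_open (nearest_derive 1 (delta_row j))
    Tc (derivableP dc)) 0 k.
  by apply: near_eq_derivable d; near=> s; rewrite mxE.
have d1 := is_derive_dotr dZs (derivableP dG).
have d2 := is_derive_coord dZs 0 k.
have E : \forall s \near s0, dotr (Z s) (G s) = Z s 0 k.
  near=> s; have hs : 'D_(Z s) rho (c s) = Z s by near: s.
  have Ms : M (c s) by near: s.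
  rewrite -[in RHS]hs (derive_row_delta _ tube_open (tube_smooth 1) (sub_tube Ms)) summxE.
  by apply: eq_bigr => i _; rewrite !mxE.
have <- := near_is_derive_eq E d1 d2.
rewrite Z0 dotr0l addr0; apply: eq_bigr => i _; by rewrite !mxE.
Unshelve. all: by end_near. Qed.

(** The extension [Yt] behind [second_ff] is arbitrary. Along [c] it differs from the velocity by a
    tangent field vanishing at [s0], whose derivative there is tangent; so ['D_X Yt p] and the
    acceleration have the same normal part. *)
Lemma second_ffE (c : R -> 'rV[R]_N) s0 :
  (forall s, M (c s)) -> (forall s, derivable c s 1) -> derivable ('D_1 c) s0 1 ->
  second_ff M (c s0) ('D_1 c s0) ('D_1 c s0) =
  'D_1 ('D_1 c) s0 - tanproj M (c s0) ('D_1 ('D_1 c) s0).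
Proof.
move=> Mc dc d2c; set X := 'D_1 c s0; set a := 'D_1 ('D_1 c) s0; set p := c s0.
have Mp : M p by exact: Mc.
have Tp := sub_tube Mp.
have vel s : 'D_('D_1 c s) rho (c s) = 'D_1 c s.
  by apply: (@derive_nearest_velocity c 1 s ltr01 _ (dc s)) => s' _; exact: Mc.
rewrite /second_ff; case: xgetP => [w _ [TX [A [Yt [[oA Ap] sY tY Yp ->]]]]|]; last first.
  (* The default value is excluded: ['D_X rho] is a smooth tangent extension of [X]. *)
  move=> /(_ ('D_X ('D_X rho) p - tanproj M p ('D_X ('D_X rho) p)))[].
  split; first by apply/tangentP => //; exact: vel.
  exists tube, ('D_X rho); split=> //.
  - by split=> //; exact: tube_open.
  - by move=> k; exact: nearest_derive.
  - by move=> q Mq _; exact: tangent_derive_nearest.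
  - exact: vel.
rewrite !(tanprojE _ Mp).
have dY : is_derive s0 1 (fun s => Yt (c s)) ('D_X Yt p).
  exact: (chain_rule_row oA (sY 1%N) Ap (derivableP (dc s0))).
have dZ : is_derive s0 1 (fun s => Yt (c s) - 'D_1 c s) ('D_X Yt p - a).
  exact: (is_deriveB dY (derivableP d2c)).
have cc : {for s0, continuous c}.
  exact: (differentiable_continuous ((derivable1_diffP c s0).1 (dc s0))).
have nA : \forall s \near s0, A (c s) by apply: cc; exact: (open_nbhs_nbhs (conj oA Ap)).
have nZ : \forall s \near s0, 'D_(Yt (c s) - 'D_1 c s) rho (c s) = Yt (c s) - 'D_1 c s.
  near=> s; have Ac : A (c s) by near: s.
  have Tc := sub_tube (Mc s).
  rewrite (derive_rowD _ _ tube_open (tube_smooth 1) Tc).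
  by rewrite (derive_rowN _ tube_open (tube_smooth 1) Tc) vel (tangent_fixed (Mc s) (tY _ (Mc s) Ac)).
have nM : \forall s \near s0, M (c s) by near=> s; exact: Mc.
have Z0 : Yt (c s0) - 'D_1 c s0 = 0 by apply/eqP; rewrite subr_eq0; apply/eqP; exact: Yp.
have tZ := tangent_field_derive Mp (dc s0) nZ nM Z0 dZ.
move: tZ; rewrite (derive_rowD _ _ tube_open (tube_smooth 1) Tp).
rewrite (derive_rowN _ tube_open (tube_smooth 1) Tp) => tZ.
have aux (y Dy a' Da : 'rV[R]_N) : Dy - Da = y - a' -> y - Dy = a' - Da.
  by move=> e; apply/eqP; rewrite subr_eq addrAC -addrA [Dy - Da]e [a' + _]addrC subrK.
exact: aux tZ.
Unshelve. all: by end_near. Qed.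

End TangentSpace.

(** * Smooth steps and periodic extensions *)

Section Smoothstep.
Context {R : realType}.

Definition pos_part (z : R) : R := Num.max 0 z.

Lemma pos_part_ge0 z : 0 <= pos_part z. Proof. by rewrite le_max lexx. Qed.
Lemma pos_part_le0 z : z <= 0 -> pos_part z = 0. Proof. by move=> h; rewrite /pos_part max_l. Qed.
Lemma pos_part_id z : 0 <= z -> pos_part z = z. Proof. by move=> h; rewrite /pos_part max_r. Qed.
Lemma pos_part_le_norm z : pos_part z <= `|z|.
Proof. by rewrite /pos_part ge_max normr_ge0 ler_norm. Qed.

Lemma is_derive_pos_part k (x v : R) :
  is_derive x v (fun z => pos_part z ^+ k.+2) (v * (k.+2%:R * pos_part x ^+ k.+1)).
Proof.
case: (ltgtP x 0) => [x0|x0|->].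
- rewrite pos_part_le0 ?(ltW x0)// expr0n/= mulr0 mulr0.
  apply: (@near_eq_is_derive _ _ _ (fun=> (0 : R))).
  by near=> z; rewrite pos_part_le0 ?expr0n//; apply: ltW; near: z; exact: lt_nbhsl.
- rewrite pos_part_id ?(ltW x0)//.
  apply: (@near_eq_is_derive _ _ _ (fun z : R => z ^+ k.+2)).
    by near=> z; rewrite pos_part_id//; apply: ltW; near: z; exact: lt_nbhsr.
  split; first exact: exprn_derivable.
  by rewrite exp_derive mulrC.
- rewrite pos_part_id// expr0n/= mulr0 mulr0.
  (* At 0 the quotient is bounded by |h| |v|^2 for small h, because the exponent is at least 2. *)
  have q0 : (fun h => h^-1 *: (((fun z => pos_part z ^+ k.+2) \o shift 0) (h *: v) -
      pos_part 0 ^+ k.+2)) @ 0^' --> (0 : R).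
    apply/cvgr0Pnorm_le => /= e e0.
    have v1 : 0 < `|v| + 1 by rewrite ltr_wpDl.
    have v2 : 0 < `|v| ^+ 2 + 1 by rewrite ltr_wpDl.
    near=> h.
    have h0 : h != 0 by near: h; exact: nbhs_dnbhs_neq.
    rewrite (pos_part_id (lexx 0)) expr0n/= subr0 addr0 normrM normfV ler_pdivrMl ?normr_gt0//.
    have h1 : `|h *: v| <= 1.
      apply: (@le_trans _ _ (`|h| * (`|v| + 1))); first by rewrite normrM ler_wpM2l// lerDl.
      rewrite -ler_pdivlMr//; near: h; apply: dnbhs0_le.
      by rewrite divr_gt0.
    apply: (@le_trans _ _ (`|h *: v| ^+ 2)).
      rewrite ger0_norm ?exprn_ge0 ?pos_part_ge0// -addn2 exprD.
      rewrite -[leRHS]mul1r ler_pM ?exprn_ge0 ?pos_part_ge0//.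
        by rewrite exprn_ile1 ?pos_part_ge0// (le_trans (pos_part_le_norm _)).
      by rewrite ler_sqr ?nnegrE ?pos_part_ge0// pos_part_le_norm.
    rewrite normrM exprMn expr2 -mulrA ler_wpM2l//.
    apply: (@le_trans _ _ (`|h| * (`|v| ^+ 2 + 1))).
      by rewrite ler_wpM2l// lerDl.
    rewrite -ler_pdivlMr//; near: h; apply: dnbhs0_le.
    by rewrite divr_gt0.
  by split; [apply/cvg_ex; exists 0|exact: cvg_lim q0].
Unshelve. all: by end_near. Qed.

Lemma pos_part_continuous : continuous pos_part.
Proof. by move=> x; apply: (@continuous_max R R (fun=> 0) id) => //; exact: cvg_cst. Qed.

Lemma Ck_pos_part k : Ck k setT (fun z => pos_part z ^+ k.+1).
Proof.
have c j (x : R) : {for x, continuous (fun z => pos_part z ^+ j)}.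
  exact: (continuous_comp (@pos_part_continuous x) (@exprn_continuous _ j _)).
elim: k => [|k IH]; first by split=> // x _; exact: c.
split=> [x _|v]; first exact: c.
split=> [x _|]; first by have [] := is_derive_pos_part k x v.
have c1 : Ck k setT (fun z => v * (k.+2%:R * pos_part z ^+ k.+1)).
  apply: Ck_mul openT (Ck_cst _ _ _) _.
  exact: Ck_mul openT (Ck_cst _ _ _) IH.
by apply: (Ck_eq openT _ c1) => x _; have [_ ->] := is_derive_pos_part k x v.
Qed.

(** The exponent 3 is the least for which powers of the positive part are C^2, the regularity that
    closed geodesics have and that an equation of order two calls for. The denominator is positive
    because z and 1 - z are never both nonpositive. *)
Definition smoothstep (z : R) : R :=
  pos_part z ^+ 3 / (pos_part z ^+ 3 + pos_part (1 - z) ^+ 3).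

Lemma smoothstep_den z : 0 < pos_part z ^+ 3 + pos_part (1 - z) ^+ 3.
Proof.
have [z0|z0] := leP z 0.
  rewrite (pos_part_le0 z0) expr0n/= add0r exprn_gt0// pos_part_id; lra.
by rewrite ltr_pwDl ?exprn_ge0 ?pos_part_ge0// exprn_gt0// pos_part_id// ltW.
Qed.

Lemma smoothstep_le0 z : z <= 0 -> smoothstep z = 0.
Proof. by move=> z0; rewrite /smoothstep (pos_part_le0 z0) expr0n/= mul0r. Qed.

Lemma smoothstep_ge1 z : 1 <= z -> smoothstep z = 1.
Proof.
move=> z1; have := smoothstep_den z; rewrite /smoothstep (@pos_part_le0 (1 - z)).
  by rewrite expr0n/= addr0 => h; rewrite divff// gt_eqF.
by rewrite subr_le0.
Qed.

Lemma smoothstep_itv z : 0 <= smoothstep z <= 1.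
Proof.
rewrite /smoothstep divr_ge0 ?addr_ge0 ?exprn_ge0 ?pos_part_ge0//=.
by rewrite ler_pdivrMr ?smoothstep_den// mul1r lerDl exprn_ge0 ?pos_part_ge0.
Qed.

Lemma Ck_smoothstep_comp (V : normedModType R) (A : set V) (f : V -> R) :
  open A -> Ck 2 A f -> Ck 2 A (fun x => smoothstep (f x)).
Proof.
move=> oA cf.
have c1 : Ck 2 A (fun x => pos_part (f x) ^+ 3).
  exact: (Ck_comp1 openT oA (Ck_pos_part 2) cf).
have cf' : Ck 2 A (fun x => 1 - f x) by exact: (Ck_sub_fun oA (Ck_cst 2 A (1 : R)) cf).
have c2 : Ck 2 A (fun x => pos_part (1 - f x) ^+ 3).
  exact: (Ck_comp1 openT oA (Ck_pos_part 2) cf').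
exact: (Ck_mul oA c1 (Ck_inv oA (fun x _ => lt0r_neq0 (smoothstep_den (f x))) (Ck_add oA c1 c2))).
Qed.

End Smoothstep.

(** * Smooth interpolation of a finite sequence *)

Section Telescope.
Context {R : realType} {W : lmodType R}.

(** A sum rather than a definition by cases, so that regularity holds termwise. Every step is
    complete at the next integer, so at most one summand is in transition. *)
Definition telescope_blend (m : nat) (a : nat -> W) (z : R) : W :=
  a 0%N + \sum_(j < m) smoothstep (z - j%:R) *: (a j.+1 - a j).

Lemma telescope_blendE m a z i : (i < m)%N -> i%:R <= z <= i.+1%:R ->
  telescope_blend m a z = a i + smoothstep (z - i%:R) *: (a i.+1 - a i).
Proof.
move=> im /andP[iz zi]; rewrite /telescope_blend.
rewrite -(big_mkord xpredT (fun j => smoothstep (z - j%:R) *: (a j.+1 - a j))).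
rewrite (big_cat_nat (n := i))//=; last exact: ltnW.
rewrite (eq_big_nat _ _ (F2 := fun j => a j.+1 - a j)) => [|j /andP[_ ji]]; last first.
  by rewrite smoothstep_ge1 ?scale1r// lerBrDr nat1r (le_trans _ iz)// ler_nat.
rewrite telescope_sumr// addrA addrC subrKC.
rewrite big_ltn// big_nat_cond big1 ?addr0 1?addrC// => j /andP[/andP[ij _] _].
by rewrite smoothstep_le0 ?scale0r// subr_le0 (le_trans zi)// ler_nat.
Qed.

Lemma telescope_blend_le0 m a z : z <= 0 -> telescope_blend m a z = a 0%N.
Proof.
move=> z0; rewrite /telescope_blend big1 ?addr0// => j _.
by rewrite smoothstep_le0 ?scale0r// subr_le0 (le_trans z0).
Qed.

Lemma telescope_blend_ge m a z : m%:R <= z -> telescope_blend m a z = a m.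
Proof.
move=> zm; rewrite /telescope_blend.
rewrite -(big_mkord xpredT (fun j => smoothstep (z - j%:R) *: (a j.+1 - a j))).
rewrite (eq_big_nat _ _ (F2 := fun j => a j.+1 - a j)) => [|j /andP[_ ji]].
  by rewrite telescope_sumr// addrC subrK.
by rewrite smoothstep_ge1 ?scale1r// lerBrDr nat1r (le_trans _ zm)// ler_nat.
Qed.

End Telescope.

(** [L0] is the linear part of the affine map [L]. Difference quotients of the composition are
    literally those of [f], which avoids a chain rule on general normed spaces. *)
Lemma Ck_affine (R : realType) (V W : normedModType R) k (f : V -> W) (L L0 : V -> V) : continuous L ->
  (forall h v x, L (h *: v + x) = h *: L0 v + L x) -> Ck k setT f -> Ck k setT (fun z => f (L z)).
Proof.
move=> cL LE; have E (g : V -> W) z v : (fun h : R => h^-1 *: (((fun z => g (L z)) \o shift z) (h *: v) - g (L z))) =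
    (fun h : R => h^-1 *: ((g \o shift (L z)) (h *: L0 v) - g (L z))).
  by apply/funext => h /=; rewrite LE.
elim: k f => [|k IH] f cf; (split; first by move=> x _;
    apply: (@continuous_comp _ _ _ L f); [exact: cL|exact: (Ck_continuous cf I)]) => // v.
have dE : 'D_v (fun z => f (L z)) = (fun z => 'D_(L0 v) f (L z)).
  by apply/funext => z; rewrite /derive E.
split=> [x _|]; last by rewrite dE; exact: (IH _ (Ck_derive (L0 v) cf)).
by rewrite /derivable E; exact: (Ck_derivable cf I).
Qed.

(** * Periodic extension of functions that vanish outside one period *)

Section PeriodicExtension.
Context {R : realType} {V W : normedModType R}.
Variables (l : V -> R) (tau : V) (P : R).
Hypotheses (P0 : 0 < P) (cl : continuous l) (lD : forall x y, l (x + y) = l x + l y)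
  (lZ : forall a x, l (a *: x) = a * l x) (ltau : l tau = P).

Definition turn (z : V) : R := (Num.floor (l z / P))%:~R.
(** The functional [l] reads the coordinate in which [tau] is one full period. Leaving [V] general
    covers loops on the line as well as functions on space-time. *)
Definition perext (f : V -> W) (z : V) : W := f (z - turn z *: tau).

Lemma turn_itv z : turn z * P <= l z < (turn z + 1) * P.
Proof.
have /andP[h1 h2] := floor_itv (l z / P); rewrite /turn.
rewrite -ler_pdivlMr// h1 -ltr_pdivrMr//=; by rewrite intrD in h2.
Qed.

Lemma turn_unique z (k : int) : k%:~R * P <= l z < (k + 1)%:~R * P -> turn z = k%:~R.
Proof.
move=> /andP[h1 h2]; rewrite /turn (@floor_def _ _ k)//.
by rewrite ler_pdivlMr// h1 ltr_pdivrMr.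
Qed.

Lemma functionalB x y : l (x - y) = l x - l y.
Proof. by rewrite lD -scaleN1r lZ mulN1r. Qed.

Lemma reduced_itv z : 0 <= l (z - turn z *: tau) < P.
Proof.
by have := turn_itv z; rewrite functionalB lZ ltau mulrDl mul1r subr_ge0 ltrBlDl.
Qed.

Lemma perext_period f z : perext f (z + tau) = perext f z.
Proof.
rewrite /perext; have -> : turn (z + tau) = turn z + 1.
  rewrite -[1]/(1%:~R) /turn -intrD; apply: turn_unique; rewrite lD ltau.
  by have := turn_itv z; rewrite /turn !intrD !mulrDl !mul1r lerD2r ltrD2r.
by rewrite scalerDl scale1r opprD addrACA subrr addr0.
Qed.

Lemma Ck_shift k (f : V -> W) c : Ck k setT f -> Ck k setT (fun z => f (z + c)).
Proof.
move=> cf; apply: (Ck_affine (L := fun z => z + c) (L0 := id) _ _ cf) => [z|h v z].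
  exact: (cvgD cvg_id (cvg_cst c)).
by rewrite addrA.
Qed.

Lemma Ck_perext k (f : V -> W) : Ck k setT f ->
  (forall z, l z <= 0 -> f z = 0) -> (forall z, P <= l z -> f z = 0) ->
  Ck k setT (perext f).
Proof.
move=> cf f0 fP; apply: Ck_local => z _.
pose i := Num.floor (l z / P).
exists [set y | (i%:~R - 1) * P < l y < (i%:~R + 1) * P].
have oA : open [set y | (i%:~R - 1) * P < l y < (i%:~R + 1) * P].
  rewrite (_ : [set _ | _] = l @^-1` `](i%:~R - 1) * P, (i%:~R + 1) * P[%classic); last first.
    by apply/seteqP; split=> y /=; rewrite in_itv.
  by apply: open_comp; [move=> y _; exact: cl|exact: interval_open].
split=> //.
  have /andP[h1 h2] := turn_itv z; apply/andP; split; last exact: h2.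
  by apply: lt_le_trans h1; rewrite ltr_pM2r// ltrBlDr ltrDl.
(* On this strip the number of turns is [i] or [i - 1]. The sum of both translates is smooth and
   equals the extension, because the wrong translate vanishes by [fP] or [f0]. *)
apply: (Ck_eq oA (f := fun y => f (y + - (i%:~R *: tau)) + f (y + - ((i%:~R - 1) *: tau)))).
  move=> y /andP[y1 y2].
  have [yi|yi] := leP (i%:~R * P) (l y).
    have -> : perext f y = f (y - i%:~R *: tau).
      by rewrite /perext (@turn_unique _ i) ?yi ?intrD.
    rewrite [X in _ + X]fP ?addr0// functionalB lZ ltau.
    by rewrite mulrBl mul1r opprB addrCA lerDl subr_ge0.
  have -> : perext f y = f (y - (i%:~R - 1) *: tau).
    rewrite /perext (@turn_unique _ (i - 1)) ?subrK ?yi ?intrB ?(ltW y1)//.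
  by rewrite [X in X + _]f0 ?add0r// functionalB lZ ltau subr_le0 ltW.
apply: Ck_add => //; apply: (Ck_sub (B := setT)) => //; exact: Ck_shift.
Qed.

End PeriodicExtension.

(** * Approximation of the homotopy near the manifold *)

Section CompactUniform.
Context {R : realType} {V W : normedModType R}.

Lemma compact_tube (K U : set V) : compact K -> open U -> K `<=` U ->
  exists2 e : R, 0 < e & forall p q, K p -> `|q - p| < e -> U q.
Proof.
move=> /compact_near_coveringP cK oU KU.
have := cK R (0^'+) (fun e p => forall q, `|q - p| < e -> U q) _.
case=> [x Kx|d /= d0 hd].
  have /nbhs_normP[r /= r0 hr] := open_nbhs_nbhs (conj oU (KU x Kx)).
  exists ([set y | `|x - y| < r / 2], [set e : R | e < r / 2]) => /=.
    split; first by apply/nbhs_normP; exists (r / 2) => //=; rewrite divr_gt0.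
    by apply: nbhs_right_lt; rewrite divr_gt0.
  move=> -[y e] /= [xy er] q qy; apply: hr => /=.
  rewrite -(subrKA y) (le_lt_trans (ler_normD _ _))// [r]splitr ltrD//.
  by rewrite distrC (lt_trans qy).
exists (d / 2) => [|p q Kp qp]; first by rewrite divr_gt0.
apply: (hd (d / 2) _ _ p Kp q qp) => /=; last by rewrite divr_gt0.
by rewrite sub0r normrN gtr0_norm ?divr_gt0// ltr_pdivrMr//; lra.
Qed.

Lemma compact_uniform (K : set V) (f : V -> W) : compact K -> {within K, continuous f} ->
  forall e : R, 0 < e -> exists2 d : R, 0 < d &
    forall p q, K p -> K q -> `|q - p| < d -> `|f q - f p| < e.
Proof.
move=> /compact_near_coveringP cK /subspace_continuousP cf e e0.
have := cK R (0^'+) (fun d p => K p -> forall q, K q -> `|q - p| < d -> `|f q - f p| < e) _.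
case=> [x Kx|d /= d0 hd].
  have /cvgrPdist_lt/(_ (e / 2)) := cf x Kx; rewrite divr_gt0// => /(_ isT).
  move=> /nbhs_normP[r /= r0 hr].
  exists ([set y | `|x - y| < r / 2], [set e : R | e < r / 2]) => /=.
    split; first by apply/nbhs_normP; exists (r / 2) => //=; rewrite divr_gt0.
    by apply: nbhs_right_lt; rewrite divr_gt0.
  move=> -[y d] /= [xy dr] Ky q Kq qy.
  rewrite -(subrKA (f x)) (le_lt_trans (ler_normD _ _))// [e]splitr ltrD//.
    rewrite distrC; apply: hr => //=.
    rewrite -(subrKA y) (le_lt_trans (ler_normD _ _))// [r]splitr ltrD//.
    by rewrite distrC (lt_trans qy).
  by apply: hr => //=; rewrite (lt_trans xy)// ltr_pdivrMr//; lra.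
exists (d / 2) => [|p q Kp Kq qp]; first by rewrite divr_gt0.
apply: (hd (d / 2) _ _ p Kp Kp q Kq qp) => /=; last by rewrite divr_gt0.
by rewrite sub0r normrN gtr0_norm ?divr_gt0// ltr_pdivrMr//; lra.
Qed.

Lemma convex_close (u v w : W) (th e : R) : 0 <= th <= 1 -> `|u - w| <= e -> `|v - w| <= e ->
  `|u + th *: (v - u) - w| <= e.
Proof.
move=> /andP[t0 t1] hu hv.
have -> : u + th *: (v - u) - w = (1 - th) *: (u - w) + th *: (v - w).
  have -> : th *: (v - u) = th *: (v - w) - th *: (u - w).
    by rewrite -scalerBr opprB subrKA.
  by rewrite scalerBl scale1r addrAC [th *: (v - w) - _]addrC addrA.
rewrite (le_trans (ler_normD _ _))// !normrZ !ger0_norm ?subr_ge0//.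
have h1 : (1 - th) * `|u - w| <= (1 - th) * e by rewrite ler_wpM2l// subr_ge0.
have h2 : th * `|v - w| <= th * e by rewrite ler_wpM2l.
have -> : e = (1 - th) * e + th * e by ring.
exact: lerD.
Qed.

End CompactUniform.

Section Approximation.
Context {R : realType} {N : nat}.

Lemma periodic_intr {U : zmodType} (f : R -> U) (P x : R) (k : int) : periodic f P ->
  f (x - k%:~R * P) = f x.
Proof.
move=> pf; case: k => k.
  by rewrite -[in RHS](subrK (k%:R * P) x) mulr_natl periodicn.
by rewrite NegzE mulrNz mulNr opprK -pmulrn mulr_natl periodicn.
Qed.

Lemma Ck_telescope (V : normedModType R) (A : set V) m (z : V -> R) (a : nat -> V -> 'rV[R]_N) :
  open A -> Ck 2 A z -> (forall j, Ck 2 A (a j)) ->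
  Ck 2 A (fun x => telescope_blend m (a^~ x) (z x)).
Proof.
move=> oA cz ca; apply: (Ck_mx oA) => i j.
have cc l := Ck_coord i j oA (ca l).
have cs : Ck 2 A (fun x => \sum_(k < m) (smoothstep (z x - k%:R) * (a k.+1 x i j - a k x i j)) : R).
  apply: Ck_sum; [exact: oA|move=> k _].
  have c2 := Ck_smoothstep_comp oA (Ck_sub_fun oA cz (Ck_cst 2 A (k%:R : R))).
  exact: (Ck_mul oA c2 (Ck_sub_fun oA (cc k.+1) (cc k))).
apply: (Ck_eq oA _ (Ck_add oA (cc 0%N) cs)) => x _; rewrite mxE summxE; congr (_ + _).
by apply: eq_bigr => k _; rewrite !mxE.
Qed.

(** Samples of [h], [m] per period, are blended: each value is a convex combination of two
    neighbouring samples, both within [e] of [h x]. *)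
Lemma loop_approx (h : R -> 'rV[R]_N) (P d e : R) (m : nat) : 0 < P -> (0 < m)%N ->
  periodic h P -> P / m%:R < d ->
  (forall x x', 0 <= x <= P -> 0 <= x' <= P -> `|x - x'| < d -> `|h x - h x'| <= e) ->
  exists g : R -> 'rV[R]_N, [/\ Ck 2 setT g, periodic g P & forall x, `|g x - h x| <= e].
Proof.
move=> P0 m0 ph Pm hd.
have mR0 : 0 < m%:R :> R by rewrite ltr0n.
pose a j : 'rV[R]_N := h (j%:R * P / m%:R).
have am : a m = a 0%N.
  by rewrite /a mul0r mul0r mulrAC divff ?gt_eqF// mul1r -[P]add0r ph.
(* Subtracting the common value at both ends makes the blend vanish outside one period, as
   [Ck_perext] requires. *)
pose f x := telescope_blend m a (x * m%:R / P) - a 0%N.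
have cz : Ck 2 setT (fun x : R => x * m%:R / P).
  apply: (Ck_mul openT _ (Ck_cst 2 setT (P^-1 : R))).
  exact: (Ck_mul openT (Ck_id 2 setT) (Ck_cst 2 setT (m%:R : R))).
have cf : Ck 2 setT f.
  apply: (Ck_sub_fun openT _ (Ck_cst 2 setT (a 0%N))).
  exact: (Ck_telescope m openT cz (fun j => Ck_cst 2 setT (a j))).
have f0 x : x <= 0 -> f x = 0.
  move=> x0; rewrite /f telescope_blend_le0 ?subrr// mulr_le0_ge0 ?invr_ge0 ?(ltW P0)//.
  by rewrite mulr_le0_ge0.
have fP x : P <= x -> f x = 0.
  move=> Px; rewrite /f telescope_blend_ge ?am ?subrr//.
  by rewrite ler_pdivlMr// mulrC ler_wpM2r.
have idc : continuous (id : R -> R) by move=> x.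
have cp := Ck_perext P0 idc (fun _ _ => erefl) (fun _ _ => erefl) (erefl P) cf f0 fP.
exists (fun x => a 0%N + perext id P P f x); split.
- exact: (Ck_add openT (Ck_cst 2 setT (a 0%N)) cp).
- move=> x /=; congr (_ + _).
  exact: (perext_period P0 (fun _ _ => erefl) (erefl P) f x).
- move=> x; have /andP[] := @reduced_itv R R id P P P0 (fun _ _ => erefl) (fun _ _ => erefl) erefl x.
  rewrite /perext; set y := x - _ => y0 yP.
  have -> : h x = h y by rewrite /y /turn periodic_intr.
  rewrite /f [a 0%N + _]addrC subrK.
  set z := y * m%:R / P.
  have z0 : 0 <= z by rewrite /z divr_ge0 ?(ltW P0)// mulr_ge0.
  have zm : z < m%:R by rewrite /z ltr_pdivrMr// mulrC ltr_pM2l.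
  have /andP[kz zk] := truncn_itv z0.
  set k := Num.trunc z in kz zk.
  have km : (k < m)%N by rewrite -(ltr_nat R) (le_lt_trans kz).
  rewrite (telescope_blendE _ km) ?kz ?(ltW zk)//.
  have yz : y = z * P / m%:R by rewrite /z divfK ?gt_eqF// mulfK ?gt_eqF.
  have close j : (j <= m)%N -> `|j%:R - z| <= 1 -> `|a j - h y| <= e.
    move=> jm jz; apply: hd; last 1 first.
    - rewrite yz -mulrBl -mulrBl -mulrA normrM (gtr0_norm (x := P / m%:R)) ?divr_gt0//.
      by apply: le_lt_trans Pm; rewrite ler_piMl// divr_ge0 ?(ltW P0).
    - rewrite divr_ge0 ?mulr_ge0 ?(ltW P0)//= ler_pdivrMr// [P * _]mulrC ler_wpM2r ?(ltW P0)//.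
      by rewrite ler_nat.
    - by rewrite y0 ltW.
  apply: convex_close; first exact: smoothstep_itv.
    by apply: close; [exact: ltnW|rewrite ler_norml; lra].
  apply: close => //; rewrite ler_norml; rewrite -natr1 in zk *; lra.
Qed.

(** The slices of the homotopy at s = j / m are smoothed by [loop_approx], but the two end loops are
    kept unchanged, since the geodesics have to be met exactly. *)
Lemma homotopy_blend (M U : set 'rV[R]_N) (H : R * R -> 'rV[R]_N) (P : R) (g0 g1 : R -> 'rV[R]_N) :
  0 < P -> compact M -> open U -> M `<=` U ->
  {within `[0, 1] `*` setT, continuous H} ->
  (forall s : R, 0 <= s <= 1 -> periodic (fun x => H (s, x)) P) ->
  (forall s x : R, 0 <= s <= 1 -> M (H (s, x))) ->
  (forall x, H (0, x) = g0 x) -> (forall x, H (1, x) = g1 x) ->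
  Ck 2 setT g0 -> Ck 2 setT g1 -> periodic g0 P -> periodic g1 P ->
  exists (m : nat) (g : nat -> R -> 'rV[R]_N),
    [/\ (forall j, Ck 2 setT (g j)), (forall j, periodic (g j) P), g 0%N = g0, g m = g1 &
      forall z x, U (telescope_blend m (g^~ x) z)].
Proof.
move=> P0 cM oU MU cH pH HM H0 H1 cg0 cg1 pg0 pg1.
have [r r0 hr] := compact_tube cM oU MU.
(* A blend of neighbouring slices is within 2 e of a point of [M]: one e for smoothing, one for the
   change of slice. *)
pose e := r / 3; have e0 : 0 < e by rewrite divr_gt0.
pose K : set (R * R) := `[0, 1]%classic `*` `[0, P]%classic.
have cK : compact K by apply: compact_setX; exact: segment_compact.
have cHK : {within K, continuous H}.
  by apply: continuous_subspaceW cH => -[s x] [/= s01 _].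
have [d d0 hd] := compact_uniform cK cHK e0.
have hH s s' x x' : 0 <= s <= 1 -> 0 <= s' <= 1 -> 0 <= x <= P -> 0 <= x' <= P ->
    `|s - s'| < d -> `|x - x'| < d -> `|H (s, x) - H (s', x')| <= e.
  move=> s01 s01' xP xP' ss xx; apply/ltW/hd.
  - by split; rewrite /= in_itv.
  - by split; rewrite /= in_itv.
  - by rewrite prod_normE/= gt_max ss xx.
(* Large enough for both meshes, [1 / m] in the homotopy parameter and [P / m] along the loop, to be
   below [d]. *)
pose m := (Num.trunc ((1 + P) / d)).+1.
have m0 : (0 < m)%N by [].
have mR0 : 0 < m%:R :> R by rewrite ltr0n.
have hm : (1 + P) / d < m%:R.
  by have /andP[] := truncn_itv (ltW (divr_gt0 (addr_gt0 ltr01 P0) d0)).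
have md : (1 + P) < d * m%:R by rewrite mulrC -ltr_pdivrMr.
have hm1 : 1 / m%:R < d by rewrite ltr_pdivrMr//; lra.
have hmP : P / m%:R < d by rewrite ltr_pdivrMr//; lra.
have jm01 j : (j <= m)%N -> 0 <= (j%:R / m%:R : R) <= 1.
  by move=> jm; rewrite divr_ge0//= ler_pdivrMr// mul1r ler_nat.
have : forall j, exists g : R -> 'rV[R]_N, (j <= m)%N ->
    [/\ Ck 2 setT g, periodic g P & forall x, `|g x - H (j%:R / m%:R, x)| <= e].
  move=> j; have [jm|jm] := leqP j m; last by exists (fun=> 0).
  have s01 := jm01 j jm.
  have [|g hg] := @loop_approx (fun x => H (j%:R / m%:R, x)) P d e m P0 m0 (pH _ s01) hmP.
    by move=> x x' xP xP' xx; apply: hH => //; rewrite subrr normr0.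
  by exists g.
move=> /choice[ga hga].
pose g j := if j == 0%N then g0 else if (j < m)%N then ga j else g1.
have gE j x : (j <= m)%N -> `|g j x - H (j%:R / m%:R, x)| <= e.
  rewrite /g; case: eqP => [->|_]; first by rewrite mul0r H0 subrr normr0 ltW.
  case: ltngtP => // [jm _|->]; first by have [_ _] := hga j (ltnW jm); exact.
  by rewrite divff ?gt_eqF// H1 subrr normr0 ltW.
exists m, g; split.
- move=> j; rewrite /g; case: eqP => [_|_]; first exact: cg0.
  case: ifP => [jm|_]; last exact: cg1.
  by have [h _ _] := hga j (ltnW jm); exact: h.
- move=> j; rewrite /g; case: eqP => [_|_]; first exact: pg0.
  case: ifP => [jm|_]; last exact: pg1.
  by have [_ h _] := hga j (ltnW jm); exact: h.
- by [].
- by rewrite /g ltnn.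
move=> z x.
have [z0|z0] := leP z 0.
  by rewrite telescope_blend_le0//= /g/= -H0; apply/MU/HM; rewrite lexx ler01.
have [zm|zm] := leP m%:R z.
  by rewrite telescope_blend_ge//= /g/= ltnn -H1; apply/MU/HM; rewrite lexx ler01.
have /andP[kz zk] := truncn_itv (ltW z0).
set k := Num.trunc z in kz zk.
have km : (k < m)%N by rewrite -(ltr_nat R) (le_lt_trans kz).
rewrite (telescope_blendE _ km) ?kz ?(ltW zk)//.
apply: (hr (H (k%:R / m%:R, x))); first by apply/HM/jm01/ltnW.
apply: (@le_lt_trans _ _ (e + e)); last by rewrite /e; lra.
apply: convex_close; first exact: smoothstep_itv.
  by rewrite (le_trans (gE _ _ (ltnW km)))// lerDl ltW.
rewrite -(subrKA (H (k.+1%:R / m%:R, x))) (le_trans (ler_normD _ _))// lerD ?gE//.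
(* Uniform continuity of [H] is available on one period only. *)
pose y := x - (Num.floor (x / P))%:~R * P.
have yP : 0 <= y <= P.
  have /andP[h1 h2] := floor_itv (x / P).
  rewrite ler_pdivlMr// in h1; rewrite ltr_pdivrMr// intrD mulrDl mul1r in h2.
  by rewrite /y; lra.
have -> : H (k.+1%:R / m%:R, x) = H (k.+1%:R / m%:R, y).
  by rewrite /y (periodic_intr (f := fun x => H (_, x)))//; exact/pH/jm01.
have -> : H (k%:R / m%:R, x) = H (k%:R / m%:R, y).
  by rewrite /y (periodic_intr (f := fun x => H (_, x)))//; exact/pH/jm01/ltnW.
apply: hH => //; rewrite ?subrr ?normr0//; [exact: jm01|exact/jm01/ltnW|].
rewrite -mulrBl -natr1 addrAC subrr add0r gtr0_norm// divr_gt0//.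
Qed.

End Approximation.

(** * Integrals over the circle and over space-time *)

Section CircleIntegrals.
Context {R : realType}.
Local Notation P := (@period R).
Local Notation leb := (@lebesgue_measure R).
Local Notation circ := (@circle_measure R).
Implicit Types F G : R -> R -> R.

Lemma period_gt0 : 0 < P. Proof. by rewrite /period mulr_gt0// pi_gt0. Qed.

(** Periodicity in [x] stands in for compactness of the circle: bounds and moduli of continuity
    found on one period hold for all [x]. *)
Definition periodic_continuous F :=
  continuous (fun p : R * R => F p.1 p.2) /\ forall t, periodic (F t) P.

Lemma periodic_continuousD F G : periodic_continuous F -> periodic_continuous G ->
  periodic_continuous (fun t x => F t x + G t x).
Proof.
move=> [cF pF] [cG pG]; split=> [p|t x]; last by rewrite pF pG.
exact: (cvgD (cF p) (cG p)).
Qed.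

Lemma periodic_continuousB F G : periodic_continuous F -> periodic_continuous G ->
  periodic_continuous (fun t x => F t x - G t x).
Proof.
move=> [cF pF] [cG pG]; split=> [p|t x]; last by rewrite pF pG.
exact: (cvgB (cF p) (cG p)).
Qed.

Lemma periodic_continuousM F G : periodic_continuous F -> periodic_continuous G ->
  periodic_continuous (fun t x => F t x * G t x).
Proof.
move=> [cF pF] [cG pG]; split=> [p|t x]; last by rewrite pF pG.
exact: (cvgM (cF p) (cG p)).
Qed.

Lemma periodic_continuous_space F t : periodic_continuous F -> continuous (F t).
Proof.
move=> [cF _] x.
apply: (@continuous_comp _ _ _ (fun x : R => (t, x)) (fun p : R * R => F p.1 p.2)).
  move=> A [[B C] /= [Bt Cx] BCA]; apply: filterS Cx => y Cy; apply: BCA; split=> //=.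
  exact: nbhs_singleton Bt.
exact: cF.
Qed.

Lemma periodic_continuous_time F x : periodic_continuous F -> continuous (F^~ x).
Proof.
move=> [cF _] t.
apply: (@continuous_comp _ _ _ (fun t : R => (t, x)) (fun p : R * R => F p.1 p.2)).
  move=> A [[B C] /= [Bt Cx] BCA]; apply: filterS Bt => y By; apply: BCA; split=> //=.
  exact: nbhs_singleton Cx.
exact: cF.
Qed.

Lemma reduce_period (x : R) : exists k : int, 0 <= x - k%:~R * P <= P.
Proof.
exists (Num.floor (x / P)).
have /andP[h1 h2] := floor_itv (x / P).
rewrite ler_pdivlMr ?period_gt0// in h1.
by rewrite ltr_pdivrMr ?period_gt0// intrD mulrDl mul1r in h2; lra.
Qed.

Lemma periodic_continuous_uniform F (u v e : R) : periodic_continuous F -> 0 < e ->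
  exists2 d : R, 0 < d & forall t s x, u <= t <= v -> u <= s <= v -> `|t - s| < d ->
    `|F t x - F s x| <= e.
Proof.
move=> [cF pF] e0.
pose K : set (R * R) := `[u, v]%classic `*` `[0, P]%classic.
have cK : compact K by apply: compact_setX; exact: segment_compact.
have cFK : {within K, continuous (fun p : R * R => F p.1 p.2)} by exact: continuous_subspaceT.
have [d d0 hd] := compact_uniform cK cFK e0.
exists d => // t s x tuv suv ts.
have [k kx] := reduce_period x.
rewrite -(periodic_intr x k (pF t)) -(periodic_intr x k (pF s)).
apply: ltW; apply: (hd (s, _) (t, _)); rewrite /K/= ?in_itv/= ?tuv ?suv ?kx//.
by rewrite prod_normE/= subrr normr0 gt_max ts d0.
Qed.

Lemma periodic_continuous_bounded F (u v : R) : periodic_continuous F ->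
  exists2 C : R, 0 <= C & forall t x, u <= t <= v -> `|F t x| <= C.
Proof.
move=> [cF pF].
pose K : set (R * R) := `[u, v]%classic `*` `[0, P]%classic.
have cK : compact K by apply: compact_setX; exact: segment_compact.
have [K0|/set0P[p0 Kp0]] := eqVneq K set0.
  exists 0 => // t x tuv; exfalso.
  have : K (t, 0) by split; rewrite /= in_itv//= lexx/= ltW// period_gt0.
  by rewrite K0.
have cn : {within K, continuous (fun p : R * R => `|F p.1 p.2|)}.
  apply: continuous_subspaceT => p; apply: (@continuous_comp _ _ _ (fun p : R * R => F p.1 p.2) (fun y : R => `|y|)).
    exact: cF.
  exact: norm_continuous.
have [c Kc hc] := compact_EVT_max (ex_intro _ p0 Kp0) cK cn.
exists (`|F c.1 c.2|) => // t x tuv.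
have [k kx] := reduce_period x.
rewrite -(periodic_intr x k (pF t)).
by apply: (hc (t, _)); rewrite inE; split; rewrite /= in_itv.
Qed.

Lemma circle_measureT : circ setT = P%:E.
Proof.
rewrite /circle_measure /mrestr setTI lebesgue_measure_itv/= lte_fin period_gt0.
by rewrite oppr0 adde0.
Qed.

Lemma circle_integrable f : continuous f -> periodic f P -> circ.-integrable setT (EFin \o f).
Proof.
move=> cf pf; apply: measurable_bounded_integrable => //.
- exact: (eq_ind_r (fun z => (z < +oo)%E) (ltry P) circle_measureT).
- exact: continuous_measurable_fun.
have pc : periodic_continuous (fun=> f).
  split=> // p; apply: (@continuous_comp _ _ _ (@snd R R) f); last exact: cf.
  exact: cvg_snd.
have [C C0 hC] := periodic_continuous_bounded 0 0 pc.
exists C; split; first exact: num_real.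
by move=> y Cy x _ /=; rewrite (le_trans (hC 0 x _)) ?lexx// ltW.
Qed.

(** [circle_measure] lives on the whole line, and the complement of one period is null for it. *)
Lemma circle_integral f : continuous f -> periodic f P ->
  \int[circ]_x f x = \int[leb]_(x in `[0, P]) f x.
Proof.
move=> cf pf; rewrite /Rintegral; congr fine.
rewrite (@negligible_integral _ _ _ circ setT (~` `[0, P]%classic))//.
- rewrite setTD setCK; apply: eq_measure_integral => A mA AP; exact: (congr1 leb (setIidl AP)).
- exact: measurableC.
- exact: circle_integrable.
- exact: (etrans (congr1 leb (setICl _)) (measure0 leb)).
Qed.

Lemma Rintegral_FTC (F f : R -> R) (a b : R) : a < b -> (forall x : R, is_derive x 1 F (f x)) ->
  continuous f -> \int[leb]_(x in `[a, b]) f x = F b - F a.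
Proof.
move=> ab dF cf.
have cF : continuous F.
  by move=> x; apply: differentiable_continuous; apply/derivable1_diffP; have [] := dF x.
rewrite /Rintegral (continuous_FTC2 ab (F := F))//.
- exact: continuous_subspaceT.
- split.
  + by move=> x _; have [] := dF x.
  + exact: cvg_at_right_filter (cF a).
  + exact: cvg_at_left_filter (cF b).
- by move=> x _; rewrite derive1E; have [_ ->] := dF x.
Qed.

Lemma circle_integral_derive (g dg : R -> R) : (forall x : R, is_derive x 1 g (dg x)) ->
  continuous dg -> periodic g P -> periodic dg P -> \int[circ]_x dg x = 0.
Proof.
move=> dgE cdg pg pdg; rewrite circle_integral// (Rintegral_FTC period_gt0 dgE cdg).
by rewrite -[X in g X - _]add0r pg subrr.
Qed.

Lemma circle_integral_continuous F : periodic_continuous F ->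
  continuous (fun t => \int[circ]_x F t x).
Proof.
move=> pF t0.
have [C C0 hC] := periodic_continuous_bounded (t0 - 1) (t0 + 1) pF.
apply: (@continuity_under_integral R _ _ circ F setT measurableT (t0 - 1) (t0 + 1) _ _ (fun=> C)).
- by move=> t _; apply: circle_integrable; [exact: periodic_continuous_space|exact: pF.2].
- by apply: aeW => y _ t _; exact: periodic_continuous_time.
- by apply: circle_integrable => // x; exact: cvg_cst.
- move=> t /=; rewrite in_itv/= => /andP[t1 t2]; apply: aeW => y _.
  by apply: hC; rewrite !ltW.
- by rewrite inE/= in_itv/=; apply/andP; split; lra.
Qed.

Lemma circle_integral_derive_time F Ft : periodic_continuous F -> periodic_continuous Ft ->
  (forall t x : R, is_derive t 1 (F^~ x) (Ft t x)) ->
  forall t : R, is_derive t 1 (fun t => \int[circ]_x F t x) (\int[circ]_x Ft t x).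
Proof.
move=> pF pFt dF t0.
have [C C0 hC] := periodic_continuous_bounded (t0 - 1) (t0 + 1) pFt.
have I0 : `]t0 - 1, t0 + 1[%classic t0 by rewrite /= in_itv/=; apply/andP; split; lra.
have intF t : `]t0 - 1, t0 + 1[%classic t -> circ.-integrable setT (EFin \o F t).
  by move=> _; apply: circle_integrable; [exact: periodic_continuous_space|exact: pF.2].
have derF t x : `]t0 - 1, t0 + 1[%classic t -> setT x -> derivable (F^~ x) t 1.
  by move=> _ _; have [] := dF t x.
have intC : circ.-integrable setT (EFin \o (fun=> C)).
  by apply: circle_integrable => // x; exact: cvg_cst.
have hG t x : `]t0 - 1, t0 + 1[%classic t -> setT x -> `|partial1of2 F t x| <= C.
  rewrite /= in_itv/= => /andP[t1 t2] _; rewrite partial1of2E.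
  by have [_ ->] := dF t x; apply: hC; rewrite !ltW.
split.
  exact: (derivable_under_integral measurableT I0 intF derF (fun=> C0) intC hG).
rewrite -derive1E.
rewrite (differentiation_under_integral measurableT I0 intF derF (fun=> C0) intC hG).
by apply: eq_Rintegral => x _; rewrite partial1of2E; have [_ ->] := dF t0 x.
Qed.

Lemma interval_integrable T (J : R -> R) : continuous J -> leb.-integrable `[0, T] (EFin \o J).
Proof.
move=> cJ; apply: continuous_compact_integrable; first exact: segment_compact.
exact: continuous_subspaceT.
Qed.

Lemma st_integralD T F G : periodic_continuous F -> periodic_continuous G ->
  st_integral T (fun t x => F t x + G t x) = st_integral T F + st_integral T G.
Proof.
move=> pF pG; rewrite /st_integral -RintegralD//.
- apply: eq_Rintegral => t _; rewrite RintegralD//.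
    by apply: circle_integrable; [exact: periodic_continuous_space|exact: pF.2].
  by apply: circle_integrable; [exact: periodic_continuous_space|exact: pG.2].
- exact/interval_integrable/circle_integral_continuous.
- exact/interval_integrable/circle_integral_continuous.
Qed.

Lemma st_integral_dt T F Ft : 0 < T -> periodic_continuous F -> periodic_continuous Ft ->
  (forall t x : R, is_derive t 1 (F^~ x) (Ft t x)) ->
  (forall x, F 0 x = 0) -> (forall x, F T x = 0) -> st_integral T Ft = 0.
Proof.
move=> T0 pF pFt dF F0 FT; rewrite /st_integral.
rewrite (Rintegral_FTC T0 (circle_integral_derive_time pF pFt dF)); last first.
  exact: circle_integral_continuous.
have z (f : R -> R) : (forall x, f x = 0) -> \int[circ]_x f x = 0.
  move=> f0; rewrite (_ : f = cst 0); last exact/funext.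
  by rewrite Rintegral_cst// mul0r.
by rewrite !z// subrr.
Qed.

Lemma st_integral_dx T F Fx : periodic_continuous F -> periodic_continuous Fx ->
  (forall t x : R, is_derive x 1 (F t) (Fx t x)) -> st_integral T Fx = 0.
Proof.
move=> pF pFx dF; rewrite /st_integral.
rewrite (@eq_Rintegral _ _ _ leb _ (cst 0)) => [|t _]; last first.
  rewrite (circle_integral_derive (dF t))//; [|exact: pF.2|exact: pFx.2].
  exact: periodic_continuous_space.
by rewrite Rintegral_cst// mul0r.
Qed.

End CircleIntegrals.

(** * Continuous functions as elements of C([0, T]; L2) *)

Section CircleL2.
Context {R : realType} {N : nat}.
Local Notation P := (@period R).
Local Notation circ := (@circle_measure R).

(** The sharp factor is sqrt P; [P + 1] dominates it and avoids the root. *)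
Lemma circle_L2_bound (f : R -> R) C : continuous f -> 0 <= C -> (forall x, `|f x| <= C) ->
  ('N[circ]_(2%:E)[EFin \o f] <= (C * (P + 1))%:E)%E.
Proof.
move=> cf C0 hf.
have P0 := @period_gt0 R.
rewrite unlock /=.
have -> : (C * (P + 1))%:E = (((C * (P + 1)) ^+ 2)%:E `^ 2^-1)%E.
  rewrite poweR_EFin powR12_sqrt ?sqr_ge0// sqrtr_sqr ger0_norm// mulr_ge0// addr_ge0// ltW//.
rewrite (@eq_integral _ _ _ circ setT (fun x => (f x * f x)%:E)); last first.
  by move=> x _; rewrite powR_mulrn// real_normK ?num_real// expr2.
apply: gt0_ler_poweR.
- by rewrite invr_ge0.
- rewrite in_itv/= leey andbT integral_ge0// => x _.
  by rewrite lee_fin -expr2 sqr_ge0.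
- by rewrite in_itv/= leey andbT lee_fin sqr_ge0.
apply: (@le_trans _ _ (\int[circ]_x (cst (C ^+ 2)%:E x))%E).
  apply: ge0_le_integral => //.
  - by move=> x _; rewrite lee_fin -expr2 sqr_ge0.
  - apply/measurable_EFinP; apply: continuous_measurable_fun => x.
    exact: (cvgM (cf x) (cf x)).
  - by move=> x _; rewrite lee_fin -expr2 -real_normK ?num_real// ler_sqr ?nnegrE.
rewrite integral_cst//.
have -> : (_ * _ = (C ^+ 2 * P)%:E)%E := congr1 (fun z => ((C ^+ 2)%:E * z)%E) circle_measureT.
rewrite lee_fin exprMn ler_wpM2l ?sqr_ge0//.
by rewrite sqrrD expr1n mulr1 -addrA ler_wpDl ?sqr_ge0// mulr2n; lra.
Qed.

Lemma enorm_le (u : 'rV[R]_N) : enorm u <= N.+1%:R * `|u|.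
Proof.
rewrite /enorm -[leRHS]ger0_norm ?mulr_ge0// -sqrtr_sqr ler_wsqrtr//.
rewrite (le_trans (dotr_le_norm _))// exprMn ler_wpM2r ?sqr_ge0//.
by rewrite -natrX ler_nat (leq_trans (leqnSn N))// -{1}(expn1 N.+1) leq_pexp2l.
Qed.

(** Uniform continuity on [0, T] times one period gives convergence uniform in [x], hence in L2. *)
Lemma C0L2_continuous T (u : R -> R -> 'rV[R]_N) :
  (forall i, periodic_continuous (fun t x => u t x 0 i)) -> C0L2 T u.
Proof.
move=> pu.
have perU t : periodic (u t) P.
  by move=> x; apply/rowP => i; exact: (pu i).2.
have cu t i : continuous (fun x => u t x 0 i) := @periodic_continuous_space R (fun t x => u t x 0 i) t (pu i).
split=> [t _|t0 t0T].
  split; first exact: perU.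
  move=> i.
  have [C C0 hC] := periodic_continuous_bounded t t (pu i).
  apply/andP; split; rewrite inE/=.
    exact: continuous_measurable_fun.
  apply: le_lt_trans (circle_L2_bound (cu t i) C0 _) (ltry _).
  by move=> x; apply: hC; rewrite lexx.
have cdiff t : continuous (fun x => enorm (u t x - u t0 x)).
  move=> x; apply: (@continuous_comp _ _ _ (fun x => dotr (u t x - u t0 x) (u t x - u t0 x)) Num.sqrt); last exact: sqrt_continuous.
  rewrite /dotr; apply: cvg_big => [|i _]; first exact: add_continuous.
  apply: cvgM; rewrite (_ : (fun x => (u t x - u t0 x) 0 i) = fun x => u t x 0 i - u t0 x 0 i);
    try (by apply/funext => y; rewrite !mxE); rewrite ![(u t x - u t0 x) 0 i]mxE ![(- u t0 x) 0 i]mxE;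
    exact: (cvgB (cu t i x) (cu t0 i x)).
have bound e : 0 < e -> \forall t \near within `[0, T] (nbhs t0),
    forall x, `|enorm (u t x - u t0 x)| <= e.
  move=> e0.
  have : forall i : 'I_N, exists d, 0 < d /\ forall t s x, 0 <= t <= T -> 0 <= s <= T -> `|t - s| < d ->
      `|u t x 0 i - u s x 0 i| <= e / N.+1%:R.
    move=> i; have [|d d0 hd] := @periodic_continuous_uniform _ _ 0 T (e / N.+1%:R) (pu i).
      by rewrite divr_gt0.
    by exists d.
  move=> /choice[d hd].
  have [r r0 hr] := finite_lower_bound (fun i => (hd i).1).
  apply/nbhs_normP; exists r => // t /= tr tT x.
  rewrite ger0_norm ?sqrtr_ge0// (le_trans (enorm_le _))// -ler_pdivlMl// mulrC.
  apply: row_norm_le => [|i]; first by rewrite divr_ge0// ltW.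
  have t01 : 0 <= t <= T by move: tT; rewrite in_itv.
  have td : `|t - t0| < d i by rewrite distrC (lt_le_trans tr).
  by rewrite !mxE; exact: (hd i).2 t t0 x t01 t0T td.
rewrite -/(0%:E)%E; apply/fine_cvgP; split.
  near=> t.
  rewrite ge0_fin_numE ?Lnorm_ge0//.
  apply: le_lt_trans (circle_L2_bound (cdiff t) ler01 _) (ltry _).
  by near: t; exact: bound.
apply/cvgr0Pnorm_le => e e0.
pose e' := e / (P + 1).
have P1 : 0 < P + 1 by rewrite addr_gt0// period_gt0.
have e'0 : 0 < e' by rewrite divr_gt0.
near=> t.
have ht : (L2norm (fun x => (u t x - u t0 x)%R) <= (e' * (P + 1))%:E)%E.
  by apply: (circle_L2_bound (cdiff t) (ltW e'0)); near: t; exact: bound.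
rewrite divfK ?gt_eqF// in ht.
rewrite /= ger0_norm ?fine_ge0 ?Lnorm_ge0//.
rewrite -lee_fin fineK// ge0_fin_numE ?Lnorm_ge0//.
exact: le_lt_trans ht (ltry _).
Unshelve. all: by end_near. Qed.

End CircleL2.

(** * The d'Alembertian *)

Section PlaneCalculus.
Context {R : realType}.

Lemma is_derive_linear (V : normedModType R) (L : V -> R) (x v : V) :
  (forall a y z, L (a *: y + z) = a * L y + L z) -> is_derive x v L (L v).
Proof.
move=> Llin.
have E : \forall h \near 0^', h^-1 *: ((L \o shift x) (h *: v) - L x) = L v.
  near=> h; have h0 : h != 0 by near: h; exact: nbhs_dnbhs_neq.
  by rewrite /= Llin addrK /GRing.scale/= mulrA mulVf// mul1r.
split; first exact: (is_cvg_near_cst (L v) E).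
exact: (lim_near_cst (@Rhausdorff R) E).
Unshelve. all: by end_near. Qed.

Lemma Ck_fst k (A : set (R * R)) : Ck k A fst.
Proof.
apply: Ck_linear => [p v|p]; first exact: is_derive_linear.
exact: cvg_fst.
Qed.

Lemma Ck_snd k (A : set (R * R)) : Ck k A snd.
Proof.
apply: Ck_linear => [p v|p]; first exact: is_derive_linear.
exact: cvg_snd.
Qed.

Lemma chain_rule1 (V W : normedModType R) (c : R -> W) (g : V -> R) (x v : V) dg dc :
  is_derive x v g dg -> is_derive (g x) 1 c dc -> is_derive x v (fun y => c (g y)) (dg *: dc).
Proof.
move=> [dgx <-] [dcx <-].
have /derivable1P dG := dgx.
pose G (h : R) := g (h *: v + x).
have G0 : G 0 = g x by rewrite /G scale0r add0r.
have diffG : differentiable G 0 by exact/derivable1_diffP.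
have diffc : differentiable c (G 0) by rewrite G0; exact/derivable1_diffP.
have dcG : differentiable (c \o G) 0 by exact: differentiable_comp.
have eD (W' : normedModType R) (F : V -> W') : 'D_v F x = 'D_1 (fun h : R => F (h *: v + x)) 0.
  rewrite /derive; set g1 := fun h => h^-1 *: _; set g2 := fun h => h^-1 *: _.
  suff -> : g1 = g2 by [].
  by apply/funext => h; rewrite /g1 /g2 /= addr0 scale0r add0r [_%:A]mulr1.
split; first exact: (derivable1P (fun y => c (g y)) x v).2 ((derivable1_diffP _ _).2 dcG).
rewrite (eD _ (fun y => c (g y))) (eD _ g).
rewrite (deriveE _ dcG) (diff_comp diffG diffc) /= (deriveE _ diffG) -G0 (deriveE _ diffc).
by rewrite -[X in 'd c _ X]mulr1 linearZ.
Qed.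

Lemma derive_slice_time (W : normedModType R) (f : R * R -> W) t x :
  derivable f (t, x) (1, 0) -> is_derive t 1 (fun t => f (t, x)) ('D_(1, 0) f (t, x)).
Proof.
have E s : (0, x) + s *: (1, 0) = (s, x) :> R * R.
  by transitivity (0 + s * 1, x + s * 0) => //; rewrite mulr1 mulr0 add0r addr0.
rewrite -E => /derive_line; rewrite (_ : (fun t => f (t, x)) = (fun s : R => f ((0, x) + s *: (1, 0))))//.
by apply/funext => s; rewrite E.
Qed.

Lemma derive_slice_space (W : normedModType R) (f : R * R -> W) t x :
  derivable f (t, x) (0, 1) -> is_derive x 1 (fun x => f (t, x)) ('D_(0, 1) f (t, x)).
Proof.
have E s : (t, 0) + s *: (0, 1) = (t, s) :> R * R.
  by transitivity (t + s * 0, 0 + s * 1) => //; rewrite mulr1 mulr0 add0r addr0.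
rewrite -E => /derive_line; rewrite (_ : (fun x => f (t, x)) = (fun s : R => f ((t, 0) + s *: (0, 1))))//.
by apply/funext => s; rewrite E.
Qed.

Lemma derive_translate (V W : normedModType R) (f : V -> W) (c v x : V) :
  (forall y, f (y + c) = f y) -> 'D_v f (x + c) = 'D_v f x.
Proof.
move=> fc; rewrite /derive; set g1 := fun h => h^-1 *: _; set g2 := fun h => h^-1 *: _.
suff -> : g1 = g2 by [].
by apply/funext => h; rewrite /g1 /g2 /= addrA !fc.
Qed.

(** The direction is general so that the two second derivatives in [wave_box] are the cases (0, 1)
    and (1, 0) of one formula. *)
Lemma second_derive_wave (C A B : R -> R) (a b : R) (q : R * R) :
  Ck 2 setT C -> Ck 2 setT A -> Ck 2 setT B ->
  'D_(a, b) ('D_(a, b) (fun q => C (A (q.2 + q.1) + B (q.2 - q.1)))) q =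
  'D_1 ('D_1 C) (A (q.2 + q.1) + B (q.2 - q.1)) *
    ('D_1 A (q.2 + q.1) * (b + a) + 'D_1 B (q.2 - q.1) * (b - a)) ^+ 2 +
  'D_1 C (A (q.2 + q.1) + B (q.2 - q.1)) *
    ('D_1 ('D_1 A) (q.2 + q.1) * (b + a) ^+ 2 + 'D_1 ('D_1 B) (q.2 - q.1) * (b - a) ^+ 2).
Proof.
move=> cC cA cB.
have d1 (f : R -> R) (z : R) : Ck 2 setT f -> is_derive (z : R) 1 f ('D_1 f z).
  by move=> cf; apply: derivableP; exact: Ck_derivable cf I.
have d2 (f : R -> R) (z : R) : Ck 2 setT f -> is_derive (z : R) 1 ('D_1 f) ('D_1 ('D_1 f) z).
  by move=> cf; have c1 : Ck 1 setT ('D_1 f) := Ck_derive (1 : R) cf; apply: derivableP; exact: (Ck_derivable c1 I).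
have dp (p : R * R) : is_derive p (a, b) (fun q : R * R => q.2 + q.1) (b + a).
  by apply: (@is_derive_linear _ (fun q : R * R => q.2 + q.1)) => k y z /=; rewrite /GRing.scale/=; ring.
have dm (p : R * R) : is_derive p (a, b) (fun q : R * R => q.2 - q.1) (b - a).
  by apply: (@is_derive_linear _ (fun q : R * R => q.2 - q.1)) => k y z /=; rewrite /GRing.scale/=; ring.
have dA p := chain_rule1 (dp p) (d1 A _ cA).
have dB p := chain_rule1 (dm p) (d1 B _ cB).
have dg p := is_deriveD (dA p) (dB p).
have first p : 'D_(a, b) (fun q => C (A (q.2 + q.1) + B (q.2 - q.1))) p =
    'D_1 C (A (p.2 + p.1) + B (p.2 - p.1)) *
    ('D_1 A (p.2 + p.1) * (b + a) + 'D_1 B (p.2 - p.1) * (b - a)).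
  have [_ ->] := chain_rule1 (dg p) (d1 C _ cC).
  by rewrite /GRing.scale/=; ring.
have -> : 'D_(a, b) (fun q => C (A (q.2 + q.1) + B (q.2 - q.1))) =
    (fun p => 'D_1 C (A (p.2 + p.1) + B (p.2 - p.1)) *
    ((b + a) * 'D_1 A (p.2 + p.1) + (b - a) * 'D_1 B (p.2 - p.1))).
  by apply/funext => p; rewrite first (mulrC (b + a)) (mulrC (b - a)).
pose g p := A (p.2 + p.1) + B (p.2 - p.1).
have dC' : is_derive q (a, b) (fun p : R * R => 'D_1 C (g p))
    (((b + a) *: 'D_1 A (q.2 + q.1) + (b - a) *: 'D_1 B (q.2 - q.1)) *: 'D_1 ('D_1 C) (g q)).
  exact: (chain_rule1 (dg q) (d2 C _ cC)).
have dS : is_derive q (a, b) (fun p : R * R => (b + a) * 'D_1 A (p.2 + p.1) + (b - a) * 'D_1 B (p.2 - p.1))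
    ((b + a) * ((b + a) * 'D_1 ('D_1 A) (q.2 + q.1)) + (b - a) * ((b - a) * 'D_1 ('D_1 B) (q.2 - q.1))).
  exact: (is_deriveD (is_deriveZ (b + a) (chain_rule1 (dp q) (d2 A _ cA)))
    (is_deriveZ (b - a) (chain_rule1 (dm q) (d2 B _ cB)))).
have [_ ->] := is_deriveM dC' dS.
rewrite /GRing.scale/= -/(g q).
move: ('D_1 ('D_1 C) _) ('D_1 C _) ('D_1 ('D_1 A) _) ('D_1 A _) ('D_1 ('D_1 B) _) ('D_1 B _).
by move=> c2 c1 a2 a1 b2 b1; ring.
Qed.

End PlaneCalculus.

Lemma Ck_comp_scalar (R : realType) (V : normedModType R) b k (A : set R) (B : set V)
    (f : R -> 'rV[R]_b) (g : V -> R) :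
  open A -> open B -> Ck k A f -> Ck k B g -> (forall x, B x -> A (g x)) ->
  Ck k B (fun x => f (g x)).
Proof.
move=> oA oB cf cg AB; apply: (Ck_mx oB) => i j.
exact: (Ck_comp1 oA oB (Ck_coord i j oA cf) cg AB).
Qed.

Definition wave_box {R : realType} {N : nat} (phi : R * R -> 'rV[R]_N) (q : R * R) : 'rV[R]_N :=
  'D_(0, 1) ('D_(0, 1) phi) q - 'D_(1, 0) ('D_(1, 0) phi) q.

Section BoxOfWave.
Context {R : realType} {N : nat}.

Lemma near_derive2 (V W : normedModType R) (f g : V -> W) (B : set V) v q : open B -> B q ->
  (forall p, B p -> f p = g p) -> 'D_v ('D_v f) q = 'D_v ('D_v g) q.
Proof.
move=> oB Bq fg; apply: near_eq_derive; apply: (open_near oB Bq) => p Bp.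
by apply: near_eq_derive; exact: (open_near oB Bp).
Qed.

(* x + t and x - t are null coordinates: the terms in 'D_1 k cancel because
   A (x + t) + B (x - t) solves the linear wave equation. *)
Lemma wave_box_comp (phi : R * R -> 'rV[R]_N) (k : R -> 'rV[R]_N) (A B : R -> R)
    (D : set (R * R)) q :
  Ck 2 setT phi -> Ck 2 setT k -> Ck 2 setT A -> Ck 2 setT B -> open D -> D q ->
  (forall p, D p -> phi p = k (A (p.2 + p.1) + B (p.2 - p.1))) ->
  wave_box phi q = (4 * 'D_1 A (q.2 + q.1) * 'D_1 B (q.2 - q.1)) *:
    'D_1 ('D_1 k) (A (q.2 + q.1) + B (q.2 - q.1)).
Proof.
move=> cphi ck cA cB oD Dq E; apply/rowP => i; rewrite /wave_box 2!mxE [RHS]mxE.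
have co v : ('D_v ('D_v phi) q) 0 i = 'D_v ('D_v (fun p => phi p 0 i)) q.
  have c1 : Ck 1 setT ('D_v phi) := Ck_derive v cphi.
  rewrite derive_coord; last exact: (Ck_derivable c1 I).
  congr ('D_v _ q); apply/funext => p.
  by rewrite derive_coord//; exact: (Ck_derivable cphi I).
have ck1 : Ck 1 setT ('D_1 k) := Ck_derive (1 : R) ck.
have ek z : ('D_1 ('D_1 k) z) 0 i = 'D_1 ('D_1 (fun z => k z 0 i)) z.
  rewrite derive_coord; last exact: (Ck_derivable ck1 I).
  congr ('D_1 _ z); apply/funext => p.
  by rewrite derive_coord//; exact: (Ck_derivable ck I).
have Ei p : D p -> phi p 0 i = k (A (p.2 + p.1) + B (p.2 - p.1)) 0 i by move=> /E ->.
have cki := Ck_coord 0 i openT ck.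
set k1 := fun z => k z 0 i; set z := A (q.2 + q.1) + B (q.2 - q.1).
have form (a b : R) : ('D_(a, b) ('D_(a, b) phi) q) 0 i =
    'D_1 ('D_1 k1) z * ('D_1 A (q.2 + q.1) * (b + a) + 'D_1 B (q.2 - q.1) * (b - a)) ^+ 2 +
    'D_1 k1 z * ('D_1 ('D_1 A) (q.2 + q.1) * (b + a) ^+ 2 + 'D_1 ('D_1 B) (q.2 - q.1) * (b - a) ^+ 2).
  rewrite co -(second_derive_wave a b q cki cA cB).
  exact: (near_derive2 (g := fun p => k1 (A (p.2 + p.1) + B (p.2 - p.1))) (a, b) oD Dq Ei).
(* In both directions (b + a)^2 = (b - a)^2 = 1, so the second derivatives of [A] and [B] cancel,
   and (A' + B')^2 - (A' - B')^2 = 4 A' B'. *)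
have e := congr2 (fun x y : R => x - y) (form 0 1) (form 1 0).
apply: (etrans e); rewrite ek /= -/k1.
move: ('D_1 ('D_1 k1) _) ('D_1 k1 _) ('D_1 ('D_1 A) _) ('D_1 A _) ('D_1 ('D_1 B) _) ('D_1 B _).
by move=> c2 c1 a2 a1 b2 b1; ring.
Qed.

End BoxOfWave.

Lemma Ck_periodic_continuous (R : realType) (F : R * R -> R) : Ck 0 setT F ->
  (forall p, F (p + (0, period)) = F p) -> periodic_continuous (fun t x => F (t, x)).
Proof.
move=> cF pF; have E : (fun q : R * R => F (q.1, q.2)) = F by apply/funext => -[].
split; first by rewrite /= E => p; exact: (Ck_continuous cF I).
move=> t x; rewrite -[in RHS]pF; congr (F _).
by transitivity (t + 0, x + period) => //; rewrite addr0.
Qed.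

(** * Controlled wave maps *)

Section SolutionFromMap.
Context {R : realType} {N : nat}.
Variables (M : set 'rV[R]_N) (n : nat).
Hypotheses (cM : compact M) (M0 : M !=set0) (sM : embedded_submanifold n M).
Variable phi : R * R -> 'rV[R]_N.
Hypotheses (cphi : Ck 2 setT phi) (Mphi : forall p, M (phi p))
  (pphi : forall p, phi (p + (0, period)) = phi p).
Local Notation P := (@period R).
Let Ph (t x : R) := phi (t, x).
Let Pt (t x : R) := 'D_(1, 0) phi (t, x).
Let Px (t x : R) := 'D_(0, 1) phi (t, x).
Let Ptt (t x : R) := 'D_(1, 0) ('D_(1, 0) phi) (t, x).
Let Pxx (t x : R) := 'D_(0, 1) ('D_(0, 1) phi) (t, x).
Let Bx (t x : R) := wave_box phi (t, x).
Let Tn (t x : R) := tanproj M (phi (t, x)) (wave_box phi (t, x)).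

Lemma periodic_derive v p : 'D_v phi (p + (0, P)) = 'D_v phi p.
Proof. exact: derive_translate. Qed.

Lemma periodic_derive2 v p : 'D_v ('D_v phi) (p + (0, P)) = 'D_v ('D_v phi) p.
Proof. by apply: derive_translate => q; exact: periodic_derive. Qed.

Lemma coord_periodic_continuous k (f : R * R -> 'rV[R]_N) i : Ck k setT f ->
  (forall p, f (p + (0, P)) = f p) -> periodic_continuous (fun t x => f (t, x) 0 i).
Proof.
move=> cf pf; apply: (@Ck_periodic_continuous R (fun p => f p 0 i)).
  exact: (Ck_coord 0 i openT (Ck_leq (leq0n k) cf)).
by move=> p; rewrite pf.
Qed.

Let cD v : Ck 1 setT ('D_v phi) := Ck_derive v cphi.
Let cDD v : Ck 0 setT ('D_v ('D_v phi)) := Ck_derive v (cD v).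

Lemma Ck_wave_box : Ck 0 setT (wave_box phi).
Proof. exact: (Ck_sub_fun openT (cDD (0, 1)) (cDD (1, 0))). Qed.

Lemma periodic_wave_box p : wave_box phi (p + (0, P)) = wave_box phi p.
Proof. exact: (congr2 (fun u v : 'rV[R]_N => u - v) (periodic_derive2 (0, 1) p) (periodic_derive2 (1, 0) p)). Qed.

Let pcPh i : periodic_continuous (fun t x => Ph t x 0 i) := coord_periodic_continuous i cphi pphi.
Let pcPt i : periodic_continuous (fun t x => Pt t x 0 i) :=
  coord_periodic_continuous i (cD (1, 0)) (periodic_derive (1, 0)).
Let pcPx i : periodic_continuous (fun t x => Px t x 0 i) :=
  coord_periodic_continuous i (cD (0, 1)) (periodic_derive (0, 1)).
Let pcPtt i : periodic_continuous (fun t x => Ptt t x 0 i) :=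
  coord_periodic_continuous i (cDD (1, 0)) (periodic_derive2 (1, 0)).
Let pcPxx i : periodic_continuous (fun t x => Pxx t x 0 i) :=
  coord_periodic_continuous i (cDD (0, 1)) (periodic_derive2 (0, 1)).
Let pcBx i : periodic_continuous (fun t x => Bx t x 0 i) :=
  coord_periodic_continuous i Ck_wave_box periodic_wave_box.

Let tubephi p : tube M (phi p) := sub_tube cM M0 sM (Mphi p).

Lemma Ck_tanproj_wave_box : Ck 0 setT (fun p => tanproj M (phi p) (wave_box phi p)).
Proof.
apply: (Ck_mx openT) => i j; rewrite ord1.
have c0 : Ck 0 setT phi := Ck_leq (leq0n 2) cphi.
have cs : Ck 0 setT (fun p => \sum_k (wave_box phi p 0 k * 'D_(delta_row k) (nearest M) (phi p) 0 j) : R).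
  apply: Ck_sum; [exact: openT|move=> k _].
  apply: (Ck_mul openT (Ck_coord 0 k openT Ck_wave_box)); apply: (Ck_coord 0 j openT).
  exact: (Ck_comp_row (@tube_open _ _ M) openT (nearest_derive M 0 (delta_row k)) c0 (fun p _ => tubephi p)).
apply: (Ck_eq openT _ cs) => p _.
rewrite (tanprojE cM M0 sM) ?(derive_row_delta _ (@tube_open _ _ M) (tube_smooth M 1) (tubephi p))//.
by rewrite summxE; apply: eq_bigr => k _; rewrite [RHS]mxE.
Qed.

Let pcTn i : periodic_continuous (fun t x => Tn t x 0 i).
Proof.
apply: (coord_periodic_continuous i Ck_tanproj_wave_box) => p.
by rewrite pphi periodic_wave_box.
Qed.

Let dPh_t (t x : R) : is_derive t 1 (Ph^~ x) (Pt t x).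
Proof. exact: (derive_slice_time (Ck_derivable cphi I)). Qed.
Let dPh_x (t x : R) : is_derive x 1 (Ph t) (Px t x).
Proof. exact: (derive_slice_space (Ck_derivable cphi I)). Qed.
Let dPt (t x : R) : is_derive t 1 (Pt^~ x) (Ptt t x).
Proof. exact: (derive_slice_time (Ck_derivable (cD (1, 0)) I)). Qed.
Let dPx (t x : R) : is_derive x 1 (Px t) (Pxx t x).
Proof. exact: (derive_slice_space (Ck_derivable (cD (0, 1)) I)). Qed.

Lemma second_ff_curve (c v : R -> 'rV[R]_N) (w : 'rV[R]_N) (s0 : R) : (forall s, M (c s)) ->
  (forall s : R, is_derive s 1 c (v s)) -> is_derive s0 1 v w ->
  second_ff M (c s0) (v s0) (v s0) = w - tanproj M (c s0) w.
Proof.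
move=> Mc dc; have <- : 'D_1 c = v by apply/funext => s; have [_ ->] := dc s.
move=> [d2 <-]; apply: (second_ffE cM M0 sM Mc _ d2) => s.
by have [] := dc s.
Qed.

Lemma tanproj_sub p u v : M p -> tanproj M p (u - v) = tanproj M p u - tanproj M p v.
Proof.
move=> Mp; have Tp := sub_tube cM M0 sM Mp.
rewrite (tanprojE cM M0 sM _ Mp) (tanprojE cM M0 sM u Mp) (tanprojE cM M0 sM v Mp).
rewrite (derive_rowD _ _ (@tube_open _ _ M) (tube_smooth M 1) Tp).
by rewrite (derive_rowN _ (@tube_open _ _ M) (tube_smooth M 1) Tp).
Qed.

(** Both coordinate lines through a point are mapped to curves in [M], so [second_ffE] makes each
    term of the null form the normal part of a second derivative; their difference is the normal
    part of the d'Alembertian. *)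
Lemma null_form_wave_box t x : null_form M (Ph t x) (Pt t x) (Px t x) = Bx t x - Tn t x.
Proof.
have tt := second_ff_curve (fun s => Mphi (s, x)) (fun s => dPh_t s x) (dPt t x).
have xx := second_ff_curve (fun s => Mphi (t, s)) (dPh_x t) (dPx t x).
have E : Tn t x = tanproj M (Ph t x) (Pxx t x) - tanproj M (Ph t x) (Ptt t x).
  exact: (tanproj_sub _ _ (Mphi (t, x))).
rewrite E /null_form; apply: (etrans (congr2 (fun u v => - u + v) tt xx)).
have alg (a b c d : 'rV[R]_N) : - (a - c) + (b - d) = (b - a) - (d - c).
  by apply/rowP => i; rewrite !mxE; ring.
exact: alg.
Qed.

Lemma test_function_data T psi : test_function T psi ->
  [/\ [/\ periodic_continuous (fun t x => psi (t, x)), periodic_continuous (dt psi) &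
      periodic_continuous (dx psi)], (forall t x : R, is_derive t 1 (fun t => psi (t, x)) (dt psi t x)),
      (forall t x : R, is_derive x 1 (fun x => psi (t, x)) (dx psi t x)) &
      (forall t x, ~ (0 < t < T) -> psi (t, x) = 0)].
Proof.
move=> [spsi ppsi [a [b [a0 bT hab]]]].
have pp p : psi (p + (0, P)) = psi p.
  case: p => t x; rewrite -(ppsi t x); congr (psi _).
  by transitivity (t + 0, x + P) => //; rewrite addr0.
have pd v p : 'D_v psi (p + (0, P)) = 'D_v psi p by exact: derive_translate.
split.
- split; first exact: (Ck_periodic_continuous (spsi 0%N) pp).
    have c1 : Ck 0 setT ('D_(1, 0) psi) := Ck_derive ((1, 0) : R * R) (spsi 1%N).
    exact: (@Ck_periodic_continuous R ('D_(1, 0) psi) c1 (pd (1, 0))).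
  have c1 : Ck 0 setT ('D_(0, 1) psi) := Ck_derive ((0, 1) : R * R) (spsi 1%N).
  exact: (@Ck_periodic_continuous R ('D_(0, 1) psi) c1 (pd (0, 1))).
- by move=> t x; exact: (derive_slice_time (Ck_derivable (spsi 1%N) I)).
- by move=> t x; exact: (derive_slice_space (Ck_derivable (spsi 1%N) I)).
- move=> t x nt; apply/eqP/negPn/negP => /hab h; apply: nt; lra.
Qed.

Lemma st_integral_parts_time T (u ut : R -> R -> R) psi : 0 < T -> test_function T psi ->
  periodic_continuous u -> periodic_continuous ut ->
  (forall t x : R, is_derive t 1 (u^~ x) (ut t x)) ->
  st_integral T (fun t x => u t x * dt psi t x + ut t x * psi (t, x)) = 0.
Proof.
move=> T0 /test_function_data[[pp pt _] dpt _ z] pu put du.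
apply: (@st_integral_dt R T (fun t x => u t x * psi (t, x))) => //.
- exact: (periodic_continuousM pu pp).
- exact: (periodic_continuousD (periodic_continuousM pu pt) (periodic_continuousM put pp)).
- move=> t x; have h := is_deriveM (du t x) (dpt t x).
  by apply: (is_derive_eq h); rewrite /GRing.scale/=; ring.
- by move=> x; rewrite z ?mulr0// ltxx.
- by move=> x; rewrite z ?mulr0// ltxx andbF.
Qed.

Lemma st_integral_parts_space T (u ux : R -> R -> R) psi : test_function T psi ->
  periodic_continuous u -> periodic_continuous ux ->
  (forall t x : R, is_derive x 1 (u t) (ux t x)) ->
  st_integral T (fun t x => u t x * dx psi t x + ux t x * psi (t, x)) = 0.
Proof.
move=> /test_function_data[[pp _ px] _ dpx _] pu pux du.
apply: (@st_integral_dx R T (fun t x => u t x * psi (t, x))) => //.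
- exact: (periodic_continuousM pu pp).
- exact: (periodic_continuousD (periodic_continuousM pu px) (periodic_continuousM pux pp)).
- move=> t x; have h := is_deriveM (du t x) (dpx t x).
  by apply: (is_derive_eq h); rewrite /GRing.scale/=; ring.
Qed.

Lemma H1_map_slice T t : 0 <= t <= T -> H1_map M (Ph t) (Px t).
Proof.
move=> tT.
have [lPh _] := C0L2_continuous T pcPh; have [lPx _] := C0L2_continuous T pcPx.
split.
- move=> x; apply: differentiable_continuous; apply/derivable1_diffP.
  by have [] := dPh_x t x.
- by move=> x; exact: Mphi.
- exact: lPh tT.
- exact: lPx tT.
- move=> eta seta peta i.
  have deta (x : R) : is_derive x 1 eta ('D_1 eta x).
    by apply: derivableP; exact: (Ck_derivable (seta 1%N) I).
  have ceta := fun x => Ck_continuous (seta 0%N) (I : setT x).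
  have cdeta := fun x => Ck_continuous (Ck_derive (1 : R) (seta 1%N)) (I : setT x).
  have pdeta : periodic ('D_1 eta) P by move=> x; exact: derive_translate.
  have E1 : derive1 eta = 'D_1 eta by apply/funext => x; rewrite derive1E.
  have cu := @periodic_continuous_space R _ t (pcPh i); have cux := @periodic_continuous_space R _ t (pcPx i).
  have pu := (pcPh i).2 t; have pux := (pcPx i).2 t.
  have c1 : continuous (fun x => Ph t x 0 i * 'D_1 eta x) by move=> x; exact: (cvgM (cu x) (cdeta x)).
  have c2 : continuous (fun x => Px t x 0 i * eta x) by move=> x; exact: (cvgM (cux x) (ceta x)).
  have p1 : periodic (fun x => Ph t x 0 i * 'D_1 eta x) P by move=> x; rewrite pu pdeta.
  have p2 : periodic (fun x => Px t x 0 i * eta x) P by move=> x; rewrite pux peta.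
  apply/eqP; rewrite -addr_eq0 E1 -RintegralD; [|exact: measurableT|exact: circle_integrable|exact: circle_integrable].
  apply/eqP; apply: (@circle_integral_derive R (fun x => Ph t x 0 i * eta x)).
  + move=> x; have h := is_deriveM (is_derive_coord (dPh_x t x) 0 i) (deta x).
    by apply: (is_derive_eq h); rewrite /GRing.scale/=; ring.
  + by move=> x; exact: (cvgD (c1 x) (c2 x)).
  + by move=> x; rewrite pu peta.
  + by move=> x; rewrite p1 p2.
Qed.

(** After integration by parts, the equation asks that the tangential part of the d'Alembertian
    agree with its restriction to omega; [free] is exactly this. *)
Lemma wave_map_of_map omega T : 0 < T ->
  (forall t x, ~ omega x -> tanproj M (phi (t, x)) (wave_box phi (t, x)) = 0) ->
  C0L2 T (fun t x => wave_box phi (t, x)) /\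
  wave_map_solution M omega T (fun t x => wave_box phi (t, x)) Ph Px Pt.
Proof.
have alg (a b c d : R) : a + b = c + d -> c = 0 -> b = 0 -> a = d by lra.
move=> T0 free; split; first exact: (C0L2_continuous T pcBx).
split.
  split.
  - split; [exact: (C0L2_continuous T pcPh)|exact: (C0L2_continuous T pcPx)|exact: (C0L2_continuous T pcPt)].
  - by move=> t tT; exact: (H1_map_slice tT).
  - move=> t _; apply: aeW => x; apply: (tangentP cM M0 sM _ (Mphi (t, x))).2.
    have [dc ec] := dPh_t t x.
    by have := derive_nearest_velocity cM M0 sM ltr01 (fun s _ => Mphi (s, x)) dc; rewrite ec.
  - move=> psi tpsi i; have [[pp pt _] _ _ _] := test_function_data tpsi.
    apply/eqP; rewrite -addr_eq0 -st_integralD; first apply/eqP.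
    + exact: (st_integral_parts_time T0 tpsi (pcPh i) (pcPt i) (fun t x => is_derive_coord (dPh_t t x) 0 i)).
    + exact: (periodic_continuousM (pcPh i) pt).
    + exact: (periodic_continuousM (pcPt i) pp).
move=> psi tpsi i; have [[pp pt px] _ _ _] := test_function_data tpsi.
have it := st_integral_parts_time T0 tpsi (pcPt i) (pcPtt i) (fun t x => is_derive_coord (dPt t x) 0 i).
have ix := st_integral_parts_space tpsi (pcPx i) (pcPxx i) (fun t x => is_derive_coord (dPx t x) 0 i).
(* [F] and [G] are the t- and x-derivatives of [Pt * psi] and [Px * psi], so their integrals vanish.
   [L] and [K] are the integrands of the two sides of the equation. *)
pose F (t x : R) := Pt t x 0 i * dt psi t x + Ptt t x 0 i * psi (t, x).
pose G (t x : R) := Px t x 0 i * dx psi t x + Pxx t x 0 i * psi (t, x).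
pose K (t x : R) := Tn t x 0 i * psi (t, x).
pose L (t x : R) := Pt t x 0 i * dt psi t x - Px t x 0 i * dx psi t x
      - null_form M (Ph t x) (Pt t x) (Px t x) 0 i * psi (t, x).
have pF : periodic_continuous F by exact: (periodic_continuousD (periodic_continuousM (pcPt i) pt) (periodic_continuousM (pcPtt i) pp)).
have pG : periodic_continuous G by exact: (periodic_continuousD (periodic_continuousM (pcPx i) px) (periodic_continuousM (pcPxx i) pp)).
have pK : periodic_continuous K by exact: (periodic_continuousM (pcTn i) pp).
have pL : periodic_continuous (fun t x => F t x + K t x - G t x).
  exact: (periodic_continuousB (periodic_continuousD pF pK) pG).
have EL : L = (fun t x => F t x + K t x - G t x).
  apply/funext => t; apply/funext => x.
  have entry (a b c : 'rV[R]_N) : ((a - b) - c) 0 i = a 0 i - b 0 i - c 0 i by rewrite !mxE.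
  have nf : null_form M (Ph t x) (Pt t x) (Px t x) 0 i = Pxx t x 0 i - Ptt t x 0 i - Tn t x 0 i.
    exact: (etrans (congr1 (fun u : 'rV[R]_N => u 0 i) (null_form_wave_box t x)) (entry _ _ _)).
  rewrite /L nf.
  have alg2 (u v w y z a b c : R) : u * a - v * b - (y - w - z) * c =
      (u * a + w * c) + z * c - (v * b + y * c) by ring.
  exact: alg2.
have ER : (fun t x => \1_omega x * tanproj M (Ph t x) (wave_box phi (t, x)) 0 i * psi (t, x)) = K.
  apply/funext => t; apply/funext => x; rewrite /K /Tn.
  have [xo|xo] := pselect (omega x); first by rewrite indicE mem_set// mul1r.
  by rewrite free// mxE mulr0 mul0r.
have e1 : st_integral T (fun t x => L t x + G t x) = st_integral T (fun t x => F t x + K t x).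
  congr st_integral; apply/funext => t; apply/funext => x; rewrite EL; ring.
have pL' : periodic_continuous L by rewrite EL.
have e2 := etrans (esym (st_integralD T pL' pG)) (etrans e1 (st_integralD T pF pK)).
apply: (etrans (alg _ _ _ _ e2 it ix)); exact: (congr1 (st_integral T) (esym ER)).
Qed.

End SolutionFromMap.

(** * Position and progress of the controlled loop *)

Section Profiles.
Context {R : realType}.

Definition ramp (a w z : R) : R := smoothstep ((z - a) / w).

Lemma ramp0 (a w z : R) : 0 < w -> z <= a -> ramp a w z = 0.
Proof. by move=> w0 za; rewrite /ramp smoothstep_le0// pmulr_lle0 ?invr_gt0// subr_le0. Qed.

Lemma ramp1 (a w z : R) : 0 < w -> a + w <= z -> ramp a w z = 1.
Proof. by move=> w0 za; rewrite /ramp smoothstep_ge1// ler_pdivlMr// mul1r lerBrDl. Qed.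

Lemma Ck_ramp (V : normedModType R) a w (f : V -> R) : Ck 2 setT f ->
  Ck 2 setT (fun x => ramp a w (f x)).
Proof.
move=> cf; apply: (Ck_smoothstep_comp openT).
have c1 := Ck_sub_fun openT cf (Ck_cst 2 setT (a : R)).
exact: (Ck_mul openT c1 (Ck_cst 2 setT (w^-1 : R))).
Qed.

Variables (P e : R).
Hypotheses (e0 : 0 < e) (eP : 4 * e <= P).

Local Ltac plra := move: (e0) (eP) => ? ?; lra.

(* Where [e <= y <= P - e], the deviation [fwd_profile (y + t) + bwd_profile (y - t)]
   solves the linear wave equation; it vanishes for [t <= e / 2] and equals [- y]
   for [t >= P - e / 2], which collapses the loop to a constant. *)
Definition fwd_profile (z : R) : R := - (z / 2) * ramp P (e / 2) z.
Definition bwd_profile (z : R) : R := - (z / 2) * ramp 0 (e / 2) (- z).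
(** Here [y] is the position relative to the centre of the control interval, reduced to one period.
    The window removes a neighbourhood of that centre, where the periodic extension is glued. *)
Definition window (y : R) : R := ramp (e / 2) (e / 2) y * ramp (e / 2) (e / 2) (P - y).
(* A wave moving in one direction is null, hence the composition of any curve with
   [switch (y + t)] is annihilated by the d'Alembertian. *)
Definition switch (z : R) : R := ramp (2 * P - e / 2) e z.
(** [switch (y + t)] may differ between y = 0 and y = P, so it does not close up around the circle;
    near the centre the progress follows this function of time alone. *)
Definition clock (t : R) : R := ramp P P t.
Definition shift_dev (q : R * R) : R := window q.2 * (fwd_profile (q.2 + q.1) + bwd_profile (q.2 - q.1)).
Definition switch_dev (q : R * R) : R := window q.2 * (switch (q.2 + q.1) - clock q.1).

Let P0 : 0 < P. Proof. by have := e0; have := eP; plra. Qed.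
Let e20 : 0 < e / 2. Proof. by rewrite divr_gt0. Qed.

Lemma fwd_profile0 (z : R) : z <= P -> fwd_profile z = 0.
Proof. by move=> h; rewrite /fwd_profile (ramp0 e20 h) mulr0. Qed.
Lemma fwd_profile1 (z : R) : P + e / 2 <= z -> fwd_profile z = - (z / 2).
Proof. by move=> h; rewrite /fwd_profile (ramp1 e20 h) mulr1. Qed.
Lemma bwd_profile0 (z : R) : 0 <= z -> bwd_profile z = 0.
Proof. by move=> h; rewrite /bwd_profile (ramp0 e20) ?mulr0// oppr_le0. Qed.
Lemma bwd_profile1 (z : R) : z <= - (e / 2) -> bwd_profile z = - (z / 2).
Proof. by move=> h; rewrite /bwd_profile (ramp1 e20) ?mulr1// add0r lerNr. Qed.
Lemma window_l (y : R) : y <= e / 2 -> window y = 0.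
Proof. by move=> h; rewrite /window (ramp0 e20 h) mul0r. Qed.
Lemma window_r (y : R) : P - e / 2 <= y -> window y = 0.
Proof. by move=> h; rewrite /window (@ramp0 _ _ (P - y) e20) ?mulr0//; plra. Qed.
Lemma window1 (y : R) : e <= y <= P - e -> window y = 1.
Proof. by move=> h; rewrite /window !ramp1 ?mulr1//; plra. Qed.

Lemma shift_dev_early (t y : R) : t <= e / 2 -> shift_dev (t, y) = 0.
Proof.
move=> te; rewrite /shift_dev/=.
have [y1|y1] := leP y (e / 2); first by rewrite window_l// mul0r.
have [y2|y2] := leP (P - e / 2) y; first by rewrite window_r// mul0r.
by rewrite fwd_profile0 ?bwd_profile0 ?addr0 ?mulr0//; plra.
Qed.

(** The value no longer depends on [t]; this is why, in [position], the copy frozen at [T / 2]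
    cancels one of the two moving copies. *)
Lemma shift_dev_late (t y : R) : P <= t -> shift_dev (t, y) = - (window y * y).
Proof.
move=> te; rewrite /shift_dev/=.
have [y1|y1] := leP y (e / 2); first by rewrite window_l// !mul0r oppr0.
have [y2|y2] := leP (P - e / 2) y; first by rewrite window_r// !mul0r oppr0.
by rewrite fwd_profile1 ?bwd_profile1; [field|plra|plra].
Qed.

Lemma shift_dev_free (t y : R) : e <= y <= P - e ->
  shift_dev (t, y) = fwd_profile (y + t) + bwd_profile (y - t).
Proof. by move=> h; rewrite /shift_dev/= window1// mul1r. Qed.

Lemma shift_dev_free_late (t y : R) : e <= y <= P - e -> P - e / 2 <= t -> shift_dev (t, y) = - y.
Proof.
move=> h ht; rewrite shift_dev_free// fwd_profile1 ?bwd_profile1//; plra.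
Qed.

Lemma switch_dev_early (t y : R) : t <= P -> switch_dev (t, y) = 0.
Proof.
move=> te; rewrite /switch_dev/= /clock (ramp0 P0 te) subr0.
have [y2|y2] := leP (P - e / 2) y; first by rewrite window_r// mul0r.
by rewrite /switch (ramp0 e0) ?mulr0//; plra.
Qed.

Lemma switch_dev_late (t y : R) : 2 * P <= t -> switch_dev (t, y) = 0.
Proof.
move=> te; have h : P + P <= t by plra.
rewrite /switch_dev/= /clock (ramp1 P0 h).
have [y1|y1] := leP y (e / 2); first by rewrite window_l// mul0r.
by rewrite /switch (ramp1 e0) ?subrr ?mulr0//; plra.
Qed.

Lemma Ck_fwd_profile : Ck 2 setT fwd_profile.
Proof.
have cz := Ck_opp openT (Ck_mul openT (Ck_id 2 setT) (Ck_cst 2 setT (2^-1 : R))).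
exact: (Ck_mul openT cz (Ck_ramp _ _ (Ck_id 2 setT))).
Qed.

Lemma Ck_bwd_profile : Ck 2 setT bwd_profile.
Proof.
have cz := Ck_opp openT (Ck_mul openT (Ck_id 2 setT) (Ck_cst 2 setT (2^-1 : R))).
exact: (Ck_mul openT cz (Ck_ramp _ _ (Ck_opp openT (Ck_id 2 setT)))).
Qed.

Let cadd : Ck 2 setT (fun q : R * R => q.2 + q.1) := Ck_add openT (Ck_snd 2 setT) (Ck_fst 2 setT).
Let csub : Ck 2 setT (fun q : R * R => q.2 - q.1) := Ck_sub_fun openT (Ck_snd 2 setT) (Ck_fst 2 setT).

Let Ck_window : Ck 2 setT (fun q : R * R => window q.2).
Proof.
exact: (Ck_mul openT (Ck_ramp _ _ (Ck_snd 2 setT))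
  (Ck_ramp _ _ (Ck_sub_fun openT (Ck_cst 2 setT P) (Ck_snd 2 setT)))).
Qed.

Lemma Ck_shift_dev : Ck 2 setT shift_dev.
Proof.
apply: (Ck_mul openT Ck_window); apply: (Ck_add openT).
  exact: (Ck_comp1 openT openT Ck_fwd_profile cadd (fun _ _ => I)).
exact: (Ck_comp1 openT openT Ck_bwd_profile csub (fun _ _ => I)).
Qed.

Lemma Ck_switch_dev : Ck 2 setT switch_dev.
Proof.
apply: (Ck_mul openT Ck_window); apply: (Ck_sub_fun openT).
  exact: (Ck_ramp _ _ cadd).
exact: (Ck_ramp _ _ (Ck_fst 2 setT)).
Qed.

Definition circle_ext (f : R * R -> R) (q : R * R) : R := perext snd (0, P) P f q.

Let sndD (x y : R * R) : (x + y).2 = x.2 + y.2. Proof. by []. Qed.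
Let sndZ (a : R) (x : R * R) : (a *: x).2 = a * x.2. Proof. by []. Qed.
Let snd_tau : ((0, P) : R * R).2 = P. Proof. by []. Qed.
Let csnd : continuous (snd : R * R -> R). Proof. by move=> x; exact: cvg_snd. Qed.

Lemma circle_ext_period f t x : circle_ext f (t, x + P) = circle_ext f (t, x).
Proof.
have -> : (t, x + P) = (t, x) + (0, P) by transitivity (t + 0, x + P) => //; rewrite addr0.
exact: (perext_period P0 sndD snd_tau).
Qed.

Lemma circle_ext_at f t x (k : int) : 0 <= x - k%:~R * P < P ->
  circle_ext f (t, x) = f (t, x - k%:~R * P).
Proof.
move=> h; rewrite /circle_ext /perext (turn_unique P0 (k := k)) /=; last by rewrite intrD; plra.
congr (f _); transitivity (t - k%:~R * 0, x - k%:~R * P) => //; by rewrite mulr0 subr0.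
Qed.

Lemma circle_reduce (x : R) : exists k : int, 0 <= x - k%:~R * P < P.
Proof.
exists (Num.floor (x / P)).
have := @turn_itv R _ (snd : R * R -> R) P P0 (0, x); rewrite /turn/=; plra.
Qed.

Lemma Ck_circle_ext (f : R * R -> R) (m : R) : Ck 2 setT f ->
  (forall t y : R, y <= 0 -> f (t, y) = 0) -> (forall t y : R, P <= y -> f (t, y) = 0) -> Ck 2 setT (fun q => circle_ext f (q - (0, m))).
Proof.
move=> cf f0 fP.
have h0 (q : R * R) : q.2 <= 0 -> f q = 0 by case: q => t y; exact: f0.
have hP (q : R * R) : P <= q.2 -> f q = 0 by case: q => t y; exact: fP.
exact: (Ck_shift (- (0, m)) (Ck_perext P0 csnd sndD sndZ snd_tau cf h0 hP)).
Qed.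

Variable m : R.
Local Notation T := (3 * P).

(* The last term makes the two time-reversed halves agree on [P <= t <= 2 P]. *)
Definition position (q : R * R) : R :=
  q.2 + circle_ext shift_dev (q - (0, m)) + circle_ext shift_dev ((T - q.1, q.2) - (0, m))
  - circle_ext shift_dev ((T / 2, q.2) - (0, m)).

Definition progress (q : R * R) : R := clock q.1 + circle_ext switch_dev (q - (0, m)).

Let pairB (t x : R) : (t, x) - (0, m) = (t, x - m) :> R * R.
Proof. by transitivity (t - 0, x - m) => //; rewrite subr0. Qed.

Lemma position_period (t x : R) : position (t, x + P) = position (t, x) + P.
Proof.
by rewrite /position/= !pairB !(addrAC x P) !circle_ext_period; ring.
Qed.

Lemma progress_period (t x : R) : progress (t, x + P) = progress (t, x).
Proof. by rewrite /progress/= !pairB !(addrAC x P) !circle_ext_period. Qed.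

Lemma Ck_position : Ck 2 setT position.
Proof.
have ce : Ck 2 setT (fun q => circle_ext shift_dev (q - (0, m))).
  apply: Ck_circle_ext; first exact: Ck_shift_dev.
    by move=> t y h; rewrite /shift_dev/= window_l ?mul0r//; plra.
  by move=> t y h; rewrite /shift_dev/= window_r ?mul0r//; plra.
pose L (a b : R) (q : R * R) := (a + b * q.1, q.2).
have cl a b : Ck 2 setT (fun q => circle_ext shift_dev (L a b q - (0, m))).
  apply: (Ck_affine (L := L a b) (L0 := L 0 b) _ _ ce) => [q|h v q].
    have c1 : {for q, continuous (fun q : R * R => a + b * q.1)}.
      exact: (cvgD (cvg_cst a) (cvgM (cvg_cst b) (@cvg_fst _ _ _ _ _))).
    exact: (cvg_pair c1 (@cvg_snd _ _ _ _ _)).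
  transitivity (a + b * (h * v.1 + q.1), h * v.2 + q.2) => //.
  transitivity (h * (0 + b * v.1) + (a + b * q.1), h * v.2 + q.2) => //.
  by congr pair; ring.
have c3 := Ck_sub_fun openT (Ck_add openT (Ck_add openT (Ck_snd 2 setT) ce) (cl T (-1))) (cl (T / 2) 0).
apply: (Ck_eq openT _ c3) => -[t x] _.
by rewrite /position /L/= mulN1r mul0r addr0.
Qed.

Lemma Ck_progress : Ck 2 setT progress.
Proof.
apply: (Ck_add openT); first exact: (Ck_ramp _ _ (Ck_fst 2 setT)).
apply: Ck_circle_ext; first exact: Ck_switch_dev.
  by move=> t y h; rewrite /switch_dev/= window_l ?mul0r//; plra.
by move=> t y h; rewrite /switch_dev/= window_r ?mul0r//; plra.
Qed.

Lemma progress_early (t x : R) : t <= P -> progress (t, x) = 0.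
Proof.
move=> tP; have [k hk] := circle_reduce (x - m).
by rewrite /progress/= pairB (circle_ext_at _ _ hk) switch_dev_early// /clock ramp0// addr0.
Qed.

Lemma progress_late (t x : R) : 2 * P <= t -> progress (t, x) = 1.
Proof.
move=> tP; have [k hk] := circle_reduce (x - m).
by rewrite /progress/= pairB (circle_ext_at _ _ hk) switch_dev_late// /clock ramp1 ?addr0//; plra.
Qed.

Lemma positionE (t x : R) (k : int) : 0 <= x - m - k%:~R * P < P -> position (t, x) = x +
  shift_dev (t, x - m - k%:~R * P) + shift_dev (T - t, x - m - k%:~R * P)
  - shift_dev (T / 2, x - m - k%:~R * P).
Proof. by move=> hk; rewrite /position/= !pairB !(circle_ext_at _ _ hk). Qed.

Lemma position_early (t x : R) : t <= e / 2 -> position (t, x) = x.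
Proof.
move=> te; have [k hk] := circle_reduce (x - m).
rewrite (positionE _ hk) shift_dev_early// !shift_dev_late; [ring|plra|plra].
Qed.

Lemma position_late (t x : R) : T - e / 2 <= t -> position (t, x) = x.
Proof.
move=> te; have [k hk] := circle_reduce (x - m).
rewrite (positionE _ hk) (@shift_dev_early (T - t)); last plra.
by rewrite !shift_dev_late; [ring|plra|plra].
Qed.

Section Free.
Variables (k : int) (t x : R).
Let c := m + k%:~R * P.
Hypothesis free : e <= x - c <= P - e.

Let yE : x - m - k%:~R * P = x - c. Proof. by rewrite /c; ring. Qed.
Let red : 0 <= x - m - k%:~R * P < P.
Proof. by rewrite yE; have := e0; have := free; plra. Qed.
Let free' : e <= x - m - k%:~R * P <= P - e. Proof. by rewrite yE. Qed.

(** The three time ranges overlap in intervals of length e around P and 2 P, so every time has an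
    open neighbourhood on which a single formula holds, as second derivatives require. *)
Lemma position_free1 : t < P + e / 2 ->
  position (t, x) = x + fwd_profile (x - c + t) + bwd_profile (x - c - t).
Proof.
move=> ht; rewrite (positionE _ red) (@shift_dev_free t)//.
by rewrite !shift_dev_late; [rewrite yE; ring|plra|plra].
Qed.

Lemma position_free2 : P - e / 2 < t < 2 * P + e / 2 -> position (t, x) = c.
Proof.
move=> ht; rewrite (positionE _ red) !shift_dev_free_late// ?yE; plra.
Qed.

Lemma position_free3 : 2 * P - e / 2 < t ->
  position (t, x) = x + fwd_profile (x - c + (T - t)) + bwd_profile (x - c - (T - t)).
Proof.
move=> ht; rewrite (positionE _ red) (@shift_dev_free (T - t))//.
by rewrite !shift_dev_late; [rewrite yE; ring|plra|plra].
Qed.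

Lemma progress_free : progress (t, x) = switch (x - c + t).
Proof.
rewrite /progress/= pairB (circle_ext_at _ _ red) /switch_dev/= window1// mul1r yE; ring.
Qed.

(** The start [2 * P - e / 2] and the width [e] in [switch] are made for this: with e <= y <= P - e,
    the argument y + t is still before the ramp when t < P + e / 2 and already past it when t > 2 P
    - e / 2. *)
Lemma progress_free1 : t < P + e / 2 -> progress (t, x) = 0.
Proof. by move=> ht; rewrite progress_free /switch ramp0//; have := free; plra. Qed.

Lemma progress_free3 : 2 * P - e / 2 < t -> progress (t, x) = 1.
Proof. by move=> ht; rewrite progress_free /switch ramp1//; have := free; plra. Qed.

End Free.

End Profiles.

Lemma open_box (R : realType) (a b c d : R) :
  open [set q : R * R | a < q.1 < b /\ c < q.2 < d].
Proof.
rewrite openE => -[t x] /= [ht hx].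
exists (`]a, b[%classic, `]c, d[%classic) => /=.
  split; apply: open_nbhs_nbhs; split=> //=; try exact: itv_open; by rewrite /= in_itv.
by move=> [t' x'] /= [] ; rewrite /= !in_itv.
Qed.

(** * The controlled map: its equation off omega and its end states *)

Section ControlledMap.
Context {R : realType} {N : nat}.
Variables (M : set 'rV[R]_N) (n : nat).
Hypotheses (cM : compact M) (M0 : M !=set0) (sM : embedded_submanifold n M).
Local Notation P := (@period R).
Local Notation T := (3 * P).

(** [second_ff] of the velocity is the normal part of the acceleration, so the geodesic equation
    removes the tangential part. *)
Lemma closed_geodesic_tanproj g x : closed_geodesic M g ->
  tanproj M (g x) ('D_1 ('D_1 g) x) = 0.
Proof.
move=> [_ cg Mg hg].
have E : derive1 g = 'D_1 g by apply/funext => y; rewrite derive1E.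
have d1 (y : R) : is_derive y 1 g ('D_1 g y) by apply: derivableP; exact: (Ck_derivable cg I).
have cg1 : Ck 1 setT ('D_1 g) := Ck_derive (1 : R) cg.
have d2 : is_derive x 1 ('D_1 g) ('D_1 ('D_1 g) x) by apply: derivableP; exact: (Ck_derivable cg1 I).
have := hg x; rewrite E derive1E (second_ff_curve cM M0 sM Mg d1 d2).
by rewrite opprB addrC subrK.
Qed.

Lemma tanproj_scale p a v : M p -> tanproj M p (a *: v) = a *: tanproj M p v.
Proof.
move=> Mp; have Tp := sub_tube cM M0 sM Mp.
rewrite (tanprojE cM M0 sM _ Mp) (tanprojE cM M0 sM v Mp).
exact: (derive_rowZ _ _ (@tube_open _ _ M) (tube_smooth M 1) Tp).
Qed.

Variables (e m : R) (l : nat) (g : nat -> R -> 'rV[R]_N).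
Hypotheses (e0 : 0 < e) (eP : 4 * e <= P)
  (cg : forall j, Ck 2 setT (g j)) (pg : forall j, periodic (g j) P)
  (gU : forall z x, tube M (telescope_blend l (g^~ x) z))
  (geo0 : closed_geodesic M (g 0%N)) (geo1 : closed_geodesic M (g l)).
Local Notation position := (position P e m).
Local Notation progress := (progress P e m).

(** [telescope_blend l] runs through its sequence as the parameter goes from 0 to [l], hence the
    rescaled progress. *)
Definition control_map (q : R * R) : 'rV[R]_N :=
  nearest M (telescope_blend l (g^~ (position q)) (l%:R * progress q)).

Lemma Ck_control_map : Ck 2 setT control_map.
Proof.
have ca j : Ck 2 setT (fun q => g j (position q)).
  exact: (Ck_comp_scalar openT openT (cg j) (Ck_position e0 eP m) (fun _ _ => I)).
have cz := Ck_mul openT (Ck_cst 2 setT (l%:R : R)) (Ck_progress e0 eP m).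
exact: (Ck_comp_row (@tube_open _ _ M) openT (tube_smooth M 2) (Ck_telescope l openT cz ca) (fun q _ => gU _ _)).
Qed.

Lemma control_map_in q : M (control_map q). Proof. exact: nearest_in. Qed.

Lemma control_map_period q : control_map (q + (0, P)) = control_map q.
Proof.
case: q => t x; have -> : (t, x) + (0, P) = (t, x + P).
  by transitivity (t + 0, x + P) => //; rewrite addr0.
rewrite /control_map (position_period e0 eP m) (progress_period e0 eP m).
have -> : (g^~ (position (t, x) + P)) = g^~ (position (t, x)) by apply/funext => j; exact: pg.
by [].
Qed.

Lemma control_map_start t x : progress (t, x) = 0 -> control_map (t, x) = g 0%N (position (t, x)).
Proof.
move=> h; rewrite /control_map h mulr0 telescope_blend_le0// nearest_id//.
by have [_ _ Mg _] := geo0.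
Qed.

Lemma control_map_end t x : progress (t, x) = 1 -> control_map (t, x) = g l (position (t, x)).
Proof.
move=> h; rewrite /control_map h mulr1 telescope_blend_ge// nearest_id//.
by have [_ _ Mg _] := geo1.
Qed.

Lemma control_map_early t x : t <= e / 2 -> control_map (t, x) = g 0%N x.
Proof.
move=> h; rewrite control_map_start ?(position_early e0 eP)//.
by apply: (progress_early e0 eP); move: (e0) (eP) => ? ?; lra.
Qed.

Lemma control_map_late t x : T - e / 2 <= t -> control_map (t, x) = g l x.
Proof.
move=> h; rewrite control_map_end ?(position_late e0 eP)//.
by apply: (progress_late e0 eP); move: (e0) (eP) => ? ?; lra.
Qed.

Section Free.
Variable k : int.
Let c := m + k%:~R * P.

(** By [wave_box_comp] the d'Alembertian is 4 A' B' times the acceleration of [kap]. It is normal to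
    [M] if [kap] is a geodesic, and zero if [B] is constant, that is, for a wave moving in one
    direction. *)
Lemma wave_box_free (kap : R -> 'rV[R]_N) (A B : R -> R) (a b t x : R) :
  a < t < b -> e < x - c < P - e ->
  Ck 2 setT kap -> Ck 2 setT A -> Ck 2 setT B ->
  (forall t x : R, a < t < b -> e < x - c < P - e ->
     control_map (t, x) = kap (A (x + t) + B (x - t))) ->
  ((forall z, tanproj M (kap z) ('D_1 ('D_1 kap) z) = 0) \/ forall z, 'D_1 B z = 0) ->
  tanproj M (control_map (t, x)) (wave_box control_map (t, x)) = 0.
Proof.
move=> ht hx ckap cA cB E H.
pose D := [set q : R * R | a < q.1 < b /\ c + e < q.2 < c + (P - e)].
have Dq : D (t, x) by split=> //=; lra.
have ED p : D p -> control_map p = kap (A (p.2 + p.1) + B (p.2 - p.1)).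
  by case: p => t' x' [/= h1 h2]; apply: E => //; lra.
have Mq := control_map_in (t, x).
rewrite (wave_box_comp Ck_control_map ckap cA cB (@open_box R a b (c + e) (c + (P - e))) Dq ED).
rewrite (tanproj_scale _ _ Mq) /=; case: H => [H|H]; last by rewrite H mulr0 scale0r.
have := H (A (x + t) + B (x - t)); rewrite -(E _ _ ht hx) => ->.
by rewrite scaler0.
Qed.

(** The identity splits as x = (x + t) / 2 + (x - t) / 2, which lets x plus the two profiles fit the
    form A(x + t) + B(x - t). *)
Let Ck_half (f : R -> R) (d : R) : Ck 2 setT f -> Ck 2 setT (fun z : R => z / 2 + f (z - d)).
Proof.
move=> cf; apply: (Ck_add openT).
  exact: (Ck_mul openT (Ck_id 2 setT) (Ck_cst 2 setT (2^-1 : R))).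
exact: (Ck_shift (- d) cf).
Qed.

Lemma control_map_free (t x : R) : e < x - c < P - e ->
  tanproj M (control_map (t, x)) (wave_box control_map (t, x)) = 0.
Proof.
move=> hx; have weak (y : R) : e < y < P - e -> e <= y <= P - e by move=> h; lra.
have cF := Ck_fwd_profile P e; have cB := Ck_bwd_profile e.
have [t1|t1] := ltP t (P + e / 2).
  have ht : t - 1 < t < P + e / 2 by lra.
  apply: (wave_box_free ht hx (cg 0%N) (Ck_half c cF) (Ck_half c cB)).
    move=> s y hs hy; have hs2 : s < P + e / 2 by lra.
    rewrite control_map_start ?(progress_free1 e0 eP (weak _ hy))//.
    rewrite (position_free1 e0 eP (weak _ hy))// -/c; congr (g 0%N _).
    have -> : y - c + s = y + s - c by ring.
    have -> : y - c - s = y - s - c by ring.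
    move: (bwd_profile _ _) (fwd_profile _ _ _) => u v; lra.
  by left=> z; exact: closed_geodesic_tanproj.
have [t2|t2] := ltP t (2 * P + e / 2).
  (* In the middle phase the position is frozen at [c], and the map is this curve evaluated at x +
     t. *)
  pose kap z := nearest M (telescope_blend l (g^~ c) (l%:R * switch P e (z - c))).
  have ht : P - e / 2 < t < 2 * P + e / 2 by move: (e0) => ?; lra.
  have ck : Ck 2 setT kap.
    have cz : Ck 2 setT (fun z => l%:R * switch P e (z - c)).
      apply: (Ck_mul openT (Ck_cst 2 setT (l%:R : R))).
      exact: (Ck_ramp _ _ (Ck_sub_fun openT (Ck_id 2 setT) (Ck_cst 2 setT c))).
    exact: (Ck_comp_row (@tube_open _ _ M) openT (tube_smooth M 2)
      (Ck_telescope l openT cz (fun j => Ck_cst 2 setT (g j c))) (fun z _ => gU _ _)).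
  apply: (wave_box_free ht hx ck (Ck_id 2 setT) (Ck_cst 2 setT (0 : R))).
    move=> s y hs hy.
    rewrite /control_map (progress_free e0 eP _ (weak _ hy)) (position_free2 e0 eP (weak _ hy) hs) -/c.
    by rewrite addr0 /kap; have -> : y - c + s = y + s - c by ring.
  by right=> z; rewrite derive_cst.
have ht : 2 * P - e / 2 < t < t + 1 by move: (e0) => ?; lra.
(* Time reversal exchanges the null coordinates: [bwd_profile] now depends on x + t and
   [fwd_profile] on x - t, with shifts by [T]. *)
apply: (wave_box_free ht hx (cg l) (Ck_half (c + T) cB) (Ck_half (c - T) cF)).
  move=> s y hs hy; have hs2 : 2 * P - e / 2 < s by lra.
  rewrite control_map_end ?(progress_free3 e0 eP (weak _ hy))//.
  rewrite (position_free3 e0 eP (weak _ hy))// -/c; congr (g l _).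
  have -> : y - c + (T - s) = y - s - (c - T) by ring.
  have -> : y - c - (T - s) = y + s - (c + T) by ring.
  move: (bwd_profile _ _) (fwd_profile _ _ _) => u v; lra.
by left=> z; exact: closed_geodesic_tanproj.
Qed.

End Free.

(** The map is defined for all real times and rests on an open set of times around 0 and around [T],
    so the velocity at both ends is an ordinary two-sided derivative. *)
Lemma control_map_velocity (U : set R) (t x : R) v : open U -> U t ->
  (forall s, U s -> control_map (s, x) = v) -> 'D_(1, 0) control_map (t, x) = 0.
Proof.
move=> oU Ut E.
have d1 := derive_slice_time (Ck_derivable Ck_control_map (I : setT (t, x))) (t := t) (x := x).
exact: (near_is_derive_eq (open_near oU Ut E) d1 (is_derive_cst v t 1)).
Qed.

Lemma control_map_carries omega :
  (forall x, ~ omega x -> exists k : int, e < x - (m + k%:~R * P) < P - e) ->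
  C0L2 T (fun t x => wave_box control_map (t, x)) /\
  flow_carries M omega T (fun t x => wave_box control_map (t, x)) (g 0%N) (fun=> 0) (g l) (fun=> 0).
Proof.
move=> homega; have P0 := @period_gt0 R; have T0 : 0 < T by lra.
have free t x : ~ omega x -> tanproj M (control_map (t, x)) (wave_box control_map (t, x)) = 0.
  by move=> /homega[k hk]; exact: (control_map_free _ hk).
have [h1 h2] := wave_map_of_map cM M0 sM Ck_control_map control_map_in control_map_period T0 free.
split; first exact: h1.
exists (fun t x => control_map (t, x)), (fun t x => 'D_(0, 1) control_map (t, x)),
  (fun t x => 'D_(1, 0) control_map (t, x)).
split; first exact: h2.
- by move=> x; rewrite control_map_early//; move: (e0) => ?; lra.
- apply: aeW => x; apply: (@control_map_velocity [set s | s < e / 2] _ _ (g 0%N x)).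
  + exact: open_lt.
  + by rewrite /= divr_gt0.
  + by move=> s /= h; rewrite control_map_early// ltW.
- by move=> x; rewrite control_map_late//; move: (e0) => ?; lra.
- apply: aeW => x; apply: (@control_map_velocity [set s | T - e / 2 < s] _ _ (g l x)).
  + exact: open_gt.
  + by rewrite /=; move: (e0) => ?; lra.
  + by move=> s /= h; rewrite control_map_late// ltW.
Qed.

End ControlledMap.

(** The interval of radius [r] around [m] lies in omega and e < r, so a point off omega, reduced to
    one period starting at [m], stays more than [e] away from both ends. *)
Lemma outside_circle_set (R : realType) (omega : set R) (m e r : R) : circle_set omega -> 0 < e < r ->
  4 * e <= period ->
  (forall x, `|x - m| < r -> omega x) ->
  forall x, ~ omega x -> exists k : int, e < x - (m + k%:~R * period) < period - e.
Proof.
move=> co er eP hm x nx; have e0 : 0 < e by case/andP: er.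
have [k hk] := circle_reduce e0 eP (x - m).
(* The indicator function turns invariance under one period into invariance under all integer
   multiples, by [periodic_intr]. *)
have pind : periodic (\1_omega : R -> R) period.
  by move=> y; rewrite !indicE; congr (nat_of_bool _)%:R; apply/idP/idP => /set_mem /co /mem_set.
have shifted (j : int) : ~ omega (x - j%:~R * period).
  move=> oj; have := periodic_intr x j pind; rewrite !indicE (mem_set oj) memNset//.
  by move=> /eqP; rewrite /= oner_eq0.
(* A point too close to the left end is near [m] after [k] turns, one too close to the right end
   after [k + 1] turns. *)
exists k; apply/andP; split; rewrite ltNge; apply/negP => h.
  by apply: (shifted k); apply: hm; rewrite ltr_norml; lra.
by apply: (shifted (k + 1)); apply: hm; rewrite intrD ltr_norml; lra.
Qed.

Theorem proposition1p5 (R : realType) (n N : nat) (M : set 'rV[R]_N)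
    (omega : set R) :
  embedded_submanifold n M -> compact M -> orientable n M ->
  open omega -> omega !=set0 -> circle_set omega ->
  forall gamma0 gamma1 : R -> 'rV[R]_N,
  closed_geodesic M gamma0 -> closed_geodesic M gamma1 ->
  homotopic M gamma0 gamma1 ->
  exists f : R -> R -> 'rV[R]_N,
    C0L2 (6 * pi) f /\
    flow_carries M omega (6 * pi) f
      gamma0 (fun=> 0) gamma1 (fun=> 0).
Proof.
move=> sM cM _ oomega [m mo] co g0 g1 geo0 geo1 [H [cH pH MH H0 H1]].
have [pg0 cg0 Mg0 _] := geo0; have [pg1 cg1 _ _] := geo1.
have M0 : M !=set0 by exists (g0 0).
have [l [g [cg pg E0 E1 gU]]] := homotopy_blend (@period_gt0 R) cM (@tube_open _ _ M) (sub_tube cM M0 sM) cH pH MH H0 H1 cg0 cg1 pg0 pg1.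
have [r /= r0 hr] : exists2 r : R, 0 < r & forall x, `|x - m| < r -> omega x.
  have /nbhs_ballP[r /= r0 hr] := open_nbhs_nbhs (conj oomega mo).
  by exists r => // x h; apply: hr; rewrite /ball/= distrC.
have pi0 := @pi_gt0 R.
(* The bound by [r] keeps the exceptional arc inside omega; the bound by [pi] gives 4 e <= 2 pi. *)
pose e := Num.min r pi / 2.
have e0 : 0 < e by rewrite /e divr_gt0// lt_min r0.
have er : e < r by rewrite /e ltr_pdivrMr// gt_min; apply/orP; left; lra.
have eP : 4 * e <= period by rewrite /e /period; have : Num.min r pi <= pi by [rewrite ge_min lexx orbT]; lra.
have ee : 0 < e < r by rewrite e0.
rewrite -E0 in geo0 *; rewrite -E1 in geo1 *.
have -> : 6 * pi = 3 * period :> R by rewrite /period; ring.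
exists (fun t x => wave_box (control_map M e m l g) (t, x)).
exact: (control_map_carries cM M0 sM e0 eP cg pg gU geo0 geo1 (outside_circle_set co ee eP hr)).
Qed.
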